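(* Let $r\ge1$. Assume that $u\in H^1_0(\Omega)\cap H^{r+1}_{\mathcal P}(\Omega)$ is the solution of $$-(\alpha u')'+\beta u'+\gamma u=f\ \text{ in }\Omega,\qquad u(a)=u(b)=0,$$ and that $u_{\mathcal P}\in U^r_{\mathcal P}$ is the solution of the finite volume scheme $a_{\mathcal P}(u_{\mathcal P},w)=\int_a^bfw\,dx$ for all $w\in V_{\mathcal P'}$, where the mesh size $h$ is sufficiently small. Then $$\|u-u_{\mathcal P}\|_{H^1(\Omega)}\le C\,h^r\,|u|_{r+1,\mathcal P},$$ where the constant $C$ is independent of $\mathcal P$ (and of $u$).
   Context: Coefficients. $\Omega=(a,b)$ is a bounded interval; $\alpha,\beta,\gamma\in L^\infty(\bar\Omega)$, $\alpha$ continuous on $[a,b]$, $\beta$ weakly differentiable, $\alpha\ge\alpha_0>0$, $\gamma-\tfrac12\beta'\ge\kappa>0$; $f$ is a real-valued (integrable) function. A solution $u$ has $\alpha u'$ absolutely continuous on $[a,b]$ and satisfies the equation a.e. Primal mesh. For $a=x_0<\dots<x_N=b$ put $\tau_i=[x_{i-1},x_i]$, $h_i=x_i-x_{i-1}$, $h=\max_ih_i$, $\mathcal P=\{\tau_i\}_{i=1}^N$ (arbitrary, no quasi-uniformity). The trial space is $U^r_{\mathcal P}=\{v\in C([a,b]): v|_{\tau_i}$ is a polynomial of degree $\le r$ for each $i$, $v(a)=v(b)=0\}$. Broken spaces: $H^m_{\mathcal P}(\Omega)=\{v\in C(\Omega): v|_{\tau_i}\in H^m(\tau_i)\ \forall i\}$,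 with seminorms $|v|_{j,\mathcal P}^2=\sum_i\|v^{(j)}\|_{L^2(\tau_i)}^2$. Dual mesh. Let $G_1<\dots<G_r$ be the zeros in $[-1,1]$ of the Legendre polynomial of degree $r$; $g_{i,j}=\tfrac12(x_i+x_{i-1}+h_iG_j)$ for $1\le i\le N$, $1\le j\le r$, and $g_{i,r+1}=g_{i+1,1}$ for $1\le i\le N-1$. Put $r_i=r$ for $i\le N-1$ and $r_N=r-1$. The test space $V_{\mathcal P'}$ consists of $w=\sum_{i=1}^N\sum_{j=1}^{r_i}w_{i,j}\chi_{[g_{i,j},g_{i,j+1}]}$, $w_{i,j}\in\mathbb R$. With $w_{1,0}=0$, $w_{N,r}=0$, $w_{i,0}=w_{i-1,r}$ ($2\le i\le N$), the jumps are $[w_{i,j}]=w_{i,j}-w_{i,j-1}$ for $1\le i\le N$, $1\le j\le r$. Bilinear form. $$a_{\mathcal P}(v,w)=\sum_{i=1}^N\sum_{j=1}^r[w_{i,j}]\,\alpha(g_{i,j})v'(g_{i,j})+\sum_{i=1}^N\sum_{j=1}^{r_i}w_{i,j}\int_{g_{i,j}}^{g_{i,j+1}}\big(\beta v'+\gamma v\big)\,dx .$$ ''$h$ sufficiently small'' means $h\le h_0$ with $h_0>0$ depending only on $r,\Omega,\alpha,\beta,\gamma$; $C$ may depend on $r,\Omega,\alpha,\beta,\gamma$. *)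

(* Defs.v *)
From HB Require Import structures.
From mathcomp Require Import all_boot all_order all_algebra.
From mathcomp Require Import all_classical all_reals all_analysis.

Set Implicit Arguments.
Unset Strict Implicit.
Unset Printing Implicit Defensive.

Import Order.TTheory GRing.Theory Num.Theory.
Import numFieldNormedType.Exports.

Local Open Scope classical_set_scope.
Local Open Scope ring_scope.

Section FunctionSpaces.
Context {R : realType}.
Implicit Types (c d : R) (v g phi : R -> R) (D : set R).

Local Notation mu := (@lebesgue_measure R).

Definition Lnorm_on (p : \bar R) D v : \bar R := 'N[mu]_p[EFin \o (v \_ D)]%E.

Definition in_Lp (p : \bar R) D v :=
  measurable_fun D v /\ (Lnorm_on p D v < +oo)%E.

(* C_c^oo(c, d) *)
Definition test_function c d phi :=
  [/\ forall n x, derivable (derive1n n phi) x 1,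
      compact (closure [set x | phi x != 0]) &
      closure [set x | phi x != 0] `<=` `]c, d[].

Definition is_weak_derivative c d (j : nat) v g :=
  [/\ locally_integrable `]c, d[ v,
      locally_integrable `]c, d[ g &
      forall phi, test_function c d phi ->
        \int[mu]_(x in `]c, d[) (v x * derive1n j phi x)
        = (-1) ^+ j * \int[mu]_(x in `]c, d[) (g x * phi x)].

(* A representative of the j-th weak derivative, which is unique up to a null
   set; the value is the junk function 0 when there is no weak derivative. *)
Definition weak_derivative c d (j : nat) v : R -> R :=
  xget (fun=> 0) [set g | is_weak_derivative c d j v g].

(* H^m(c, d) *)
Definition sobolev c d (m : nat) v :=
  forall j, (j <= m)%N ->
    exists2 g, is_weak_derivative c d j v g & in_Lp 2%:E `]c, d[ g.

(* H^1_0(c, d), for the continuous representative on [c, d] *)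
Definition sobolev10 c d v :=
  [/\ sobolev c d 1 v, {within `[c, d], continuous v}, v c = 0 & v d = 0].

Definition H1norm c d v : \bar R :=
  ((Lnorm_on 2%:E `]c, d[ v ^+ 2
    + Lnorm_on 2%:E `]c, d[ (weak_derivative c d 1 v) ^+ 2) `^ 2^-1)%E.

Definition absolutely_continuous c d v :=
  forall e, 0 < e -> exists2 delta, 0 < delta &
    forall (n : nat) (s t : nat -> R),
      (forall k, (k < n)%N -> c <= s k /\ s k <= t k /\ t k <= d) ->
      trivIset `I_n (fun k => `]s k, t k[%classic) ->
      \sum_(k < n) (t k - s k) < delta ->
      \sum_(k < n) `|v (t k) - v (s k)| < e.

(* u solves - (alpha u')' + beta u' + gamma u = f a.e. on (c, d); q is the
   absolutely continuous representative of alpha u', and dq = q'. *)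
Definition solves_ode c d (alpha beta gamma f u : R -> R) :=
  let du := weak_derivative c d 1 u in
  exists q dq : R -> R,
    [/\ absolutely_continuous c d q,
        {ae mu, forall x, x \in `]c, d[ -> alpha x * du x = q x},
        is_weak_derivative c d 1 q dq &
        {ae mu, forall x, x \in `]c, d[ ->
           - dq x + beta x * du x + gamma x * u x = f x}].

End FunctionSpaces.

Section GaussNodes.
Variable R : realType.

(* Rodrigues' formula *)
Definition legendre (r : nat) : {poly R} :=
  (2 ^+ r * r`!%:R)^-1 *: derivn r (('X^2 - 1) ^+ r).

Definition gauss_nodes (r : nat) (G : nat -> R) :=
  (forall j, (1 <= j < r)%N -> G j < G j.+1) /\
  (forall t, (-1 <= t <= 1 /\ root (legendre r) t) <->
             exists2 j, (1 <= j <= r)%N & t = G j).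

End GaussNodes.

Section FiniteVolume.
Context {R : realType}.
(* The mesh points are x 0 < ... < x N, the i-th element (1 <= i <= N) is
   [x i.-1, x i], and G 1 < ... < G r are the Gauss nodes; values of these
   sequences at other indices are irrelevant. *)
Implicit Types (a b : R) (x G : nat -> R) (N r i j m : nat) (v : R -> R).
Implicit Types (w : nat -> nat -> R).

Local Notation mu := (@lebesgue_measure R).

Definition is_mesh a b N x :=
  [/\ x 0%N = a, x N = b & forall i, (1 <= i <= N)%N -> x i.-1 < x i].

Definition mesh_size N x : R :=
  \big[Num.max/0]_(1 <= i < N.+1) (x i - x i.-1).

Definition trial_space a b N x r v :=
  [/\ {within `[a, b], continuous v},
      (forall i, (1 <= i <= N)%N -> exists2 p : {poly R}, (size p <= r.+1)%N &
         {in `[x i.-1, x i], forall t, v t = p.[t]}),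
      v a = 0 & v b = 0].

Definition broken_sobolev a b N x m v :=
  {within `]a, b[, continuous v} /\
  forall i, (1 <= i <= N)%N -> sobolev (x i.-1) (x i) m v.

Definition broken_seminorm N x j v : \bar R :=
  ((\sum_(1 <= i < N.+1)
      Lnorm_on 2%:E `]x i.-1, x i[ (weak_derivative (x i.-1) (x i) j v) ^+ 2)
   `^ 2^-1)%E.

Definition gauss_pt x r G i j : R :=
  let g k l := (x k + x k.-1 + (x k - x k.-1) * G l) / 2 in
  if j == r.+1 then g i.+1 1%N else g i j.

Definition ndof N r i : nat := if i == N then r.-1 else r.

(* The test functions are encoded by their coefficients w i j, for
   1 <= i <= N and 1 <= j <= ndof N r i. *)
Definition test_fun N x r G w : R -> R := fun t =>
  \sum_(1 <= i < N.+1) \sum_(1 <= j < (ndof N r i).+1)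
    w i j * \1_(`[gauss_pt x r G i j, gauss_pt x r G i j.+1]%classic) t.

(* Coefficients extended by w_{1,0} = w_{N,r} = 0 and w_{i,0} = w_{i-1,r} *)
Definition coef_ext N r w i j : R :=
  if j == 0%N then (if i == 1%N then 0 else w i.-1 r)
  else if (i == N) && (j == r) then 0 else w i j.

Definition jump N r w i j : R := coef_ext N r w i j - coef_ext N r w i j.-1.

Definition fv_form (alpha beta gamma : R -> R) N x r G v w : R :=
  \sum_(1 <= i < N.+1) \sum_(1 <= j < r.+1)
    jump N r w i j * (alpha (gauss_pt x r G i j)
                      * derive1 v (gauss_pt x r G i j))
  + \sum_(1 <= i < N.+1) \sum_(1 <= j < (ndof N r i).+1)
      w i j * \int[mu]_(t in `[gauss_pt x r G i j, gauss_pt x r G i j.+1])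
                (beta t * derive1 v t + gamma t * v t).

Definition fv_solution a b (alpha beta gamma f : R -> R) N x r G v :=
  trial_space a b N x r v /\
  forall w, fv_form alpha beta gamma N x r G v w
            = \int[mu]_(t in `[a, b]) (f t * test_fun N x r G w t).

End FiniteVolume.

(* Main.v *)
(* Let [p] interpolate [u] on the mesh by polynomials of degree at most [r],
   with [|u' - p'| <= H_i] on the i-th element; Taylor's formula for [u'] with
   remainder in the derivative of order [r + 1] gives
   [sum_i h_i H_i ^ 2 <= C h ^ (2 r) |u| ^ 2].

   Abel summation turns the scheme, subtracted from the equation integrated
   from [a] to the Gauss points, into an identity for [e = uP - p], weighted by
   an arbitrary family [J] of zero sum on the Gauss points. Take for [J] the
   Gauss weights times [e']. The first terms then sum to at least
   [alpha0 |e'| ^ 2], since the quadrature is exact on polynomials of degree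
   at most [2 r - 1]. The integral terms amount to integrating
   [beta e' + gamma e] against a step function which is within
   [O(h_i sup |e'|)] of [e] on each element, and the integral against [e]
   itself is nonnegative by coercivity. For small [h] this gives
   [sum_i h_i sup_i |e'| ^ 2 <= C sum_i h_i H_i ^ 2].

   Weak derivatives are handled through test functions which are differences
   of steepening smooth steps: they show that a function with a weak derivative
   [g] has increments equal to the integrals of [g] between Lebesgue points. *)

Require Import Defs.
From HB Require Import structures.
From mathcomp Require Import all_boot all_order all_algebra.
From mathcomp Require Import all_classical all_reals all_analysis.
From mathcomp Require Import measurable_realfun ring lra.
Set Implicit Arguments.
Unset Strict Implicit.
Unset Printing Implicit Defensive.
Import Order.TTheory GRing.Theory Num.Theory.
Import numFieldNormedType.Exports.
Local Open Scope classical_set_scope.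
Local Open Scope ring_scope.

(** * Gauss quadrature *)

Section PolynomialIntegral.
Variable R : realType.
Implicit Types p q : {poly R}.

(** A zero sum is exactly what makes [J] the jump family of a test function: the coefficients are
    the partial sums of [J], and the last one must vanish. For the Gauss weights times e', exactness
    turns the partial sums over whole elements into the values of e at the mesh points and the total
    into e(b) - e(a). This is why p has to match u at every mesh point.

    Locally, e' is measured by a majorant of its sup norm, because the scheme sees derivatives only
    at Gauss points. A polynomial of degree below r is controlled by its values at the r nodes, with
    a constant fixed on [-1, 1] and therefore the same for all elements. Adding increments from a
    then bounds e itself.

    Coercivity is the delicate point: beta has only a weak derivative, and e^2, being merely
    continuous and piecewise polynomial, is not a test function. It is smoothed by replacing the
    indicators of half-lines starting at mesh points by smooth steps. The derivative of a step is
    large, but it is multiplied by the difference of two neighbouring polynomials, which vanishes at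
    the mesh point, so dominated convergence applies. *)

Definition polyprim p : {poly R} :=
  \poly_(i < (size p).+1) (if i is k.+1 then p`_k / k.+1%:R else 0).

Lemma deriv_polyprim p : (polyprim p)^`() = p.
Proof.
apply/polyP => i; rewrite coef_deriv coef_poly ltnS.
case: ltnP => [_|/(nth_default 0)->]; last by rewrite mul0rn.
by rewrite -[RHS](@divfK _ i.+1%:R) ?pnatr_eq0// mulr_natr.
Qed.

Lemma size_polyprim p n : (size p <= n)%N -> (size (polyprim p) <= n.+1)%N.
Proof. by move=> pn; rewrite (leq_trans (size_poly _ _)). Qed.

Lemma eq_deriv_horner p q (s t : R) :
  p^`() = q^`() -> p.[s] - p.[t] = q.[s] - q.[t].
Proof.
move=> pq; have d0 : (p - q)^`() = 0 by rewrite derivB pq subrr.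
suff [c pqc] : exists c, p = q + c%:P by rewrite pqc !hornerE; ring.
exists (p - q)`_0; apply/eqP; rewrite addrC -subr_eq; apply/eqP/polyP => -[|i].
  by rewrite coefC.
have /polyP/(_ i) := d0; rewrite coef_deriv coefC /= coefC if_same => /eqP.
by rewrite mulrn_eq0 /= => /eqP.
Qed.

(** The integral over [-1, 1], taken algebraically so that linearity and integration by parts are
    identities between polynomials. *)
Definition polyint p : R := (polyprim p).[1] - (polyprim p).[-1].

Lemma polyint_deriv p : polyint p^`() = p.[1] - p.[-1].
Proof. by apply: eq_deriv_horner; rewrite deriv_polyprim. Qed.

Lemma polyintD p q : polyint (p + q) = polyint p + polyint q.
Proof.
have -> : p + q = (polyprim p + polyprim q)^`() by rewrite derivD !deriv_polyprim.
by rewrite polyint_deriv !hornerD /polyint; ring.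
Qed.

Lemma polyintZ c p : polyint (c *: p) = c * polyint p.
Proof.
have -> : c *: p = (c *: polyprim p)^`() by rewrite derivZ deriv_polyprim.
by rewrite polyint_deriv !hornerZ /polyint; ring.
Qed.

Lemma polyint0 : polyint 0 = 0.
Proof. by have := polyintZ 0 0; rewrite scale0r mul0r. Qed.

Lemma polyint_sum (I : Type) (s : seq I) (F : I -> {poly R}) :
  polyint (\sum_(i <- s) F i) = \sum_(i <- s) polyint (F i).
Proof.
by apply: (big_morph polyint polyintD polyint0).
Qed.

(** A primitive is nondecreasing on [-1, 1]. Equal end values would make it constant there, hence
    constant as a polynomial, and p would be zero. *)
Lemma polyint_gt0 p : p != 0 -> (forall t, -1 <= t <= 1 -> 0 <= p.[t]) ->
  0 < polyint p.
Proof.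
move=> p0 pge0; rewrite /polyint; set P := polyprim p.
have mono (s t : R) : -1 <= s -> s <= t -> t <= 1 -> P.[s] <= P.[t].
  move=> s1 st t1.
  have [||c cst E] := @MVT_segment R (horner P) (horner p) s t st.
  - by move=> y _; have := is_derive_poly P y; rewrite deriv_polyprim.
  - by apply: continuous_subspaceT => y; exact: continuous_horner.
  - rewrite -subr_ge0 E mulr_ge0 ?subr_ge0// pge0//.
    by move: cst; rewrite in_itv/= => /andP[? ?]; apply/andP; split; lra.
have Pm : P.[-1] <= P.[1] by apply: mono; lra.
rewrite lt_neqAle subr_ge0 Pm andbT.
apply: contra_neq p0 => /esym/eqP; rewrite subr_eq0 => /eqP PE.
(* These are [size P] distinct points of [-1, 1], too many roots for P - P(1) unless it is zero. *)
pose pts := [seq (k.+1%:R^-1 : R) | k <- iota 0 (size P)].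
have Pc : P - (P.[1])%:P = 0.
  apply/eqP/negPn/negP => /max_poly_roots => /(_ pts).
  have upts : uniq pts.
    rewrite map_inj_uniq ?iota_uniq// => i j /invr_inj /eqP.
    by rewrite eqr_nat => /eqP[].
  have rpts : all (root (P - P.[1]%:P)) pts.
    apply/allP => y /mapP[k _ ->]; rewrite rootE !hornerE subr_eq0 eq_le.
    have k1 : k.+1%:R^-1 <= 1 :> R by rewrite invf_le1 ?ltr0n// ler1n.
    have k0 : 0 <= k.+1%:R^-1 :> R by rewrite invr_ge0.
    have k2 : -1 <= k.+1%:R^-1 :> R by exact: le_trans k0.
    by rewrite mono//= PE mono.
  move=> /(_ rpts upts); rewrite size_map size_iota ltnNge.
  rewrite (leq_trans (size_polyD _ _))// geq_max leqnn size_polyN size_polyC/=.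
  case: eqP => //= P1; rewrite lt0n size_poly_eq0.
  by apply: contra_notN P1 => /eqP ->; rewrite horner0.
by rewrite -(deriv_polyprim p) -/P -(subrK P.[1]%:P P) Pc add0r derivC.
Qed.

End PolynomialIntegral.

(** * Orthogonality from Rodrigues' formula *)

Section Rodrigues.
Variable R : realType.
Implicit Types p q : {poly R}.

Lemma dvdp_exp_deriv (d p : {poly R}) m :
  d ^+ m.+1 %| p -> d ^+ m %| p^`().
Proof.
move=> /dvdpP[s ->]; rewrite derivM deriv_exp dvdp_add//.
  by rewrite dvdp_mull// exprS dvdp_mull.
by rewrite dvdp_mull// -mulrnAl dvdp_mulIr.
Qed.

Lemma dvdp_exp_derivn (d p : {poly R}) m k :
  d ^+ (m + k) %| p -> d ^+ m %| p^`(k).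
Proof.
elim: k m => [|k IH] m; first by rewrite addn0 derivn0.
by rewrite addnS -addSn => /IH; rewrite derivnS; exact: dvdp_exp_deriv.
Qed.

(** Integration by parts, moving one derivative to q at each step of the induction on k. The
    boundary terms vanish because a derivative of order below r of (X^2 - 1)^r is still divisible by
    X^2 - 1. *)
Lemma rodrigues_orthogonal r k q : (k <= r)%N -> (size q <= k)%N ->
  polyint (derivn k (('X^2 - 1) ^+ r) * q) = 0.
Proof.
elim: k q => [|k IH] q kr; first by rewrite leqn0 size_poly_eq0 => /eqP->; rewrite mulr0 polyint0.
move=> sq; set L := ('X^2 - 1) ^+ r.
have root_L (t : R) : t ^+ 2 = 1 -> L^`(k).[t] = 0.
  move=> t1; apply/rootP; apply: (@root_dvdp _ ('X^2 - 1)).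
    by rewrite -[X in X %| _]expr1; apply: dvdp_exp_derivn; rewrite dvdp_exp2l// addnC addn1.
  by rewrite rootE !hornerE t1 subrr.
have -> : L^`(k.+1) * q = (L^`(k) * q)^`() + (-1) *: (L^`(k) * q^`()).
  by rewrite derivM derivnS scaleN1r addrK.
rewrite polyintD polyintZ polyint_deriv IH ?(ltnW kr)//.
  by rewrite !hornerM !root_L ?sqrrN ?expr1n// !mul0r mulr0 subrr addr0.
have [->|q0] := eqVneq q 0; first by rewrite deriv0 size_poly0.
by rewrite -ltnS (leq_trans (lt_size_deriv q0)).
Qed.

(** (X^2 - 1)^r is monic of degree 2 r, and r differentiations multiply its leading coefficient by a
    nonzero falling factorial. *)
Lemma size_rodrigues r : size (derivn r (('X^2 - 1 : {poly R}) ^+ r)) = r.+1.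
Proof.
have m2 : ('X^2 - 1 : {poly R}) \is monic by exact: monicXnsubC.
have s2 : size (('X^2 - 1 : {poly R}) ^+ r) = (r + r).+1.
  have s3 : size ('X^2 - 1 : {poly R}) = 3%N by exact: size_XnsubC.
  have s0 : (0 < size (('X^2 - 1 : {poly R}) ^+ r))%N.
    by rewrite size_poly_gt0 monic_neq0// monic_exp.
  by rewrite -(prednK s0) size_exp s3/= mul2n addnn.
apply/eqP; rewrite eqn_leq; apply/andP; split.
  apply/leq_sizeP => j rj; rewrite coef_derivn nth_default ?mul0rn//.
  by rewrite s2 -addnS leq_add2l.
rewrite ltnNge; apply/negP => /leq_sizeP/(_ r (leqnn r))/eqP.
rewrite coef_derivn; have := monic_exp r m2; rewrite monicE lead_coefE s2/= => /eqP ->.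
by rewrite pnatr_eq0 gtn_eqF ?ffact_gt0 ?leq_addr.
Qed.

End Rodrigues.

(** * Nodes and weights on the reference interval [-1, 1] *)

Section GaussQuadrature.
Variables (R : realType) (r : nat) (G : nat -> R).
Implicit Types p q : {poly R}.
Hypothesis hG : gauss_nodes r G.

Let nodes := [seq G j | j <- index_iota 1 r.+1].

Lemma gauss_nodes_lt j k : (1 <= j)%N -> (j < k)%N -> (k <= r)%N -> G j < G k.
Proof.
move=> j1; elim: k => // k IH; rewrite ltnS leq_eqVlt => /predU1P[<-|jk] kr.
  by apply: hG.1; rewrite j1.
apply: lt_trans (IH jk (ltnW kr)) _; apply: hG.1.
by rewrite kr andbT (leq_trans j1)// ltnW.
Qed.

Lemma gauss_nodes_inj j k : (1 <= j <= r)%N -> (1 <= k <= r)%N ->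
  G j = G k -> j = k.
Proof.
move=> /andP[j1 jr] /andP[k1 kr]; case: (ltngtP j k) => // jk E.
  by have := gauss_nodes_lt j1 jk kr; rewrite E ltxx.
by have := gauss_nodes_lt k1 jk jr; rewrite E ltxx.
Qed.

Let nodes_uniq : uniq nodes.
Proof.
rewrite map_inj_in_uniq ?iota_uniq// => i j.
rewrite !mem_index_iota !ltnS; exact: gauss_nodes_inj.
Qed.

Let size_nodes : size nodes = r. Proof. by rewrite size_map size_iota subn1. Qed.

Let W : {poly R} := \prod_(z <- nodes) ('X - z%:P).

(** The Legendre polynomial has degree r and the r distinct nodes as roots, so it is a multiple of
    the node polynomial [W]. *)
Let W_orthogonal q : (size q <= r)%N -> polyint (W * q) = 0.
Proof.
move=> qr; set L := derivn r (('X^2 - 1 : {poly R}) ^+ r).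
have sL : size L = r.+1 by exact: size_rodrigues.
have L0 : L != 0 by rewrite -size_poly_eq0 sL.
have E : L = lead_coef L *: W.
  apply: all_roots_prod_XsubC; rewrite ?size_nodes ?uniq_rootsE//.
  apply/allP => z /mapP[j]; rewrite mem_index_iota ltnS => j1r ->.
  have [_] := (hG.2 (G j)).2 (ex_intro2 _ _ j j1r erefl).
  have c0 : (2 ^+ r * r`!%:R : R) != 0.
    by rewrite mulf_neq0 ?expf_neq0 ?pnatr_eq0// gtn_eqF ?fact_gt0.
  by rewrite /legendre rootZ// invr_neq0.
have := rodrigues_orthogonal (leqnn r) qr; rewrite -/L E -scalerAl polyintZ.
by move/eqP; rewrite mulf_eq0 lead_coef_eq0 (negPf L0) => /eqP.
Qed.

Let size_W : size W = r.+1.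
Proof. by rewrite /W size_prod_XsubC size_nodes. Qed.

Let W_neq0 : W != 0. Proof. by rewrite -size_poly_eq0 size_W. Qed.

Let W_root j : (1 <= j <= r)%N -> root W (G j).
Proof.
by move=> jr; rewrite root_prod_XsubC map_f// mem_index_iota ltnS.
Qed.

(** [gauss_nodes] only places the nodes in the closed interval. Strict bounds keep the Gauss points
    off the mesh points, where a trial function may fail to be differentiable. *)
Lemma gauss_nodes_bounds j : (1 <= j <= r)%N -> -1 < G j < 1.
Proof.
move=> jr; have [/andP[G1 G2] _] := (hG.2 (G j)).2 (ex_intro2 _ _ j jr erefl).
suff endpoint (s : R) : s ^+ 2 = 1 -> G j <> s.
  rewrite !lt_neqAle G1 G2 !andbT; apply/andP; split; apply/eqP => E.
    by apply: (endpoint (-1)); rewrite // sqrrN expr1n.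
  by apply: (endpoint 1); rewrite // expr1n.
(* If the endpoint [s] is a node then [W = (X - s) Q], and [Q (W)] has a
   constant sign on [-1, 1] although it has zero integral. *)
move=> s1 E; have /factor_theorem[Q WQ] := W_root jr; rewrite E in WQ.
have Q0 : Q != 0 by apply: contra_neq W_neq0 => Q0; rewrite WQ Q0 mul0r.
have sQ : size Q = r.
  by apply/eqP; rewrite -eqSS -size_W WQ size_Mmonic ?monicXsubC// size_XsubC addn2.
have sQle : (size ((- s) *: Q) <= r)%N by rewrite (leq_trans (size_scale_leq _ _))// sQ.
have := W_orthogonal sQle.
suff : 0 < polyint (W * ((- s) *: Q)) by move=> /[swap] ->; rewrite ltxx.
apply: polyint_gt0.
  rewrite mulf_neq0// scaler_eq0 negb_or Q0 andbT oppr_eq0.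
  by apply: contraPneq s1 => ->; rewrite expr0n/=; lra.
move=> t /andP[t1 t2]; rewrite WQ !hornerM hornerZ hornerXsubC.
have -> : Q.[t] * (t - s) * (- s * Q.[t]) = Q.[t] ^+ 2 * (s ^+ 2 - s * t) by ring.
rewrite mulr_ge0 ?sqr_ge0// s1.
have /orP[/eqP->|/eqP->] : (s == 1) || (s == -1) by rewrite -eqf_sqr expr1n s1.
  by rewrite mul1r subr_ge0.
lra.
Qed.

(** The Lagrange basis polynomials of the Gauss nodes. *)
Let ell j : {poly R} := let P := \prod_(1 <= k < r.+1 | k != j) ('X - (G k)%:P) in
  P.[G j]^-1 *: P.

Let ellE j k : (1 <= j <= r)%N -> (1 <= k <= r)%N ->
  (ell j).[G k] = (k == j)%:R.
Proof.
move=> jr kr; rewrite /ell hornerZ; have [<-|kj] := eqVneq k j.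
  rewrite mulVf// horner_prod prodf_seq_neq0; apply/allP => i.
  rewrite mem_index_iota ltnS => ir; apply/implyP => ik.
  rewrite hornerXsubC subr_eq0; apply: contra_neq ik => E.
  exact/esym/gauss_nodes_inj.
rewrite -[X in (X).[G k]]big_filter (bigD1_seq k) ?filter_uniq ?iota_uniq//=; last first.
  by rewrite mem_filter kj mem_index_iota.
by rewrite hornerM hornerXsubC subrr mul0r mulr0.
Qed.

Let size_ell j : (1 <= j <= r)%N -> (size (ell j) <= r)%N.
Proof.
move=> jr; rewrite (leq_trans (size_scale_leq _ _))//.
set P := \prod_(_ <= _ < _ | _) _.
have WP : W = ('X - (G j)%:P) * P.
  by rewrite /W big_map (bigD1_seq j) ?iota_uniq ?mem_index_iota ?ltnS.
have := size_W; rewrite WP size_monicM ?monicXsubC ?size_XsubC//.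
  by rewrite add2n => -[->].
by apply: contra_neq W_neq0 => P0; rewrite WP P0 mulr0.
Qed.

Let lagrange_eq p : (size p <= r)%N ->
  p = \sum_(1 <= j < r.+1) p.[G j] *: ell j.
Proof.
move=> pr; apply/eqP; rewrite -subr_eq0; apply/negPn/negP => /max_poly_roots.
move=> /(_ nodes); rewrite size_nodes => H; suff /H : all (root (p - \sum_(1 <= j < r.+1) p.[G j] *: ell j)) nodes.
  move=> /(_ nodes_uniq); rewrite ltnNge (leq_trans (size_polyD _ _))// geq_max pr.
  rewrite size_polyN big_seq (leq_trans (size_sum _ _ _))//; apply/bigmax_leqP_seq => j.
  rewrite mem_index_iota ltnS => jr _.
  by rewrite (leq_trans (size_scale_leq _ _))// size_ell.
apply/allP => z /mapP[k]; rewrite mem_index_iota ltnS => kr ->.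
rewrite rootE hornerD hornerN horner_sum (bigD1_seq k) ?iota_uniq ?mem_index_iota ?ltnS//=.
rewrite hornerZ ellE// eqxx mulr1 big_seq_cond big1 ?addr0 ?subrr// => j.
rewrite mem_index_iota ltnS => /andP[jr jk].
by rewrite hornerZ ellE// eq_sym (negPf jk) mulr0.
Qed.

(** The weights are the integrals of the Lagrange polynomials, so exactness in degree below r is
    mere interpolation. Orthogonality gives positivity: [ell j] and its square have the same
    integral. Exactness is stated on derivatives because it is used to produce increments of p. *)
Lemma gauss_quadrature : exists A : nat -> R,
  (forall j, (1 <= j <= r)%N -> 0 < A j) /\
  forall p, (size p <= r.+1)%N ->
    \sum_(1 <= j < r.+1) A j * p^`().[G j] = p.[1] - p.[-1].
Proof.
exists (fun j => polyint (ell j)); split=> [j jr|p pr]; last first.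
  have pr' : (size p^`() <= r)%N.
    have [->|p0] := eqVneq p 0; first by rewrite deriv0 size_poly0.
    by rewrite -ltnS (leq_trans (lt_size_deriv p0)).
  rewrite -polyint_deriv [in RHS](lagrange_eq pr') polyint_sum.
  by apply: eq_bigr => j _; rewrite polyintZ mulrC.
have elljj : (ell j).[G j] = 1 by rewrite ellE// eqxx.
have ell0 : ell j != 0.
  by apply: contra_eq_neq elljj => ->; rewrite horner0 eq_sym oner_neq0.
(* [ell j ^ 2 - ell j] vanishes at every node, hence is a multiple of [W] by a
   polynomial of low degree. *)
have /dvdpP[q Eq] : W %| ell j ^+ 2 - ell j.
  rewrite uniq_roots_dvdp ?uniq_rootsE//; apply/allP => z /mapP[k].
  rewrite mem_index_iota ltnS => kr ->; rewrite rootE hornerD hornerN horner_exp ellE//.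
  by case: (k == j); rewrite ?expr1n ?expr0n/= ?subr0 ?subrr.
have qr : (size q <= r)%N.
  have [->|q0] := eqVneq q 0; first by rewrite size_poly0.
  have : (size (q * W)%R <= r + r)%N.
    rewrite -Eq (leq_trans (size_polyD _ _))// size_polyN geq_max.
    rewrite (leq_trans (size_ell jr)) ?leq_addr// andbT.
    rewrite expr2 (leq_trans (size_polyMleq _ _))//.
    by rewrite (leq_trans (leq_pred _))// leq_add ?size_ell.
  by rewrite size_mul// size_W addnS/= leq_add2r.
have -> : ell j = ell j ^+ 2 + (-1) *: (W * q).
  by rewrite mulrC -Eq scaleN1r opprB addrC subrK.
rewrite polyintD polyintZ W_orthogonal// mulr0 addr0 polyint_gt0 ?expf_neq0//.
by move=> t _; rewrite horner_exp sqr_ge0.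
Qed.

(** On [-1, 1] each Lagrange polynomial is at most the sum of the absolute values of its
    coefficients. *)
Lemma gauss_nodes_norm : exists2 K : R, 0 < K & forall p : {poly R},
  (size p <= r)%N -> forall t, -1 <= t <= 1 ->
    `|p.[t]| <= K * \sum_(1 <= j < r.+1) `|p.[G j]|.
Proof.
pose B (j : nat) : R := \sum_(i < size (ell j)) `|(ell j)`_i|.
have B0 j : 0 <= B j by apply: sumr_ge0.
have ellB j (t : R) : -1 <= t <= 1 -> `|(ell j).[t]| <= B j.
  rewrite -ler_norml => t1; rewrite horner_coef (le_trans (ler_norm_sum _ _ _))//.
  by apply: ler_sum => i _; rewrite normrM normrX ler_piMr// exprn_ile1.
exists (1 + \sum_(1 <= j < r.+1) B j); first by rewrite ltr_pwDl// sumr_ge0.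
move=> p pr t t1; rewrite [in `|p.[t]|](lagrange_eq pr) horner_sum.
rewrite (le_trans (ler_norm_sum _ _ _))// mulr_sumr !big_seq ler_sum// => j.
rewrite mem_index_iota ltnS => jr; rewrite hornerZ normrM mulrC ler_wpM2r//.
rewrite (le_trans (ellB j t t1))//; have : B j <= \sum_(1 <= j < r.+1) B j.
  rewrite (bigD1_seq j) ?iota_uniq ?mem_index_iota ?ltnS//= lerDl sumr_ge0//.
by move/le_trans; apply; rewrite -big_seq lerDr.
Qed.

End GaussQuadrature.

(** * A family of smooth steps *)

Section SmoothStep.
Variable R : realType.
Implicit Types (P : {poly R}) (x z t : R) (k n : nat).
Local Notation mu := (@lebesgue_measure R).

Lemma derive1n_seq (F : nat -> R -> R) :
  (forall n x, is_derive x 1 (F n) (F n.+1 x)) ->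
  forall n, derive1n n (F 0%N) = F n.
Proof.
move=> dF; elim=> [|n IH]; first by rewrite derive1n0.
by rewrite derive1nS IH; apply/funext => x; rewrite derive1E derive_val.
Qed.

Lemma is_derive0_sqr (f : R -> R) x (C : R) :
  f x = 0 -> (forall z, `|f z| <= C * (z - x) ^+ 2) -> is_derive x 1 f 0.
Proof.
move=> fx0 fC.
have C0 : 0 <= C.
  have := fC (x + 1); rewrite addrAC subrr add0r expr1n mulr1.
  exact: le_trans.
have cv : h^-1 *: (f (h *: 1 + x) - f x) @[h --> 0^'] --> (0 : R).
  apply/cvgr0Pnorm_le => e e0; near=> h.
  have h0 : h != 0 by near: h; exact: nbhs_dnbhs_neq.
  rewrite fx0 subr0 normrZ normfV.
  rewrite ler_pdivrMl ?normr_gt0//.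
  apply: (le_trans (fC _)); rewrite scaler1 addrK -normr_id -real_normK ?num_real//.
  rewrite !normr_id expr2 mulrA mulrC ler_wpM2l//.
  rewrite (@le_trans _ _ ((C + 1) * `|h|))//.
    by rewrite ler_wpM2r// lerDl.
  rewrite -ler_pdivlMl ?ltr_wpDl// mulrC.
  near: h; apply: dnbhs0_le; rewrite divr_gt0// ltr_wpDl//.
by apply: DeriveDef; [apply/cvg_ex; exists 0|apply/cvg_lim].
Unshelve. all: by end_near. Qed.

Let inside x := (0 < x) && (x < 1).

(* A class of functions closed under differentiation and containing
   [exp (- 1 / (x (1 - x)))] on [0, 1]. *)
Definition bumpf P k x : R :=
  if (0 < x) && (x < 1) then P.[x] * (x * (1 - x))^-1 ^+ k * expR (- (x * (1 - x))^-1) else 0.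

(** With y = 1 / (x (1 - x)) one has y' = (2 x - 1) y^2. Writing every term of the derivative of P
    y^k exp(- y) with the common factor y^(k + 2) exp(- y) leaves this polynomial. *)
Let bump_next P k : {poly R} :=
  P^`() * ('X * (1 - 'X)) ^+ 2 + k%:R *: (P * (2 *: 'X - 1) * ('X * (1 - 'X)))
  - P * (2 *: 'X - 1).

Lemma pow_expRN_le k (y : R) : 0 <= y -> y ^+ k * expR (- y) <= k`!%:R.
Proof.
move=> y0; rewrite expRN ler_pdivrMr ?expR_gt0//.
case: k => [|k].
  by rewrite expr0 fact0 mul1r; apply: le_trans (expR_ge1Dx y); rewrite lerDl.
rewrite mulrC -ler_pdivrMr ?ltr0n ?fact_gt0//.
by apply: le_trans (expR_ge1Dxn k y0); rewrite lerDr.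
Qed.

(** Two extra powers of y = 1 / (z (1 - z)) are absorbed by exp(- y) and paid back as (z (1 - z))^2,
    which is at most (z - x)^2 when x lies outside ]0, 1[. *)
Lemma bumpf_quadratic P k : exists2 C, 0 <= C &
  forall x z, inside x = false -> `|bumpf P k z| <= C * (z - x) ^+ 2.
Proof.
pose B : R := \sum_(i < size P) `|P`_i|.
have B0 : 0 <= B by apply: sumr_ge0.
exists (B * (k.+2)`!%:R); first by rewrite mulr_ge0.
move=> x z xout; rewrite /bumpf; case: ifPn => [/andP[z0 z1]|]; last first.
  by rewrite normr0 mulr_ge0 ?sqr_ge0// mulr_ge0.
have y0 : 0 < z * (1 - z) by rewrite mulr_gt0 ?subr_gt0.
set y := (z * (1 - z))^-1; have yp : 0 < y by rewrite invr_gt0.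
have -> : P.[z] * y ^+ k * expR (- y) = P.[z] * (y ^+ k.+2 * expR (- y)) * (z * (1 - z)) ^+ 2.
  transitivity (P.[z] * y ^+ k * expR (- y) * (y * (z * (1 - z))) ^+ 2).
    by rewrite mulVf ?gt_eqF// expr1n mulr1.
  by rewrite !exprS; ring.
rewrite normrM [X in X * _]normrM ler_pM ?mulr_ge0//.
- rewrite ler_pM ?mulr_ge0//.
  + rewrite horner_coef (le_trans (ler_norm_sum _ _ _))// ler_sum// => i _.
    by rewrite normrM normrX ler_piMr// exprn_ile1// ger0_norm ltW.
  + rewrite ger0_norm; first exact: pow_expRN_le (ltW yp).
    by apply: mulr_ge0; [exact/exprn_ge0/ltW|exact: expR_ge0].
- rewrite normrX ger0_norm ?(ltW y0)//.
  have [x0|x0] := leP x 0.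
    by rewrite ler_sqr ?nnegrE ?(ltW y0)//; nra.
  have x1 : 1 <= x by move: xout; rewrite /inside x0/= => /negbT; rewrite -leNgt.
  rewrite -[leRHS]sqrrN opprB ler_sqr ?nnegrE ?(ltW y0)//; nra.
Qed.

(** Inside ]0, 1[ this is the chain rule. At all other points, 0 and 1 included, the quadratic bound
    forces the derivative to be 0. *)
Lemma is_derive_bumpf P k x :
  is_derive x 1 (bumpf P k) (bumpf (bump_next P k) k.+2 x).
Proof.
case xi : (inside x); last first.
  have [C C0 HC] := bumpf_quadratic P k.
  rewrite {2}/bumpf; move: (xi); rewrite /inside => ->.
  apply: (@is_derive0_sqr _ _ C) => [|z]; last exact: HC.
  by rewrite /bumpf; move: (xi); rewrite /inside => ->.
have /andP[x0 x1] := xi.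
pose g z := P.[z] * (z * (1 - z))^-1 ^+ k * expR (- (z * (1 - z))^-1).
apply: (@near_eq_is_derive _ _ _ g).
  near=> z; rewrite /bumpf ifT//; apply/andP; split; near: z.
    exact: lt_nbhsr.
  exact: lt_nbhsl.
have y0 : x * (1 - x) != 0 by rewrite mulf_neq0// gt_eqF ?subr_gt0.
pose y z : R := (z * (1 - z))^-1.
have dy : is_derive x 1 y ((2 * x - 1) * y x ^+ 2).
  have d1 : is_derive x 1 (fun z : R => z * (1 - z)) (1 - 2 * x).
    apply: is_derive_eq; rewrite /= !scaler1 /GRing.scale/=; ring.
  have := @is_deriveV _ (fun z : R => z * (1 - z)) x _ _ y0 d1.
  move=> H; apply: is_derive_eq; rewrite /y /GRing.scale/=; field.
  by apply/andP; split; rewrite gt_eqF ?subr_gt0.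
have dyk m : is_derive x 1 (fun z => y z ^+ m) (m%:R * (2 * x - 1) * y x ^+ m.+1).
  elim: m => [|m IH]; first by rewrite !mul0r; exact: (is_derive_cst (1 : R)).
  rewrite (_ : (fun z => y z ^+ m.+1) = y * (fun z => y z ^+ m)).
    apply: (is_derive_eq (is_deriveM dy IH)).
    by rewrite /GRing.scale/= !exprS -natr1; ring.
  by apply/funext => z; rewrite exprS.
have de : is_derive x 1 (fun z => expR (- y z)) (- (2 * x - 1) * y x ^+ 2 * expR (- y x)).
  have dN : is_derive x 1 (fun z => - y z) (- ((2 * x - 1) * y x ^+ 2)) by exact: is_deriveN.
  have := @is_derive1_comp _ expR (fun z => - y z) x _ _ (is_derive_expR _) dN.
  by move=> H; apply: is_derive_eq; ring.
have dP : is_derive x 1 (horner P) (P^`()).[x] by exact: is_derive_poly.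
have := is_deriveM (is_deriveM dP (dyk k)) de.
move=> H; apply: (is_derive_eq H).
rewrite /bumpf x0 x1 [RHS]/= -[(x * (1 - x))^-1]/(y x) /bump_next.
rewrite !(hornerD, hornerN, hornerM, hornerZ, hornerX, hornerC, horner_exp).
rewrite /GRing.scale/= ?mulrfctE.
have yw : y x * (x * (1 - x)) = 1 by rewrite mulVf.
transitivity (P.[x] * y x ^+ k * (- (2 * x - 1) * y x ^+ 2 * expR (- y x)) +
   expR (- y x) * (P.[x] * (k%:R * (2 * x - 1) * y x ^+ k.+1) *
    (y x * (x * (1 - x))) + y x ^+ k * P^`().[x] * (y x * (x * (1 - x))) ^+ 2)).
  by rewrite yw; ring.
by rewrite [y x ^+ k.+2]exprS [y x ^+ k.+1]exprS; ring.
Unshelve. all: by end_near. Qed.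

Fixpoint bumpP (n : nat) : {poly R} := if n is m.+1 then bump_next (bumpP m) m.*2 else 1.

Definition bump_derivn n : R -> R := bumpf (bumpP n) n.*2.

Lemma is_derive_bump_derivn n x :
  is_derive x 1 (bump_derivn n) (bump_derivn n.+1 x).
Proof. by rewrite /bump_derivn doubleS; exact: is_derive_bumpf. Qed.

Lemma bump_derivn_out n x : (0 < x < 1) = false -> bump_derivn n x = 0.
Proof. by rewrite /bump_derivn /bumpf => ->. Qed.

Lemma bump_ge0 x : 0 <= bump_derivn 0 x.
Proof.
rewrite /bump_derivn /bumpf; case: ifP => // _.
by rewrite hornerC expr0 mul1r mul1r expR_ge0.
Qed.

Lemma bump_le1 x : bump_derivn 0 x <= 1.
Proof.
rewrite /bump_derivn /bumpf; case: ifP => // /andP[x0 x1].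
rewrite hornerC expr0 mul1r mul1r -[leRHS]expR0 ler_expR oppr_le0 invr_ge0.
by apply: mulr_ge0; rewrite ?subr_ge0; exact: ltW.
Qed.

Lemma bump_continuous : continuous (bump_derivn 0).
Proof.
move=> x; apply/differentiable_continuous/derivable1_diffP.
by have := is_derive_bump_derivn 0 x; case.
Qed.

Lemma bump_integrable : mu.-integrable setT (EFin \o bump_derivn 0).
Proof.
have -> : EFin \o bump_derivn 0 = (EFin \o bump_derivn 0) \_ `[0, 1].
  apply/funext => x; rewrite patchE; case: ifPn => //= x01.
  rewrite bump_derivn_out//; apply: contraNF x01 => /andP[x0 x1].
  by rewrite inE/= in_itv/= !ltW.
suff : mu.-integrable `[0, 1] (EFin \o bump_derivn 0) by move/integrable_mkcond; apply.
apply: continuous_compact_integrable; first exact: segment_compact.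
apply: continuous_subspaceT; exact: bump_continuous.
Qed.

Let step0 x : R := \int[mu]_(t in `]-oo, x]) bump_derivn 0 t.

Let is_derive_step0 x : is_derive x 1 step0 (bump_derivn 0 x).
Proof.
have [] := @continuous_FTC1 R (bump_derivn 0) -oo%O x (x + 1).
- by rewrite ltrDl.
- exact: integrableS bump_integrable.
- by rewrite ltNyr.
- exact: bump_continuous.
by move=> d1 d2; apply: DeriveDef; [exact: d1|rewrite -derive1E; exact: d2].
Qed.

Let step0_mono s t : s <= t -> step0 s <= step0 t.
Proof.
move=> st; rewrite -subr_ge0 /step0 Rintegral_itvB//.
- by apply: Rintegral_ge0 => y _; exact: bump_ge0.
- exact: integrableS bump_integrable.
Qed.

Let step0_le0 x : x <= 0 -> step0 x = 0.
Proof.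
move=> x0; rewrite /step0 (@eq_Rintegral _ _ _ _ _ (cst 0)).
  by rewrite Rintegral_cst// mul0r.
move=> y; rewrite inE/= in_itv/= => yx.
by rewrite bump_derivn_out// ltNge (le_trans yx).
Qed.

Let step0_ge1 x : 1 <= x -> step0 x = step0 1.
Proof.
move=> x1; apply/eqP; rewrite -subr_eq0 /step0 Rintegral_itvB//; last first.
  exact: integrableS bump_integrable.
rewrite (@eq_Rintegral _ _ _ _ _ (cst 0)) ?Rintegral_cst// ?mul0r//.
move=> y; rewrite inE/= in_itv/= => /andP[y1 _].
by rewrite bump_derivn_out// (ltNge y) (ltW y1) andbF.
Qed.

(** If [step0 1] were 0, monotonicity would make [step0] vanish identically, whereas its derivative
    at 1/2 is a positive exponential. *)
Let step0_gt0 : 0 < step0 1.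
Proof.
have step00 : step0 0 = 0 by exact: step0_le0.
rewrite lt_neqAle -[X in X <= _]step00 step0_mono// andbT.
apply/eqP => s10.
have step0E x : step0 x = 0.
  have [x0|x0] := leP x 0; first exact: step0_le0.
  have [x1|x1] := leP 1 x; first by rewrite step0_ge1.
  by apply/eqP; rewrite eq_le -{2}step00 step0_mono ?(ltW x0)// s10 step0_mono// ltW.
have : bump_derivn 0 2^-1 = 0.
  have <- := @derive_val _ _ _ _ _ _ _ (is_derive_step0 2^-1).
  rewrite (_ : step0 = cst 0) ?derive_cst//; exact/funext.
rewrite /bump_derivn /bumpf ifT; last lra.
by rewrite hornerC expr0 !mul1r; apply/eqP; rewrite gt_eqF// expR_gt0.
Qed.

(** [smooth_step 0] is the normalised primitive of the bump, rising from 0 to 1 across [0, 1]; the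
    index n stands for its n-th derivative. *)
Definition smooth_step n x : R :=
  if n is m.+1 then bump_derivn m x / step0 1 else step0 x / step0 1.

Lemma is_derive_smooth_step n x :
  is_derive x 1 (smooth_step n) (smooth_step n.+1 x).
Proof.
case: n => [|n]; rewrite /smooth_step.
  have d := is_derive_step0 x.
  by apply: is_derive_eq; rewrite /GRing.scale/= mulrC; ring.
have d := is_derive_bump_derivn n x.
by apply: is_derive_eq; rewrite /GRing.scale/= mulrC; ring.
Qed.

Lemma smooth_step_le0 n x : x <= 0 -> smooth_step n x = 0.
Proof.
case: n => [|n] x0 /=; first by rewrite step0_le0// mul0r.
by rewrite bump_derivn_out ?mul0r// ltNge x0.
Qed.

Lemma smooth_step_ge1 x : 1 <= x -> smooth_step 0 x = 1.
Proof. by move=> x1; rewrite /= step0_ge1// divff// gt_eqF. Qed.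

Lemma smooth_stepS_ge1 n x : 1 <= x -> smooth_step n.+1 x = 0.
Proof.
by move=> x1; rewrite /= bump_derivn_out ?mul0r// (ltNge x) x1 andbF.
Qed.

Lemma smooth_step_mono s t : s <= t -> smooth_step 0 s <= smooth_step 0 t.
Proof. by move=> st; rewrite /= ler_pM2r ?invr_gt0// step0_mono. Qed.

Lemma smooth_step_ge0 x : 0 <= smooth_step 0 x.
Proof.
have [x0|x0] := leP x 0; first by rewrite smooth_step_le0.
by rewrite -(smooth_step_le0 0 (lexx 0)) smooth_step_mono// ltW.
Qed.

Lemma smooth_step_le1 x : smooth_step 0 x <= 1.
Proof.
have [x1|x1] := leP 1 x; first by rewrite smooth_step_ge1.
by rewrite -(smooth_step_ge1 (lexx 1)) smooth_step_mono// ltW.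
Qed.

Lemma smooth_step1_bound : exists2 K, 0 < K & forall x, 0 <= smooth_step 1 x <= K.
Proof.
exists (step0 1)^-1; rewrite ?invr_gt0// => x /=.
by rewrite divr_ge0 ?bump_ge0 ?(ltW step0_gt0)//= ler_piMl ?invr_ge0 ?(ltW step0_gt0)// bump_le1.
Qed.

(* [n]-th derivative of [smooth_step 0 (l * (x - p))] *)
Definition step_at l p n x : R := l ^+ n * smooth_step n (l * (x - p)).

Lemma is_derive_step_at l p n x :
  is_derive x 1 (step_at l p n) (step_at l p n.+1 x).
Proof.
have d0 : is_derive x 1 (fun x : R => l * (x - p)) l.
  by apply: is_derive_eq; rewrite /GRing.scale/=; ring.
have d := @is_derive1_comp _ _ _ x _ _ (is_derive_smooth_step n (l * (x - p))) d0.
have dE : is_derive x 1 (step_at l p n) (l ^+ n *: (smooth_step n.+1 (l * (x - p)) * l)).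
  exact: is_deriveZ.
by apply: (is_derive_eq dE); rewrite /step_at /GRing.scale/= [in RHS]exprS; ring.
Qed.

Lemma step_at_continuous l p n : continuous (step_at l p n).
Proof.
move=> x; apply/differentiable_continuous/derivable1_diffP.
by have := is_derive_step_at l p n x; case.
Qed.

Lemma step_at_le l p n x : 0 < l -> x <= p -> step_at l p n x = 0.
Proof.
by move=> l0 xp; rewrite /step_at smooth_step_le0 ?mulr0// pmulr_rle0// subr_le0.
Qed.

Lemma step_at0_ge l p x : 0 < l -> p + l^-1 <= x -> step_at l p 0 x = 1.
Proof.
move=> l0 px; rewrite /step_at expr0 mul1r smooth_step_ge1//.
by rewrite -ler_pdivrMl// mulr1 lerBrDl.
Qed.

Lemma step_atS_ge l p n x : 0 < l -> p + l^-1 <= x -> step_at l p n.+1 x = 0.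
Proof.
move=> l0 px; rewrite /step_at smooth_stepS_ge1 ?mulr0//.
by rewrite -ler_pdivrMl// mulr1 lerBrDl.
Qed.

Lemma step_at0_bound l p x : 0 <= step_at l p 0 x <= 1.
Proof. by rewrite /step_at expr0 mul1r smooth_step_ge0 smooth_step_le1. Qed.

Lemma step_at0_mono l p q x : 0 < l -> p <= q -> step_at l q 0 x <= step_at l p 0 x.
Proof.
move=> l0 pq; rewrite /step_at expr0 !mul1r smooth_step_mono//.
by rewrite ler_pM2l// lerD2l lerN2.
Qed.

End SmoothStep.

(** * Integrals *)

Section IntegralComplements.
Variable R : realType.
Implicit Types (F f g : R -> R) (s t m : R) (D K : set R).
Local Notation mu := (@lebesgue_measure R).

(** The bound holds at every point, not only almost everywhere, and on the whole line. The class is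
    thus closed under products and integrable on every bounded interval; [in_Linfty_truncate]
    provides such representatives of the coefficients. *)
Definition bdm F := measurable_fun setT F /\ exists M, forall t, `|F t| <= M.

Lemma bdm_cst c : bdm (fun=> c).
Proof. by split; [exact: measurable_cst|exists `|c|]. Qed.

Lemma bdmD f g : bdm f -> bdm g -> bdm (fun x => f x + g x).
Proof.
move=> [mf [M fM]] [mg [N gN]]; split; first exact: measurable_funD.
by exists (M + N) => t; rewrite (le_trans (ler_normD _ _))// lerD.
Qed.

Lemma bdmM f g : bdm f -> bdm g -> bdm (fun x => f x * g x).
Proof.
move=> [mf [M fM]] [mg [N gN]]; split; first exact: measurable_funM.
by exists (M * N) => t; rewrite normrM ler_pM.
Qed.

Lemma bdmN f : bdm f -> bdm (fun x => - f x).
Proof.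
move=> /(bdmM (bdm_cst (-1))); congr bdm; apply/funext => x; exact: mulN1r.
Qed.

Lemma bdmB f g : bdm f -> bdm g -> bdm (fun x => f x - g x).
Proof. by move=> hf /bdmN; exact: bdmD. Qed.

Lemma bdm_norm f : bdm f -> bdm (fun x => `|f x|).
Proof.
move=> [mf [M fM]]; split; first exact: measurableT_comp.
by exists M => t; rewrite normr_id.
Qed.

Lemma bdm_indic D : measurable D -> bdm (\1_D : R -> R).
Proof.
move=> mD; split; first exact: measurable_indic.
by exists 1 => t; rewrite indicE; case: (t \in D); rewrite ?normr1 ?normr0.
Qed.

Lemma bdm_patch D f M : measurable D -> measurable_fun D f ->
  (forall t, D t -> `|f t| <= M) -> bdm (f \_ D).
Proof.
move=> mD mf fM; split; first exact/(measurable_restrictT _ _).1.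
exists `|M| => t; rewrite patchE; case: ifPn; last by rewrite normr0.
by rewrite inE => /fM/le_trans; apply; exact: ler_norm.
Qed.

Lemma bdm_sum (I : Type) (l : seq I) (F : I -> R -> R) :
  (forall i, bdm (F i)) -> bdm (fun x => \sum_(i <- l) F i x).
Proof.
move=> hF; elim: l => [|i l IH].
  by rewrite (_ : (fun _ => _) = fun=> 0); [exact: bdm_cst|apply/funext => x; rewrite big_nil].
by rewrite (_ : (fun _ => _) = fun x => F i x + \sum_(j <- l) F j x);
  [exact: bdmD|apply/funext => x; rewrite big_cons].
Qed.

Lemma bdm_integrableM D F g : measurable D -> bdm F ->
  mu.-integrable D (EFin \o g) -> mu.-integrable D (EFin \o (fun x => F x * g x)).
Proof.
move=> mD [mF [M FM]] ig.
have := @integrableMr _ _ _ mu D mD F (EFin \o g) (measurable_funTS mF) _ ig.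
apply; exists `|M|; split; first exact: num_real.
move=> x Mx t _ /=; rewrite (le_trans (FM t))// (le_trans (ler_norm _))// ltW//.
Qed.

Lemma bdm_integrable D F : measurable D -> (mu D < +oo)%E -> bdm F ->
  mu.-integrable D (EFin \o F).
Proof.
move=> mD Doo [mF [M FM]]; apply: measurable_bounded_integrable => //.
  exact: measurable_funTS.
exists `|M|; split; first exact: num_real.
by move=> x Mx t _ /=; rewrite (le_trans (FM t))// (le_trans (ler_norm _))// ltW.
Qed.

Lemma RintegrableD D f g : measurable D -> mu.-integrable D (EFin \o f) ->
  mu.-integrable D (EFin \o g) -> mu.-integrable D (EFin \o (fun x => f x + g x)).
Proof. by move=> mD i1 i2; have := @integrableD _ _ _ mu D mD _ _ i1 i2; apply: eq_integrable. Qed.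

Lemma RintegrableB D f g : measurable D -> mu.-integrable D (EFin \o f) ->
  mu.-integrable D (EFin \o g) -> mu.-integrable D (EFin \o (fun x => f x - g x)).
Proof. by move=> mD i1 i2; have := @integrableB _ _ _ mu D mD _ _ i1 i2; apply: eq_integrable. Qed.

Lemma bdm_integrable_itv F s t : bdm F -> mu.-integrable `[s, t] (EFin \o F).
Proof.
apply: bdm_integrable => //; rewrite lebesgue_measure_itv/=.
by case: ifP => _; rewrite ?ltry// -EFinB ltry.
Qed.

Lemma integrable_oo_cc F s t : mu.-integrable `]s, t[ (EFin \o F) ->
  mu.-integrable `[s, t] (EFin \o F).
Proof.
move=> /integrableP[mF Foo]; have [ts|] := ltP t s.
  by rewrite set_itv_ge ?bnd_simp -?ltNge//; exact: integrable_set0.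
rewrite le_eqVlt => /predU1P[->|st].
  rewrite set_itv1; apply: null_set_integrable => //; last exact: lebesgue_measure_set1.
  exact: measurable_fun_set1.
have mFo : measurable_fun `[s, t[ (EFin \o F).
  rewrite -(@setU1itv _ _ (BLeft t) s false) ?bnd_simp//.
  by apply/measurable_funU => //; split => //; exact: measurable_fun_set1.
have mFc : measurable_fun `[s, t] (EFin \o F).
  rewrite -(@setUitv1 _ _ (BLeft s) t true) ?bnd_simp ?(ltW st)//.
  by apply/measurable_funU => //; split => //; exact: measurable_fun_set1.
apply/integrableP; split => //; move: Foo.
rewrite integral_itv_obnd_cbnd; last exact: measurableT_comp.
by rewrite integral_itv_bndo_bndc//; exact: measurableT_comp.
Qed.

Lemma Rint_cat F s m t : s <= m -> m <= t -> mu.-integrable `[s, t] (EFin \o F) ->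
  \int[mu]_(x in `[s, t]) F x =
  \int[mu]_(x in `[s, m]) F x + \int[mu]_(x in `[m, t]) F x.
Proof.
move=> sm mt iF; rewrite -(@Rintegral_itv_obnd_cbnd _ m); last first.
  by apply: integrableS iF => //; apply: subset_itvr; rewrite bnd_simp.
by rewrite -(Rintegral_itvB iF) ?bnd_simp// addrC subrK.
Qed.

Lemma Rint_oo F s t : mu.-integrable `]s, t[ (EFin \o F) ->
  \int[mu]_(x in `]s, t[) F x = \int[mu]_(x in `[s, t]) F x.
Proof.
move=> iF; rewrite Rintegral_itv_bndo_bndc//.
have [ts|st] := leP t s.
  rewrite set_itv_ge ?bnd_simp -?leNgt//.
  move: ts; rewrite le_eqVlt => /predU1P[->|ts].
    by rewrite set_itv1 Rintegral_set1 Rintegral_set0.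
  by rewrite [in RHS]set_itv_ge ?bnd_simp -?ltNge// Rintegral_set0.
rewrite Rintegral_itv_obnd_cbnd//.
by apply: integrableS (integrable_oo_cc iF) => //; apply: subset_itvr; rewrite bnd_simp.
Qed.

Lemma Rint_ae D f g : measurable D -> measurable_fun D f -> measurable_fun D g ->
  {ae mu, forall x, D x -> f x = g x} ->
  \int[mu]_(x in D) f x = \int[mu]_(x in D) g x.
Proof.
move=> mD mf mg fg; congr fine; apply: ae_eq_integral => //.
- exact/measurable_EFinP.
- exact/measurable_EFinP.
- by apply: (@filterS _ _ (ae_filter_ringOfSetsType mu) _ _ _ fg) => x h Dx /=; rewrite h.
Qed.

Lemma Rint_support D K f : K `<=` D -> (forall x, D x -> ~ K x -> f x = 0) ->
  \int[mu]_(x in D) f x = \int[mu]_(x in K) f x.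
Proof.
move=> KD f0; rewrite Rintegral_mkcond [RHS]Rintegral_mkcond.
apply: eq_Rintegral => x _; rewrite !patchE.
case: ifPn; case: ifPn => //; rewrite ?inE ?notin_setE => h1 h2.
  exact: f0.
by case: h2; exact: KD.
Qed.

Lemma Rint_normM_le F M s t : s <= t -> mu.-integrable `[s, t] (EFin \o F) ->
  (forall x, s < x < t -> `|F x| <= M) ->
  `|\int[mu]_(x in `[s, t]) F x| <= M * (t - s).
Proof.
move=> st iF FM.
have iFo : mu.-integrable `]s, t[ (EFin \o F).
  by apply: integrableS iF => //; exact: subset_itv_oo_cc.
rewrite -Rint_oo// (le_trans (le_normr_Rintegral _ _))//.
have -> : M * (t - s) = \int[mu]_(x in `]s, t[) M.
  rewrite Rintegral_cst//= lebesgue_measure_itv/= lte_fin.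
  by move: st; rewrite le_eqVlt => /predU1P[->|->//]; rewrite ltxx subrr.
apply: le_Rintegral => //.
- have := integrable_norm iFo; apply: eq_integrable => //.
- apply: bdm_integrable => //; last exact: bdm_cst.
  by rewrite lebesgue_measure_itv/=; case: ifP => _; rewrite ?ltry// -EFinB ltry.
Qed.

Lemma Rint_dct D (f_ : nat -> R -> R) f g : measurable D ->
  (forall n, measurable_fun D (f_ n)) -> measurable_fun D f ->
  {ae mu, forall x, D x -> f_ ^~ x @ \oo --> f x} ->
  mu.-integrable D (EFin \o g) ->
  (forall n x, D x -> `|f_ n x| <= g x) ->
  (fun n => \int[mu]_(x in D) f_ n x) @ \oo --> \int[mu]_(x in D) f x.
Proof.
move=> mD mf_ mf cv ig fg.
have [|||||iF _ H] := @dominated_convergence _ _ _ mu D mD (fun n => EFin \o f_ n) (EFin \o f) (EFin \o g).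
- by move=> n; apply/measurable_EFinP; exact: mf_.
- by apply/measurable_EFinP; exact: mf.
- by apply: (@filterS _ _ (ae_filter_ringOfSetsType mu) _ _ _ cv) => x h Dx /=; apply: cvg_EFin; [exact: nearW|exact: h].
- exact: ig.
- by apply: aeW => x n Dx; rewrite /= lee_fin fg.
rewrite /Rintegral; apply: fine_cvg.
by rewrite fineK; [exact: H|exact: integrable_fin_num].
Qed.

Lemma Rint_FTC2 F f s t : s <= t -> (forall x : R, is_derive x 1 F (f x)) ->
  continuous f -> \int[mu]_(x in `[s, t]) f x = F t - F s.
Proof.
rewrite le_eqVlt => /predU1P[-> _ _|st dF cf].
  by rewrite set_itv1 Rintegral_set1 subrr.
have cF : continuous F.
  by move=> x; apply/differentiable_continuous/derivable1_diffP; case: (dF x).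
rewrite /Rintegral (@continuous_FTC2 _ f F)//.
- exact: continuous_subspaceT.
- split; [by move=> x _; case: (dF x)|exact/cvg_at_right_filter/cF|exact/cvg_at_left_filter/cF].
- by move=> x _; rewrite derive1E; apply: derive_val.
Qed.

End IntegralComplements.

(** * Weak derivatives *)

Section WeakDerivative.
Variable R : realType.
Implicit Types (c d s t p : R) (v g : R -> R).
Local Notation mu := (@lebesgue_measure R).

Lemma locally_integrable_itv c d s t v : locally_integrable `]c, d[ v ->
  c < s -> t < d -> mu.-integrable `[s, t] (EFin \o v).
Proof.
move=> [mv _ voo] cs td.
have sub : `[s, t] `<=` `]c, d[.
  by move=> y /=; rewrite !in_itv/= => /andP[sy yt]; rewrite (lt_le_trans cs)//= (le_lt_trans yt).
apply/integrableP; split; last by apply: voo => //; exact: segment_compact.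
by apply/measurable_EFinP; exact: measurable_funS mv.
Qed.

(** Both steps vanish to the left of s and equal 1 beyond t + 1/l, so their difference has compact
    support. *)
Lemma test_function_step c d s t (l : R) : 0 < l -> c < s -> s < t -> t + l^-1 < d ->
  test_function c d (fun x => step_at l s 0 x - step_at l t 0 x).
Proof.
move=> l0 cs st td.
have der n (x : R) : is_derive x 1 (fun x => step_at l s n x - step_at l t n x)
    (step_at l s n.+1 x - step_at l t n.+1 x).
  by apply: is_deriveB; exact: is_derive_step_at.
have dn := derive1n_seq der.
have supp : closure [set x | step_at l s 0 x - step_at l t 0 x != 0] `<=`
    `[s, t + l^-1].
  rewrite [X in _ `<=` X](closure_id _).1; last exact: itv_closed.
  apply: closure_subset => x /= ; apply: contraNP => /negP.
  rewrite in_itv/= negb_and -!ltNge => /orP[xs|tx].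
    by rewrite !step_at_le ?subrr// ltW// (lt_trans xs).
  rewrite !step_at0_ge ?subrr// ltW// (le_lt_trans _ tx)// lerD2r ltW//.
split.
- by move=> n x; rewrite dn; case: (der n x).
- apply: subclosed_compact supp; [exact: closed_closure|exact: segment_compact].
- apply: subset_trans supp _ => y /=; rewrite !in_itv/= => /andP[sy yt].
  by rewrite (lt_le_trans cs)//= (le_lt_trans yt).
Qed.

Lemma bdm_step_at0 (l : R) p : bdm (step_at l p 0).
Proof.
split; first by apply: continuous_measurable_fun; exact: step_at_continuous.
by exists 1 => x; have /andP[? ?] := step_at0_bound l p x; rewrite ger0_norm.
Qed.

Lemma bdm_step_at1 (l : R) p : bdm (step_at l p 1).
Proof.
split; first by apply: continuous_measurable_fun; exact: step_at_continuous.
have [K K0 bK] := smooth_step1_bound R.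
exists (`|l| * K) => x; rewrite /step_at expr1 normrM ler_wpM2l//.
by have /andP[? ?] := bK (l * (x - p)); rewrite ger0_norm.
Qed.

Lemma step_at0_near p x :
  \forall n \near \oo, step_at n.+1%:R p 0 x = \1_(`]p, +oo[%classic) x :> R.
Proof.
have [xp|px] := leP x p.
  near=> n; rewrite step_at_le// indicE memNset//= in_itv/= andbT.
  by apply/negP; rewrite -leNgt.
near=> n; rewrite step_at0_ge ?indicE ?mem_set//= ?in_itv/= ?andbT ?ltr0n//.
rewrite -lerBrDl; near: n.
by apply: (cvgr_le _ (@cvg_harmonic R)); rewrite subr_gt0.
Unshelve. all: by end_near. Qed.

(* [step_at l p 1] is an approximate identity at [p] as [l] goes to infinity. *)
Lemma step_at1_lebesgue_pt v p e0 e1 : e0 < p -> p < e1 ->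
  mu.-integrable `[e0, e1] (EFin \o v) -> lebesgue_pt v p ->
  (fun n => \int[mu]_(x in `[e0, e1]) (v x * step_at n.+1%:R p 1 x)) @ \oo --> v p.
Proof.
move=> e0p pe1 iv vp.
have [K K0 bK] := smooth_step1_bound R.
have bstep n x : 0 <= step_at (n.+1%:R : R) p 1 x <= n.+1%:R * K.
  by rewrite /step_at expr1 mulr_ge0 ?ler_pM2l ?ltr0n//; case/andP: (bK (n.+1%:R * (x - p))).
have bdms n := bdm_step_at1 n.+1%:R p.
have r_cvg : (2 / n.+1%:R : R) @[n --> \oo] --> 0.
  have := @cvgMr _ _ _ _ (@harmonic R) 2 _ (@cvg_harmonic R).
  by rewrite mulr0; exact.
have davg_cvg : davg v p (2 / n.+1%:R) @[n --> \oo] --> 0%E.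
  apply: (@cvg_comp _ _ _ (fun n => 2 / n.+1%:R) (davg v p) \oo (0^'+)); last exact: vp.
  move=> A A0; have : \forall r \near (0 : R), 0 < r -> A r by exact: A0.
  move=> /(r_cvg _) rA; suff : \forall n \near \oo, A (2 / n.+1%:R) by [].
  near=> n; have : 0 < 2 / n.+1%:R :> R -> A (2 / n.+1%:R) by near: n; exact: rA.
  by apply; rewrite divr_gt0.
(* The kernel has integral 1, is at most (n + 1) K and vanishes off the ball of radius 2/(n + 1)
   around p. As this ball has length 4/(n + 1), the integral of |v - v p| against the kernel is at
   most 4 K times its average. *)
have bound : \forall n \near \oo,
   (`|\int[mu]_(x in `[e0, e1]) (v x * step_at (n.+1%:R) p 1 x) - v p|%:E <= (4 * K)%:E * davg v p (2 / n.+1%:R))%E.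
  near=> n.
  set l : R := n.+1%:R; have l0 : 0 < l by rewrite ltr0n.
  have ple1 : p + 2 / l < e1.
    rewrite /l {l l0} -ltrBrDl; near: n; apply: (cvgr_lt _ r_cvg).
    by rewrite subr_gt0.
  have e0pl : e0 < p - 2 / l.
    rewrite /l {ple1 l l0} ltrBrDr -ltrBrDl; near: n; apply: (cvgr_lt _ r_cvg).
    by rewrite subr_gt0.
  have one : \int[mu]_(x in `[e0, e1]) step_at l p 1 x = 1.
    rewrite (@Rint_FTC2 _ _ _ _ _ _ (is_derive_step_at l p 0)) ?(ltW (lt_trans e0p pe1))//.
    - rewrite step_at0_ge// ?step_at_le ?subr0// ltW//.
      by rewrite (le_lt_trans _ ple1)// lerD2l ler_pdivlMr// mulVf ?gt_eqF// ler1n.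
    - exact: step_at_continuous.
  have i1 : mu.-integrable `[e0, e1] (EFin \o (fun x => v x * step_at l p 1 x)).
    have := bdm_integrableM (measurable_itv _) (bdms n) iv.
    by apply: eq_integrable => // x _ /=; rewrite mulrC.
  have i2 : mu.-integrable `[e0, e1] (EFin \o (step_at l p 1)).
    by apply: bdm_integrable_itv; exact: bdms.
  have i3 : mu.-integrable `[e0, e1] (EFin \o (fun x => v p * step_at l p 1 x)).
    by apply: bdm_integrable_itv; exact: (bdmM (bdm_cst (v p)) (bdms n)).
  have i4 : mu.-integrable `[e0, e1] (EFin \o (fun x => v x - v p)).
    by apply: RintegrableB => //; apply: bdm_integrable_itv; exact: bdm_cst.
  have -> : \int[mu]_(x in `[e0, e1]) (v x * step_at l p 1 x) - v p =
     \int[mu]_(x in `[e0, e1]) ((v x - v p) * step_at l p 1 x).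
    rewrite -[v p in LHS]mulr1 -one -RintegralZl// -RintegralB//.
    by apply: eq_Rintegral => x _; rewrite mulrBl.
  have i5 : mu.-integrable `[e0, e1] (EFin \o (fun x => (v x - v p) * step_at l p 1 x)).
    have := bdm_integrableM (measurable_itv _) (bdms n) i4.
    by apply: eq_integrable => // x _ /=; rewrite mulrC.
  have ballsub : ball p (2 / l) `<=` `[e0, e1].
    rewrite ball_itv => x /=; rewrite !in_itv/= => /andP[x1 x2].
    by rewrite (ltW (lt_trans e0pl x1)) (ltW (lt_trans x2 ple1)).
  have mball : measurable (ball p (2 / l)) by exact: measurable_ball.
  rewrite (@Rint_support _ _ (ball p (2 / l))) //; last first.
    move=> x _ xb; have [xp|px] := leP x p; first by rewrite step_at_le ?mulr0.
    rewrite step_atS_ge ?mulr0// leNgt; apply/negP => xl; apply: xb.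
    rewrite ball_itv /= in_itv/= (lt_le_trans _ (ltW px)) ?ltrBlDr ?ltrDl ?divr_gt0//=.
    by rewrite (lt_trans xl)// ltrD2l ltr_pdivlMr// mulVf ?gt_eqF// ltr1n.
  have i6 := @integrableS _ _ _ mu _ _ _ (measurable_itv _) mball ballsub i5.
  have i7 := @integrableS _ _ _ mu _ _ _ (measurable_itv _) mball ballsub i4.
  rewrite EFin_normr_Rintegral//.
  have /integrableP[m6 _] := i6.
  have /integrableP[m7 _] := i7.
  apply: (le_trans (@le_abse_integral _ _ _ mu _ _ mball m6)).
  rewrite /davg /iavg lebesgue_measure_ball ?divr_ge0 ?(ltW l0)//.
  rewrite inver.
  have -> : (2 / l *+ 2 == 0) = false by rewrite mulrn_eq0/= gt_eqF// divr_gt0.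
  rewrite muleA -EFinM.
  have -> : 4 * K * (2 / l *+ 2)^-1 = l * K by rewrite -mulr_natr; field; rewrite gt_eqF.
  have n6 : measurable_fun (ball p (2 / l)) (fun x => `|(v x - v p) * step_at l p 1 x|%:E).
    by apply/measurable_EFinP; apply: measurableT_comp => //; exact/measurable_EFinP.
  have n7 : measurable_fun (ball p (2 / l)) (fun x => `|v x - v p|%:E).
    by apply/measurable_EFinP; apply: measurableT_comp => //; exact/measurable_EFinP.
  have lK : (0 <= (l * K)%:E)%E by rewrite lee_fin mulr_ge0// ltW.
  rewrite -ge0_integralZl//=.
  apply: ge0_le_integral => //=.
  - by apply: measurable_funeM.
  move=> x _; rewrite -EFinM lee_fin normrM mulrC ler_wpM2r//.
  by have /andP[? ?] := bstep n x; rewrite ger0_norm.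
have /fine_cvgP[fin cv0] := davg_cvg.
apply/cvgrPdist_le => e e_gt0.
have K4 : 0 < 4 * K by rewrite mulr_gt0.
have E0 : 0 < (4 * K)^-1 * e by rewrite mulr_gt0 ?invr_gt0.
near=> n.
rewrite distrC -lee_fin; apply: (@le_trans _ _ ((4 * K)%:E * davg v p (2 / n.+1%:R))%E).
  by near: n; exact: bound.
have finn : davg v p (2 / n.+1%:R) \is a fin_num by near: n; exact: fin.
rewrite -(fineK finn) -EFinM lee_fin -ler_pdivlMl//.
by near: n; exact: (cvgr_le _ cv0 _ E0).
Unshelve. all: by end_near. Qed.

Lemma is_weak_derivative_lebesgue_pt c d v g s t : is_weak_derivative c d 1 v g ->
  c < s -> s < t -> t < d -> lebesgue_pt v s -> lebesgue_pt v t ->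
  v t - v s = \int[mu]_(x in `[s, t]) g x.
Proof.
move=> [lv lg H] cs st td vs vt.
(* A compact interval inside ]c, d[ that contains the supports for large n; v and g, only locally
   integrable on ]c, d[, are integrable on it. *)
pose e0 := (c + s) / 2; pose e1 := (t + d) / 2.
have [ce0 e0s] : c < e0 /\ e0 < s by rewrite /e0; split; lra.
have [te1 e1d] : t < e1 /\ e1 < d by rewrite /e1; split; lra.
have iv : mu.-integrable `[e0, e1] (EFin \o v) by exact: locally_integrable_itv lv _ _.
have ig : mu.-integrable `[e0, e1] (EFin \o g) by exact: locally_integrable_itv lg _ _.
have Ksub : `[e0, e1] `<=` `]c, d[.
  by move=> y /=; rewrite !in_itv/= => /andP[y1 y2]; rewrite (lt_le_trans ce0)//= (le_lt_trans y2).
pose phi n x : R := step_at n.+1%:R s 0 x - step_at n.+1%:R t 0 x.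
pose dphi n x : R := step_at n.+1%:R s 1 x - step_at n.+1%:R t 1 x.
have l0 n : 0 < n.+1%:R :> R by rewrite ltr0n.
have near_e1 : \forall n \near \oo, t + n.+1%:R^-1 < e1.
  near=> n; rewrite -ltrBrDl; near: n.
  by apply: (cvgr_lt _ (@cvg_harmonic R)); rewrite subr_gt0.
have eqn : \forall n \near \oo, \int[mu]_(x in `[e0, e1]) (v x * dphi n x) =
    - \int[mu]_(x in `[e0, e1]) (g x * phi n x).
  near=> n.
  have tn : t + n.+1%:R^-1 < e1 by near: n; exact: near_e1.
  have out (x : R) m : ~ `[e0, e1]%classic x ->
      step_at n.+1%:R s m x - step_at n.+1%:R t m x = 0.
    move=> /negP; rewrite /= in_itv/= negb_and -!ltNge => /orP[xe|ex].
      have xs : x < s by exact: lt_trans e0s.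
      by rewrite !step_at_le ?subrr// ltW// (lt_trans xs).
    have tx : t + n.+1%:R^-1 <= x by rewrite ltW// (lt_trans tn).
    have sx : s + n.+1%:R^-1 <= x by rewrite (le_trans _ tx)// lerD2r ltW.
    by case: m => [|m]; rewrite ?step_at0_ge ?step_atS_ge ?subrr.
  have := H _ (test_function_step (l0 n) cs st (lt_trans tn e1d)).
  rewrite derive1n1 expr1 mulN1r.
  have -> : (fun x => step_at n.+1%:R s 0 x - step_at n.+1%:R t 0 x)^`()%classic = dphi n.
    apply/funext => x; rewrite derive1E.
    have d' := is_deriveB (is_derive_step_at n.+1%:R s 0 x) (is_derive_step_at n.+1%:R t 0 x).
    exact: (@derive_val _ _ _ _ _ _ _ d').
  rewrite (@Rint_support _ `]c, d[%classic `[e0, e1]%classic)//; last by move=> x _ xK; rewrite /dphi out ?mulr0.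
  rewrite (@Rint_support _ `]c, d[%classic `[e0, e1]%classic)//; last by move=> x _ xK; rewrite out ?mulr0.
have mv : measurable_fun `[e0, e1] v by case/integrableP: iv => /measurable_EFinP.
have mg : measurable_fun `[e0, e1] g by case/integrableP: ig => /measurable_EFinP.
have lhs : (fun n => \int[mu]_(x in `[e0, e1]) (v x * dphi n x)) @ \oo --> v s - v t.
  rewrite (_ : (fun n => _) = (fun n => \int[mu]_(x in `[e0, e1]) (v x * step_at n.+1%:R s 1 x) -
     \int[mu]_(x in `[e0, e1]) (v x * step_at n.+1%:R t 1 x))); last first.
    apply/funext => n; rewrite -RintegralB//.
    - by apply: eq_Rintegral => x _; rewrite /dphi mulrBr.
    - have := bdm_integrableM (measurable_itv _) (bdm_step_at1 n.+1%:R s) iv.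
      by apply: eq_integrable => // x _ /=; rewrite mulrC.
    - have := bdm_integrableM (measurable_itv _) (bdm_step_at1 n.+1%:R t) iv.
      by apply: eq_integrable => // x _ /=; rewrite mulrC.
  apply: cvgB; apply: step_at1_lebesgue_pt => //; first exact: lt_trans te1.
  exact: lt_trans st.
have rhs : (fun n => \int[mu]_(x in `[e0, e1]) (g x * phi n x)) @ \oo -->
    \int[mu]_(x in `[e0, e1]) (g x * \1_(`]s, t]) x).
  have mphi n : measurable_fun `[e0, e1] (phi n).
    by apply: measurable_funTS; case: (bdmB (bdm_step_at0 n.+1%:R s) (bdm_step_at0 n.+1%:R t)).
  apply: (@Rint_dct _ _ _ _ (fun x => `|g x|)) => //.
  - by move=> n; exact: measurable_funM.
  - by apply: measurable_funM => //; exact: measurable_indic.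
  - apply: aeW => x _; apply: cvgM; [exact: cvg_cst|apply: cvg_near_cst].
    near=> n; rewrite /phi; have -> : step_at n.+1%:R s 0 x = \1_(`]s, +oo[%classic) x :> R.
      by near: n; exact: step_at0_near.
    have -> : step_at n.+1%:R t 0 x = \1_(`]t, +oo[%classic) x :> R.
      by near: n; exact: step_at0_near.
    rewrite !indicE !mem_setE !in_itv/= !andbT.
    case: (ltP s x) => sx; case: (leP x t) => xt; rewrite ?subr0 ?subrr//.
    by have := lt_le_trans st (ltW xt); rewrite ltNge sx.
  - by have := integrable_norm ig; apply: eq_integrable.
  - move=> n x _; rewrite normrM ler_piMr// ler_norml /phi.
    have /andP[? ?] := step_at0_bound n.+1%:R s x.
    have /andP[? ?] := step_at0_bound n.+1%:R t x.
    by apply/andP; split; lra.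
have : v s - v t = - \int[mu]_(x in `[e0, e1]) (g x * \1_(`]s, t]) x).
  have rhs' : (fun n => - \int[mu]_(x in `[e0, e1]) (g x * phi n x)) @ \oo -->
      - \int[mu]_(x in `[e0, e1]) (g x * \1_(`]s, t]) x) by exact: cvgN.
  apply: (cvg_unique _ lhs); first exact: Rhausdorff.
  rewrite /=; apply: cvg_trans rhs'; apply: near_eq_cvg.
  by near=> n; apply/esym; near: n; exact: eqn.
move/eqP; rewrite -eqr_oppLR opprB => /eqP ->.
rewrite (@Rint_support _ _ `]s, t]%classic); last 2 first.
- move=> y /=; rewrite !in_itv/= => /andP[y1 y2]; apply/andP; split; first by rewrite ltW// (lt_trans e0s).
  by rewrite (le_trans y2)// ltW.
- by move=> x _ xst; rewrite indicE memNset// mulr0.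
rewrite -Rintegral_itv_obnd_cbnd//; last first.
  apply: integrableS ig => // y /=; rewrite !in_itv/= => /andP[y1 y2]; apply/andP; split; first by rewrite ltW// (lt_trans e0s).
  by rewrite (le_trans y2)// ltW.
by apply: eq_Rintegral => x xst; rewrite indicE xst mulr1.
Unshelve. all: by end_near. Qed.

(** Lebesgue differentiation is applied to the truncations of v to [c + 1/(n + 1), d - 1/(n + 1)].
    For n large, small balls around a given point do not see the truncation. *)
Lemma ae_lebesgue_pt c d v : locally_integrable `]c, d[ v ->
  {ae mu, forall p, p \in `]c, d[ -> lebesgue_pt v p}.
Proof.
move=> lv; pose e (n : nat) : R := n.+1%:R^-1.
have e0 n : 0 < e n by rewrite invr_gt0.
have H n : {ae mu, forall p, lebesgue_pt (v \_ `[c + e n, d - e n]) p}.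
  apply: lebesgue_differentiation; apply: integrable_locally_restrict => //.
  by apply: (locally_integrable_itv lv); rewrite ?ltrDl// gtrBl.
have := ae_foralln H.
apply: (@filterS _ _ (ae_filter_ringOfSetsType mu)) => p Hp.
rewrite in_itv/= => /andP[cp pd].
have : \forall n \near \oo, c + e n < p /\ p < d - e n.
  near=> n; split.
    rewrite -ltrBrDl; near: n.
    by apply: (cvgr_lt _ (@cvg_harmonic R)); rewrite subr_gt0.
  rewrite ltrBrDr -ltrBrDl; near: n.
  by apply: (cvgr_lt _ (@cvg_harmonic R)); rewrite subr_gt0.
move=> [n _ /(_ n (leqnn n))[cn nd]].
have := Hp n; apply: cvg_trans; apply: near_eq_cvg.
have cnp : ((c + e n)%:E < p%:E)%E by rewrite lte_fin.
by near=> r; apply/esym; near: r; exact: (@near_davg R v (BLeft (c + e n)) p (d - e n) nd cnp).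
Unshelve. all: by end_near. Qed.

Lemma in_continuous_lebesgue_pt c d v t : measurable_fun `]c, d[ v ->
  {in `]c, d[, continuous v} -> t \in `]c, d[ -> lebesgue_pt v t.
Proof.
move=> mv cv tcd; apply: (@continuous_lebesgue_pt _ _ _ `]c, d[%classic) => //.
exact: cv.
Qed.

(** The constant is fixed at one Lebesgue point [m], which exists because almost every point of ]c,
    d[ is one and the interval has positive measure. *)
Lemma weak_derivative_primitive c d v g : c < d -> is_weak_derivative c d 1 v g ->
  mu.-integrable `]c, d[ (EFin \o g) ->
  exists k, forall t, t \in `]c, d[ -> lebesgue_pt v t ->
    v t = k + \int[mu]_(x in `[c, t]) g x.
Proof.
move=> cd wd /integrable_oo_cc ig.
have [m mcd vm] : exists2 m, m \in `]c, d[ & lebesgue_pt v m.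
  have [lv _ _] := wd; apply: contrapT => noleb.
  have [N [mN N0 sub]] := ae_lebesgue_pt lv.
  have : (mu `]c, d[ <= mu N)%E.
    apply: le_measure; rewrite ?inE//.
    by apply: subset_trans sub => p pcd H; apply: noleb; exists p => //; exact: H.
  by rewrite N0 lebesgue_measure_itv/= lte_fin cd leNgt lte_fin subr_gt0 cd.
exists (v m - \int[mu]_(x in `[c, m]) g x) => t tcd vt.
move: mcd tcd; rewrite !in_itv/= => /andP[cm md] /andP[ct td].
have igS (e : R) : e < d -> mu.-integrable `[c, e] (EFin \o g).
  by move=> ed; apply: integrableS ig => //; apply: subset_itvl; rewrite bnd_simp ltW.
have [tm|mt|->] := ltgtP t m; last by rewrite subrK.
- rewrite (@Rint_cat _ _ _ t m) ?(ltW ct) ?(ltW tm)//; last exact: igS.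
  by rewrite -(is_weak_derivative_lebesgue_pt wd ct tm md vt vm); ring.
- rewrite (@Rint_cat _ _ _ m t) ?(ltW cm) ?(ltW mt)//; last exact: igS.
  by rewrite -(is_weak_derivative_lebesgue_pt wd cm mt td vm vt); ring.
Qed.

Lemma test_function_derive1 c d phi : test_function c d phi ->
  test_function c d phi^`()%classic.
Proof.
move=> [der cpt sub].
have S : closure [set x | phi^`()%classic x != 0] `<=` closure [set x | phi x != 0].
  rewrite [X in _ `<=` X](closure_id _).1; last exact: closed_closure.
  apply: closure_subset => x /=; apply: contraNP => xcl.
  have : \forall y \near x, phi y = 0.
    move: xcl; rewrite /closure/= => /existsNP[B /not_implyP[xB]].
    move=> /set0P/negP/negPn/eqP B0; near=> y.
    apply/eqP/negPn/negP => y0.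
    have : ([set x | phi x != 0] `&` B) y by split => //; near: y.
    by rewrite B0.
  move=> near0; rewrite derive1E (@near_eq_derive _ _ _ _ (cst 0))//.
  by rewrite derive_cst.
split.
- by move=> n x; have := der n.+1 x; rewrite /derive1n iterSr.
- exact: subclosed_compact (@closed_closure _ _) cpt S.
- exact: subset_trans sub.
Unshelve. all: by end_near. Qed.

(** The derivative of a test function is again a test function, so order j tested with phi' is order
    j + 1 tested with phi. *)
Lemma is_weak_derivativeS c d j u v g : is_weak_derivative c d j u v ->
  is_weak_derivative c d j.+1 u g -> is_weak_derivative c d 1 v g.
Proof.
move=> [lu lv Hv] [_ lg Hg]; split => // phi tphi.
have := Hv _ (test_function_derive1 tphi).
rewrite {1}/derive1n -iterSr -/(derive1n j.+1 phi) Hg// derive1n1 expr1 exprS => /eqP.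
rewrite -mulrA mulrCA (inj_eq (mulfI _)) ?signr_eq0//.
by move=> /eqP <-.
Qed.

End WeakDerivative.

(** * Approximation on one element *)

Section Taylor.
Variable R : realType.
Implicit Types (c d s t m : R) (u v D : R -> R).
Local Notation mu := (@lebesgue_measure R).

Lemma MVT_norm_le (f df : R -> R) s t K : 
  {in `]s, t[, forall x : R, is_derive x (1 : R) f (df x)} ->
  {within `[s, t], continuous f} -> s <= t ->
  {in `]s, t[, forall x, `|df x| <= K} -> `|f t - f s| <= K * (t - s).
Proof.
move=> dF cf; rewrite le_eqVlt => /predU1P[->|st] dfK.
  by rewrite !subrr normr0 mulr0.
have [c cst ->] := MVT st dF cf.
have ts : 0 < t - s by rewrite subr_gt0.
by rewrite normrM (gtr0_norm ts); apply: ler_wpM2r; [exact: ltW|exact: dfK].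
Qed.

(** [F] lists successive derivatives, and only the oscillation of the last one is bounded. A
    polynomial close to [F 1] is integrated and adjusted to agree with [F 0] at the midpoint; by the
    mean value theorem each integration costs one factor d - c. *)
Lemma taylor_chain n c d K (F : nat -> R -> R) : c < d ->
  (forall j, (j < n)%N ->
    {in `]c, d[, forall t : R, is_derive t (1 : R) (F j) (F j.+1 t)}) ->
  {in `]c, d[ &, forall s t, `|F n t - F n s| <= K} ->
  exists2 p : {poly R}, (size p <= n.+1)%N &
    {in `]c, d[, forall t, `|F 0%N t - p.[t]| <= K * (d - c) ^+ n}.
Proof.
move=> cd; elim: n F => [|n IH] F dF FK.
  exists (F 0%N ((c + d) / 2))%:P; first by rewrite size_polyC leq_b1.
  by move=> t tcd; rewrite hornerC expr0 mulr1 FK// in_itv/=; apply/andP; split; lra.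
have [||p sp pF] := IH (fun j => F j.+1).
- by move=> j jn t tcd; exact: (dF j.+1).
- by move=> s t; exact: FK.
set m := (c + d) / 2.
have mcd : m \in `]c, d[ by rewrite in_itv/= /m; apply/andP; split; lra.
pose P := polyprim p + (F 0%N m - (polyprim p).[m])%:P.
exists P.
  rewrite (leq_trans (size_polyD _ _))// geq_max size_polyprim//.
  by rewrite (leq_trans (size_polyC_leq1 _)).
have dP (t : R) : t \in `]c, d[ ->
    is_derive t (1 : R) (fun x => F 0%N x - P.[x]) (F 1%N t - p.[t]).
  move=> tcd; have d0 := dF 0%N (ltn0Sn _) t tcd.
  have d1 := is_derive_poly P t; rewrite derivD deriv_polyprim derivC addr0 in d1.
  exact: is_deriveB.
have Pm : F 0%N m - P.[m] = 0 by rewrite hornerD hornerC; ring.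
have K0 : 0 <= K * (d - c) ^+ n by exact: le_trans (normr_ge0 _) (pF m mcd).
have sub s t : s \in `]c, d[ -> t \in `]c, d[ -> s <= t ->
    `|(F 0%N t - P.[t]) - (F 0%N s - P.[s])| <= K * (d - c) ^+ n.+1.
  rewrite !in_itv/= => /andP[cs sd] /andP[ct td] st.
  have itvS x : s <= x <= t -> x \in `]c, d[.
    by move=> /andP[sx xt]; rewrite in_itv/= (lt_le_trans cs)//= (le_lt_trans xt).
  rewrite (@le_trans _ _ (K * (d - c) ^+ n * (t - s)))//; last first.
    by rewrite exprSr mulrA ler_wpM2l//; lra.
  apply: (@MVT_norm_le (fun x => F 0%N x - P.[x]) (fun x => F 1%N x - p.[x])) => //.
  - by move=> x; rewrite in_itv/= => /andP[sx xt]; apply: dP; rewrite itvS// !ltW.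
  - apply: derivable_within_continuous => x; rewrite in_itv/= => sxt.
    by case: (dP x (itvS x sxt)).
  - by move=> x; rewrite in_itv/= => /andP[sx xt]; apply: pF; rewrite itvS// !ltW.
move=> t tcd; rewrite -[X in `|X|]subr0 -Pm; have [mt|tm] := leP m t.
  exact: sub.
by rewrite distrC; apply: sub => //; exact: ltW.
Qed.

(** The polynomial of [taylor_chain] for [F 1] is integrated, then corrected by an affine function
    to match u at both ends. The slope of the correction is a mean value of [F 1] minus that
    polynomial, hence obeys the same bound; this accounts for the factor 2. *)
Lemma element_approx n c d K u (F : nat -> R -> R) : c < d -> (1 <= n)%N ->
  {within `[c, d], continuous u} ->
  {in `]c, d[, forall t : R, is_derive t (1 : R) u (F 1%N t)} ->
  (forall j, (1 <= j < n)%N ->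
    {in `]c, d[, forall t : R, is_derive t (1 : R) (F j) (F j.+1 t)}) ->
  {in `]c, d[ &, forall s t, `|F n t - F n s| <= K} ->
  exists p : {poly R}, [/\ (size p <= n.+1)%N, p.[c] = u c, p.[d] = u d &
    {in `]c, d[, forall t, `|F 1%N t - p^`().[t]| <= 2 * K * (d - c) ^+ n.-1}].
Proof.
case: n => // n cd _ cu du dF FK.
have [||p sp pF] := @taylor_chain n c d K (fun j => F j.+1) cd.
- by move=> j jn; exact: (dF j.+1).
- exact: FK.
pose v t := u t - (polyprim p).[t].
pose sigma := (v d - v c) / (d - c).
have dc0 : 0 < d - c by rewrite subr_gt0.
have vcd : `|v d - v c| <= K * (d - c) ^+ n * (d - c).
  apply: (@MVT_norm_le _ (fun x => F 1%N x - p.[x])) => //; last exact: ltW.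
  - move=> x xcd; have d1 := is_derive_poly (polyprim p) x.
    by rewrite deriv_polyprim in d1; apply: is_deriveB; exact: du.
  - move=> x; apply: continuousB; first exact: cu.
    by apply: continuous_subspaceT => y; exact: continuous_horner.
have sK : `|sigma| <= K * (d - c) ^+ n.
  by rewrite normrM normfV (gtr0_norm dc0) ler_pdivrMr.
pose P := polyprim p + (v c)%:P + sigma *: ('X - c%:P).
have sP : (size P <= n.+2)%N.
  rewrite (leq_trans (size_polyD _ _))// geq_max; apply/andP; split.
    rewrite (leq_trans (size_polyD _ _))// geq_max size_polyprim//.
    by rewrite (leq_trans (size_polyC_leq1 _)).
  by rewrite (leq_trans (size_scale_leq _ _))// size_XsubC.
exists P; split => //.
- by rewrite /P 2!hornerD hornerC hornerZ hornerXsubC /v subrr mulr0 addr0 addrC subrK.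
- by rewrite /P 2!hornerD hornerC hornerZ hornerXsubC /sigma divfK ?gt_eqF// -addrA subrKC /v addrC subrK.
- move=> t tcd; have -> : P^`() = p + sigma%:P.
    by rewrite /P !derivD deriv_polyprim derivC addr0 derivZ derivXsubC alg_polyC.
  rewrite hornerD hornerC opprD addrA (le_trans (ler_normB _ _))//.
  by rewrite -mulrA mulrDl mul1r lerD// pF.
Qed.

End Taylor.

(** * Coercivity *)

Section Coercivity.
Variable R : realType.
Implicit Types (a b s t z : R) (beta gamma : R -> R) (p q d : {poly R}).
Local Notation mu := (@lebesgue_measure R).

Lemma poly_bound_itv q a b : exists2 M : R, 0 <= M & {in `[a, b], forall t, `|q.[t]| <= M}.
Proof.
have [M qM] := poly_itv_bound q a b; exists `|M| => // t tab.
by apply: le_trans (ler_norm M); apply: qM; move: tab; rewrite in_itv.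
Qed.

(** Finite sums of a polynomial times the m-th derivative of a smooth step of width 1/l at y,
    encoded by the triples (q, y, m). The class is closed under differentiation, [deriv_steps] being
    the Leibniz rule, so all its members are smooth. *)
Definition eval_steps (l : R) (s : seq ({poly R} * R * nat)) (t : R) : R :=
  \sum_(i <- s) i.1.1.[t] * step_at l i.1.2 i.2 t.

Definition deriv_steps (s : seq ({poly R} * R * nat)) :=
  [seq (i.1.1^`(), i.1.2, i.2) | i <- s] ++ [seq (i.1.1, i.1.2, i.2.+1) | i <- s].

Lemma is_derive_eval_steps (l : R) (s : seq ({poly R} * R * nat)) t :
  is_derive t (1 : R) (eval_steps l s) (eval_steps l (deriv_steps s) t).
Proof.
elim: s => [|[[q y] m] s IH].
  rewrite /eval_steps big_nil (_ : (fun _ => _) = cst 0); first exact: is_derive_cst.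
  by apply/funext => x; rewrite big_nil.
rewrite (_ : eval_steps l _ = (fun x => q.[x] * step_at l y m x) + eval_steps l s); last first.
  by apply/funext => x; rewrite /eval_steps big_cons.
have dq := is_derive_poly q t.
have dS := is_derive_step_at l y m t.
apply: (is_derive_eq (is_deriveD (is_deriveM dq dS) IH)).
rewrite /eval_steps /deriv_steps /= !big_cat /= !big_cons /= big_cat/= big_cons /GRing.scale/=.
ring.
Qed.

Lemma harmonic_small (M e : R) : 0 < e -> \forall n \near \oo, M / n.+1%:R < e.
Proof.
move=> e0; have H : (M / n.+1%:R : R) @[n --> \oo] --> M * 0.
  by apply: cvgM; [exact: cvg_cst|exact: cvg_harmonic].
by rewrite mulr0 in H; exact: (cvgr_lt _ H).
Qed.

(** A shift proportional to the width 1/(n + 1) does not change the limit away from z. This freedom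
    serves to push the supports inside ]a, b[. *)
Lemma step_shift_near z sigma t m : z != t ->
  \forall n \near \oo, step_at n.+1%:R (z + sigma / n.+1%:R) m t =
    if m is 0%N then \1_(`]z, +oo[%classic) t else 0 :> R.
Proof.
move=> zt; have [tz|tz|] := ltgtP t z; last by move=> tz; rewrite tz eqxx in zt.
- near=> n; rewrite step_at_le ?ltr0n//; last first.
    have : - sigma / n.+1%:R < z - t by near: n; apply: harmonic_small; rewrite subr_gt0.
    by move: (n.+1%:R^-1) => w H; rewrite -subr_ge0 ltW//; lra.
  by case: m => //; rewrite indicE memNset//= in_itv/= andbT; apply/negP; rewrite -leNgt ltW.
- near=> n; have : (sigma + 1) / n.+1%:R < t - z by near: n; apply: harmonic_small; rewrite subr_gt0.
  rewrite mulrDl mul1r => H; have H1 : z + sigma / n.+1%:R + n.+1%:R^-1 <= t.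
    by move: H; move: (n.+1%:R^-1) => w H; rewrite -subr_ge0 ltW//; lra.
  case: m => [|m]; last by rewrite step_atS_ge.
  by rewrite step_at0_ge// indicE mem_set//= in_itv/= andbT.
Unshelve. all: by end_near. Qed.

(** The integrand beta phi' + 2 gamma phi for phi equal to d times the step at y. *)
Let term beta gamma d (l y t : R) : R :=
  beta t * (d^`().[t] * step_at l y 0 t + d.[t] * step_at l y 1 t)
  + 2 * gamma t * (d.[t] * step_at l y 0 t).

Lemma measurable_term D beta gamma d l y : bdm beta -> bdm gamma ->
  measurable_fun D (term beta gamma d l y).
Proof.
move=> [mb _] [mg _]; apply: measurable_funTS.
have mp q : measurable_fun setT (horner q).
  by apply: continuous_measurable_fun; exact: continuous_horner.
have ms m : measurable_fun setT (step_at l y m).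
  by apply: continuous_measurable_fun; exact: step_at_continuous.
apply: measurable_funD; apply: measurable_funM => //.
- by apply: measurable_funD; apply: measurable_funM.
- by apply: measurable_funM.
- by apply: measurable_funM.
Qed.

(** The derivative of the step is of size l K, but it lives within distance (|sigma| + 1)/l of z,
    where d, being divisible by X - z, is O(1/l). *)
Lemma term_bound beta gamma d a b z sigma : bdm beta -> bdm gamma -> d.[z] = 0 ->
  exists M, forall n t, t \in `[a, b] ->
    `|term beta gamma d n.+1%:R (z + sigma / n.+1%:R) t| <= M.
Proof.
move=> [_ [Mb bM]] [_ [Mg gM]] /rootP/factor_theorem[q dq].
have Mb0 : 0 <= Mb by exact: le_trans (normr_ge0 _) (bM 0).
have Mg0 : 0 <= Mg by exact: le_trans (normr_ge0 _) (gM 0).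
have [B0 B0p dB0] := poly_bound_itv d a b.
have [B1 B1p dB1] := poly_bound_itv d^`() a b.
have [Q Qp qQ] := poly_bound_itv q a b.
have [K K0 bK] := smooth_step1_bound R.
exists (Mb * (B1 + Q * (`|sigma| + 1) * K) + 2 * Mg * B0) => n t tab.
set l : R := n.+1%:R; have l0 : 0 < l by rewrite ltr0n.
set y := z + sigma / l.
have th0 : `|step_at l y 0 t| <= 1.
  by have /andP[? ?] := step_at0_bound l y t; rewrite ger0_norm.
have th1 : `|d.[t] * step_at l y 1 t| <= Q * (`|sigma| + 1) * K.
  have [ty|yt] := leP t y.
    by rewrite step_at_le// mulr0 normr0 !mulr_ge0 ?addr_ge0// ltW.
  have [yt'|ty] := leP (y + l^-1) t.
    by rewrite step_atS_ge// mulr0 normr0 !mulr_ge0 ?addr_ge0// ltW.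
  have tz : `|t - z| <= (`|sigma| + 1) / l.
    have -> : t - z = (t - y) + sigma / l by rewrite /y; ring.
    rewrite (le_trans (ler_normD _ _))// mulrDl mul1r addrC lerD//.
      by rewrite normrM normfV (gtr0_norm l0).
    by rewrite ger0_norm ?subr_ge0 ?(ltW yt)// lerBlDl ltW.
  have s1 : `|step_at l y 1 t| <= l * K.
    rewrite /step_at expr1 normrM (gtr0_norm l0) ler_pM2l//.
    by have /andP[? ?] := bK (l * (t - y)); rewrite ger0_norm.
  rewrite dq hornerM hornerXsubC normrM (normrM q.[t]).
  have -> : Q * (`|sigma| + 1) * K = Q * ((`|sigma| + 1) / l) * (l * K) by field; rewrite gt_eqF.
  by apply: ler_pM => //; apply: ler_pM => //; exact: qQ.
rewrite /term (le_trans (ler_normD _ _))// lerD//.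
  rewrite normrM ler_pM// (le_trans (ler_normD _ _))// lerD//.
  by rewrite normrM -[leRHS]mulr1 ler_pM// dB1.
rewrite normrM ler_pM//.
  by rewrite normrM ler_pM// ger0_norm.
by rewrite normrM -[leRHS]mulr1 ler_pM// dB0.
Qed.

(** Dominated convergence with the constant of [term_bound]; pointwise convergence is only missing
    at z. The derivative of the step leaves no trace in the limit. *)
Lemma cvg_term beta gamma d a b z sigma : bdm beta -> bdm gamma -> d.[z] = 0 ->
  (fun n => \int[mu]_(t in `[a, b]) term beta gamma d n.+1%:R (z + sigma / n.+1%:R) t) @ \oo -->
  \int[mu]_(t in `[a, b]) ((beta t * d^`().[t] + 2 * gamma t * d.[t]) * \1_(`]z, +oo[%classic) t).
Proof.
move=> hb hg dz; have [M bM] := term_bound a b sigma hb hg dz.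
have mp q : measurable_fun setT (horner q).
  by apply: continuous_measurable_fun; exact: continuous_horner.
apply: (@Rint_dct _ _ _ _ (fun=> M)) => //.
- by move=> n; exact: measurable_term.
- apply: measurable_funTS; apply: measurable_funM; last exact: measurable_indic.
  case: hb => mb _; case: hg => mg _.
  by apply: measurable_funD; apply: measurable_funM => //; apply: measurable_funM.
- exists [set z]; split => //; first exact: lebesgue_measure_set1.
  move=> t /= /not_implyP[_ H]; apply: contrapT => tz; apply: H.
  have zt : z != t by apply/eqP => zt; apply: tz.
  apply: cvg_near_cst; near=> n; rewrite /term.
  have -> : step_at n.+1%:R (z + sigma / n.+1%:R) 0 t = \1_(`]z, +oo[%classic) t :> R.
    by near: n; exact: (@step_shift_near z sigma t 0).
  have -> : step_at n.+1%:R (z + sigma / n.+1%:R) 1 t = 0 :> R.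
    by near: n; exact: (@step_shift_near z sigma t 1).
  ring.
- exact: bdm_integrable_itv (bdm_cst M).
Unshelve. all: by end_near. Qed.

Lemma continuous_integrableM F psi a b : bdm F -> continuous psi ->
  mu.-integrable `[a, b] (EFin \o (fun t => F t * psi t)).
Proof.
move=> hF cpsi; apply: bdm_integrableM => //.
apply: continuous_compact_integrable; first exact: segment_compact.
exact: continuous_subspaceT.
Qed.

(** Testing the weak derivative of beta with phi turns the integrand into (2 gamma - dbeta) phi. The
    compact interval [s, e] carries the support because [dbeta] is only locally integrable on ]a,
    b[. *)
Lemma test_function_ge0 beta dbeta gamma kappa phi a b s e : bdm beta -> bdm gamma ->
  is_weak_derivative a b 1 beta dbeta -> 0 <= kappa ->
  {ae mu, forall t, t \in `]a, b[ -> kappa <= gamma t - 2^-1 * dbeta t} ->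
  test_function a b phi -> a < s -> e < b ->
  (forall t, ~ (s <= t <= e) -> phi t = 0) -> (forall t, 0 <= phi t) ->
  0 <= \int[mu]_(t in `[a, b]) (beta t * phi^`()%classic t + 2 * gamma t * phi t).
Proof.
move=> hb hg [_ ldb H] k0 coer tphi as_ eb out phi0.
have [dphi _ _] := tphi.
have cphi : continuous phi.
  by move=> t; apply/differentiable_continuous/derivable1_diffP; exact: (dphi 0%N).
have cdphi : continuous phi^`()%classic.
  by move=> t; apply/differentiable_continuous/derivable1_diffP; exact: (dphi 1%N).
have i1 : mu.-integrable `[a, b] (EFin \o (fun t => beta t * phi^`()%classic t)).
  exact: continuous_integrableM.
have h2g : bdm (fun t => 2 * gamma t) by apply: bdmM => //; exact: bdm_cst.
have i2 e0 e1 : mu.-integrable `[e0, e1] (EFin \o (fun t => 2 * gamma t * phi t)).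
  exact: (continuous_integrableM _ _ h2g).
have sub_oo : `]a, b[ `<=` `[a, b] by exact: subset_itv_oo_cc.
rewrite RintegralD//; try exact: i2.
rewrite -[X in X + _]Rint_oo; last by apply: integrableS i1.
have := H _ tphi; rewrite derive1n1 => ->.
have subK : `[s, e] `<=` `]a, b[.
  by move=> t /=; rewrite !in_itv/= => /andP[st te]; rewrite (lt_le_trans as_)//= (le_lt_trans te).
rewrite expr1 mulN1r (@Rint_support _ `]a, b[%classic `[s, e]%classic)//; last first.
  by move=> t _ /= /negP; rewrite in_itv/= => /negP tse; rewrite out// mulr0.
rewrite (@Rint_support _ `[a, b]%classic `[s, e]%classic); last 2 first.
- exact: subset_trans subK sub_oo.
- by move=> t _ /= /negP; rewrite in_itv/= => /negP tse; rewrite out// mulr0.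
have [M phiM] : exists M, forall t, `[s, e]%classic t -> `|phi t| <= M.
  have [es|se] := ltP e s.
    exists 0 => t /=; rewrite in_itv/= => /andP[st te].
    by have := le_trans st te; rewrite leNgt es.
  have [|c _ cM] := @EVT_max R (fun t => `|phi t|) s e se; last first.
    by exists `|phi c| => t; exact: cM.
  by apply: continuous_subspaceT => t; apply: cvg_norm; exact: cphi.
have mphi D : measurable_fun D phi.
  by apply: measurable_funTS; exact: continuous_measurable_fun.
have hphi : bdm (phi \_ `[s, e]) by exact: bdm_patch phiM.
have idb : mu.-integrable `[s, e] (EFin \o dbeta) by exact: locally_integrable_itv ldb _ _.
have i3 : mu.-integrable `[s, e] (EFin \o (fun t => dbeta t * phi t)).
  have := bdm_integrableM (measurable_itv _) hphi idb.
  by apply: eq_integrable => // t tse /=; rewrite patchE tse mulrC.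
rewrite addrC -RintegralB//; try exact: i2.
have mI : measurable_fun `[s, e] (fun t => 2 * gamma t * phi t - dbeta t * phi t).
  have i4 := RintegrableB (measurable_itv _) (i2 s e) i3.
  by case/integrableP: i4 => /measurable_EFinP.
(* The integrand is nonnegative only almost everywhere; its absolute value has the same integral and
   is nonnegative everywhere. *)
rewrite (@Rint_ae _ _ _ (fun t => `|2 * gamma t * phi t - dbeta t * phi t|))//.
- by apply: Rintegral_ge0.
- exact: measurableT_comp.
- apply: (@filterS _ _ (ae_filter_ringOfSetsType mu) _ _ _ coer) => t ct tse.
  rewrite ger0_norm// -mulrBl mulr_ge0//.
  have := le_trans k0 (ct (subK _ tse)); lra.
Qed.

Lemma cvg_sum_seq (I : eqType) (l : seq I) (f : I -> nat -> R) (c : I -> R) :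
  {in l, forall i, f i n @[n --> \oo] --> c i} ->
  (\sum_(i <- l) f i n) @[n --> \oo] --> \sum_(i <- l) c i.
Proof.
elim: l => [|i l IH] fc.
  by rewrite big_nil; under eq_fun do rewrite big_nil; exact: cvg_cst.
rewrite big_cons; under eq_fun do rewrite big_cons.
apply: cvgD; first by apply: fc; rewrite mem_head.
by apply: IH => j jl; apply: fc; rewrite inE jl orbT.
Qed.

Lemma abel_sum (p theta : nat -> R) N : p 0%N = 0 -> p N.+1 = 0 ->
  \sum_(0 <= i < N.+1) (p i.+1 - p i) * theta i =
  \sum_(1 <= i < N.+1) p i * (theta i.-1 - theta i).
Proof.
move=> p0 pN; under eq_bigr do rewrite mulrBl; rewrite sumrB.
rewrite big_nat_recr//= pN mul0r addr0 [X in _ - X]big_nat_recl//= p0 mul0r add0r.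
by rewrite -sumrB [RHS]big_add1/=; apply: eq_bigr => i _; rewrite mulrBr.
Qed.

Lemma Rint_sum (I : Type) (l : seq I) (F : I -> R -> R) D : measurable D ->
  (forall i, mu.-integrable D (EFin \o F i)) ->
  mu.-integrable D (EFin \o (fun t => \sum_(i <- l) F i t)) /\
  \int[mu]_(t in D) (\sum_(i <- l) F i t) = \sum_(i <- l) \int[mu]_(t in D) F i t.
Proof.
move=> mD iF; elim: l => [|i l [iI IH]].
  rewrite (_ : (fun _ => _) = fun=> 0); last by apply/funext => t; rewrite big_nil.
  by split; [exact: integrable0|rewrite big_nil Rintegral_cst// mul0r].
rewrite (_ : (fun _ => _) = fun t => F i t + \sum_(j <- l) F j t); last first.
  by apply/funext => t; rewrite big_cons.
by split; [exact: RintegrableD|rewrite big_cons RintegralD// IH].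
Qed.

(* The piecewise function equal to [F i] on [`]x i.-1, x i]]. *)
Definition pw (x : nat -> R) N (F : nat -> R -> R) (t : R) : R :=
  \sum_(1 <= i < N.+1)
    F i t * (\1_(`]x i.-1, +oo[%classic) t - \1_(`]x i, +oo[%classic) t).

(** The integral is twice that of (beta e' + gamma e) e. It is the limit of the integrals of
    [test_function_ge0] for the smoothed squares [phi n], taken term by term over the mesh
    points. *)
Lemma coercivity beta dbeta gamma kappa a b x N (e : nat -> {poly R}) :
  bdm beta -> bdm gamma ->
  is_weak_derivative a b 1 beta dbeta -> 0 <= kappa ->
  {ae mu, forall t, t \in `]a, b[ -> kappa <= gamma t - 2^-1 * dbeta t} ->
  is_mesh a b N x -> (1 <= N)%N ->
  (forall i, (1 <= i < N)%N -> (e i).[x i] = (e i.+1).[x i]) ->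
  (e 1%N).[a] = 0 -> (e N).[b] = 0 ->
  0 <= \int[mu]_(t in `[a, b]) (beta t * pw x N (fun i t => (e i ^+ 2)^`().[t]) t
      + 2 * gamma t * pw x N (fun i t => (e i ^+ 2).[t]) t).
Proof.
move=> hb hg wd k0 coer [x0 xN xinc] N1 econt ea eb.
(* The squares are extended by 0 beyond both ends of the mesh, which removes the end terms of
   [abel_sum]. The conditions at a and b then say that [d 0] and [d N] vanish at their mesh points
   like the interior differences. *)
pose p i := if (1 <= i <= N)%N then e i ^+ 2 else 0.
pose d i := p i.+1 - p i.
have dx i : (i <= N)%N -> (d i).[x i] = 0.
  rewrite /d /p hornerD hornerN ltnS /= => iN.
  have [->|i0] := posnP i.
    by rewrite N1 /= horner0 subr0 x0 horner_exp ea expr0n.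
  rewrite iN/=; case: ltnP => [iN'|Ni].
    by rewrite !horner_exp econt ?i0// subrr.
  have -> : i = N by apply/eqP; rewrite eqn_leq iN.
  by rewrite xN horner_exp eb expr0n horner0 subrr.
(* Every step is shifted right by one width, except the last, shifted left by two: the support then
   lies in [a + 1/(n + 1), b - 1/(n + 1)]. *)
pose sg i : R := if i == N then -2 else 1.
pose y n i := x i + sg i / n.+1%:R.
pose s0 n := [seq (d i, y n i, 0%N) | i <- index_iota 0 N.+1].
pose phi n := eval_steps n.+1%:R (s0 n).
have phiE n t : phi n t = \sum_(0 <= i < N.+1) (d i).[t] * step_at n.+1%:R (y n i) 0 t.
  by rewrite /phi /eval_steps big_map.
(* Grouped by elements, phi is visibly nonnegative, as a step decreases when its position moves
   right. The grouping by mesh points in [phiE] is the one that passes to the limit. *)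
have phiA n t : phi n t = \sum_(1 <= i < N.+1)
    (p i).[t] * (step_at n.+1%:R (y n i.-1) 0 t - step_at n.+1%:R (y n i) 0 t).
  rewrite phiE -(@abel_sum (fun i => (p i).[t]) (fun i => step_at n.+1%:R (y n i) 0 t)).
  - by apply: eq_bigr => i _; rewrite hornerD hornerN.
  - by rewrite /p horner0.
  - by rewrite /p ltnn andbF horner0.
have der n k t : is_derive t (1 : R) (eval_steps n.+1%:R (iter k deriv_steps (s0 n)))
    (eval_steps n.+1%:R (iter k.+1 deriv_steps (s0 n)) t).
  exact: is_derive_eval_steps.
have dphiE n t : (phi n)^`()%classic t = \sum_(0 <= i < N.+1)
    ((d i)^`().[t] * step_at n.+1%:R (y n i) 0 t + (d i).[t] * step_at n.+1%:R (y n i) 1 t).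
  rewrite derive1E (@derive_val _ _ _ _ _ _ _ (der n 0%N t))/=.
  by rewrite /eval_steps /deriv_steps /s0 big_cat !big_map big_split.
have xmono i j : (i <= j)%N -> (j <= N)%N -> x i <= x j.
  elim: j => [|j IH]; first by rewrite leqn0 => /eqP ->.
  rewrite leq_eqVlt => /predU1P[->//|]; rewrite ltnS => ij jN.
  by rewrite (le_trans (IH ij (ltnW jN)))// ltW// (xinc j.+1).
have xN1 : x N.-1 < b by rewrite -xN; apply: xinc; rewrite N1 leqnn.
have ab : a < b by rewrite (le_lt_trans _ xN1)// -x0 xmono// leq_pred.
have near_ge0 : \forall n \near \oo, 0 <= \int[mu]_(t in `[a, b])
    (beta t * (phi n)^`()%classic t + 2 * gamma t * phi n t).
  near=> n.
  have n0 : 0 < n.+1%:R^-1 :> R by rewrite invr_gt0.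
  (* Three widths: one for the step at [x N.-1] moved right, two for the last step moved left, so
     that their order is kept. *)
  have nsmall : 3 / n.+1%:R < b - x N.-1.
    by near: n; apply: harmonic_small; rewrite subr_gt0.
  have ymono i : (1 <= i <= N)%N -> y n i.-1 <= y n i.
    move=> /andP[i1 iN]; rewrite /y /sg.
    rewrite (_ : (i.-1 == N) = false); last by apply/eqP => E; move: iN i1; rewrite -E; case: i E => //= i _; rewrite ltnn.
    have [->|_] := eqVneq i N; last by rewrite lerD2r ltW// xinc// i1.
    rewrite xN; move: nsmall; move: (n.+1%:R^-1) => w; lra.
  have y0 : y n 0%N = a + n.+1%:R^-1.
    by rewrite /y /sg x0 ltn_eqF// mul1r.
  have yN : y n N = b - 2 / n.+1%:R by rewrite /y /sg eqxx xN mulNr.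
  have ymono0 i : (i <= N)%N -> y n 0%N <= y n i.
    elim: i => // i IH iN; rewrite (le_trans (IH (ltnW iN)))//.
    exact: (ymono i.+1).
  have ymonoN i : (i <= N)%N -> y n i <= y n N.
    move=> iN; rewrite -(subKn iN); elim: (N - i)%N => [|k IH]; first by rewrite subn0.
    have [Nk|kN] := leqP N k.
      by have -> : (N - k.+1 = N - k)%N by rewrite (eqP (leqW Nk)) (eqP Nk).
    rewrite (le_trans _ IH)// subnS.
    by apply: ymono; rewrite subn_gt0 kN leq_subr.
  have out t : ~ (a + n.+1%:R^-1 <= t <= b - n.+1%:R^-1) -> phi n t = 0.
    move=> /negP; rewrite negb_and -!ltNge => /orP[ta|bt].
      rewrite phiE big_seq big1// => i; rewrite mem_index_iota ltnS => iN; rewrite step_at_le ?mulr0//.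
      by rewrite (le_trans (ltW ta))// -y0 ymono0.
    rewrite phiA big_seq big1// => i; rewrite mem_index_iota ltnS => /andP[i1 iN].
    have ge1 j : (j <= N)%N -> step_at n.+1%:R (y n j) 0 t = 1.
      move=> jN; rewrite step_at0_ge// (le_trans _ (ltW bt))//.
      have := ymonoN j jN; rewrite yN; move: (n.+1%:R^-1) => w; lra.
    by rewrite !ge1 ?subrr ?mulr0// (leq_trans (leq_pred _)).
  have dn := derive1n_seq (der n).
  have supp : closure [set t | phi n t != 0] `<=` `[a + n.+1%:R^-1, b - n.+1%:R^-1].
    rewrite [X in _ `<=` X](closure_id _).1; last exact: itv_closed.
    apply: closure_subset => t /=; apply: contraNP => /negP nt.
    by rewrite out// => tt; move: nt; rewrite in_itv/= tt.
  apply: (@test_function_ge0 beta dbeta gamma kappa (phi n) a b (a + n.+1%:R^-1) (b - n.+1%:R^-1)) => //.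
  - split.
    + by move=> k t; have := dn k; rewrite /= => ->; case: (der n k t).
    + by apply: subclosed_compact supp; [exact: closed_closure|exact: segment_compact].
    + apply: subset_trans supp _ => t /=; rewrite !in_itv/= => /andP[at_ tb].
      by rewrite (lt_le_trans _ at_) ?ltrDl//= (le_lt_trans tb)// gtrBl.
  - by rewrite ltrDl.
  - by rewrite gtrBl.
  - move=> t; rewrite phiA big_seq sumr_ge0// => i; rewrite mem_index_iota ltnS => i1N.
    rewrite mulr_ge0//; first by rewrite /p i1N horner_exp sqr_ge0.
    by rewrite subr_ge0 step_at0_mono// ymono.
have bdt n i : mu.-integrable `[a, b] (EFin \o term beta gamma (d i) n.+1%:R (y n i)).
  apply: RintegrableD => //; apply: continuous_integrableM => //; last 2 first.
  - by apply: bdmM => //; exact: bdm_cst.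
  - by move=> t; apply: cvgM; [exact: continuous_horner|exact: step_at_continuous].
  by move=> t; apply: cvgD; apply: cvgM; first [exact: continuous_horner|exact: step_at_continuous].
have lim : (fun n => \int[mu]_(t in `[a, b]) (beta t * (phi n)^`()%classic t + 2 * gamma t * phi n t)) @ \oo -->
   \sum_(0 <= i < N.+1) \int[mu]_(t in `[a, b]) ((beta t * (d i)^`().[t] + 2 * gamma t * (d i).[t]) * \1_(`]x i, +oo[%classic) t).
  rewrite (_ : (fun n => _) = (fun n => \sum_(0 <= i < N.+1) \int[mu]_(t in `[a, b]) term beta gamma (d i) n.+1%:R (y n i) t)).
    apply: cvg_sum_seq => i; rewrite mem_index_iota ltnS => iN.
    exact: cvg_term (dx i iN).
  apply/funext => n; rewrite -(Rint_sum _ _ (bdt n)).2//; apply: eq_Rintegral => t _.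
  by rewrite dphiE phiE !mulr_sumr -big_split.
apply: (le_trans (cvgr_to_ge lim near_ge0)); rewrite -(Rint_sum _ _ _).2//; last first.
  move=> i; apply: (@eq_integrable _ _ _ mu _ _ (EFin \o (fun t => \1_(`]x i, +oo[%classic) t *
    (beta t * (d i)^`().[t] + 2 * gamma t * (d i).[t])))) => //.
    by move=> t _ /=; rewrite mulrC.
  apply: bdm_integrableM => //; first exact: bdm_indic.
  apply: RintegrableD => //; apply: continuous_integrableM => //; try exact: continuous_horner.
  by apply: bdmM => //; exact: bdm_cst.
rewrite le_eqVlt; apply/orP; left; apply/eqP; apply: eq_Rintegral => t _.
transitivity (beta t * \sum_(0 <= i < N.+1) ((p i.+1)^`().[t] - (p i)^`().[t]) * \1_(`]x i, +oo[%classic) t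
  + 2 * gamma t * \sum_(0 <= i < N.+1) ((p i.+1).[t] - (p i).[t]) * \1_(`]x i, +oo[%classic) t).
  rewrite !mulr_sumr -big_split; apply: eq_bigr => i _ /=.
  by rewrite /d derivB !(hornerD, hornerN); ring.
have p0 : p 0%N = 0 by [].
have pN : p N.+1 = 0 by rewrite /p ltnn andbF.
rewrite (@abel_sum (fun i => (p i)^`().[t]) (fun i => \1_(`]x i, +oo[%classic) t)); last 2 first.
- by rewrite p0 deriv0 horner0.
- by rewrite pN deriv0 horner0.
rewrite (@abel_sum (fun i => (p i).[t]) (fun i => \1_(`]x i, +oo[%classic) t)); last 2 first.
- by rewrite p0 horner0.
- by rewrite pN horner0.
rewrite /pw; congr (_ * _ + _ * _); rewrite big_seq [RHS]big_seq; apply: eq_bigr => i;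
  by rewrite mem_index_iota ltnS /p => ->.
Unshelve. all: by end_near. Qed.

End Coercivity.

(** * Weighted Cauchy-Schwarz, the reference map, and integrals over the mesh *)

Section Auxiliary.
Variable R : realType.
Implicit Types (a b c d s t : R) (p q : {poly R}).
Local Notation mu := (@lebesgue_measure R).

(** Weighted Cauchy-Schwarz: T times the difference of the two sides is the sum of the A i (T y i -
    Y / A i)^2. T can only vanish for the empty list. *)
Lemma sqr_sum_le (I : eqType) (l : seq I) (A y : I -> R) :
  {in l, forall i, 0 < A i} ->
  (\sum_(i <- l) y i) ^+ 2 <= (\sum_(i <- l) (A i)^-1) * \sum_(i <- l) A i * y i ^+ 2.
Proof.
move=> A0; set T := \sum_(i <- l) (A i)^-1; set Y := \sum_(i <- l) y i; set Q := \sum_(i <- l) _.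
have T0 : 0 <= T by rewrite /T big_seq sumr_ge0// => i /A0 ?; rewrite invr_ge0 ltW.
have Q0 : 0 <= Q by rewrite /Q big_seq sumr_ge0// => i /A0 ?; rewrite mulr_ge0 ?sqr_ge0// ltW.
have key : 0 <= T * (T * Q - Y ^+ 2).
  have -> : T * (T * Q - Y ^+ 2) = \sum_(i <- l) A i * (T * y i - Y / A i) ^+ 2.
    rewrite big_seq (eq_bigr (fun i => T ^+ 2 * (A i * y i ^+ 2) - 2 * T * Y * y i + Y ^+ 2 * (A i)^-1)).
      rewrite -big_seq !big_split/= sumrN -!mulr_sumr -/T -/Y -/Q; ring.
    by move=> i /A0 Ai; field; rewrite gt_eqF.
  by rewrite big_seq sumr_ge0// => i /A0 ?; rewrite mulr_ge0 ?sqr_ge0// ltW.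
move: T0; rewrite le_eqVlt => /predU1P[T0|T0]; last first.
  by rewrite pmulr_rge0// subr_ge0 in key.
suff -> : Y = 0 by rewrite expr0n/= mulr_ge0// -T0.
rewrite /Y big_seq big1// => i il; exfalso.
have : \sum_(j <- l) (A j)^-1 = 0 by rewrite -/T -T0.
rewrite big_seq => /eqP; rewrite psumr_eq0 => [/allP/(_ i il)|j /A0 ?]; last by rewrite invr_ge0 ltW.
by rewrite il/= invr_eq0 gt_eqF// A0.
Qed.

(** [L] is the affine map of [-1, 1] onto [c, d]; it carries the reference nodes to the Gauss points
    of the element. *)
Lemma gauss_itv_poly c d p : let L := (((c + d) / 2)%:P + ((d - c) / 2) *: 'X) in
  [/\ (size (p \Po L) <= size p)%N, (p \Po L).[1] = p.[d], (p \Po L).[-1] = p.[c] &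
    forall t, (p \Po L)^`().[t] = (d - c) / 2 * p^`().[(d + c + (d - c) * t) / 2]].
Proof.
move=> L; have L2 : (size L <= 2)%N.
  rewrite (leq_trans (size_polyD _ _))// geq_max (leq_trans (size_polyC_leq1 _))//=.
  by rewrite (leq_trans (size_scale_leq _ _))// size_polyX.
have LE t : L.[t] = (d + c + (d - c) * t) / 2.
  by rewrite /L hornerD hornerC hornerZ hornerX; field.
split.
- have [->|p0] := eqVneq p 0; first by rewrite comp_poly0.
  rewrite (leq_trans (size_comp_poly_leq _ _))//.
  have : (0 < size p)%N by rewrite size_poly_gt0.
  by case: (size p) => // n _; rewrite ltnS/= -{2}[n]muln1 leq_mul2l; case: (size L) L2 => [|[|[]]]//= _; rewrite orbT.
- by rewrite horner_comp LE; congr (_.[_]); field.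
- by rewrite horner_comp LE; congr (_.[_]); field.
- move=> t; rewrite deriv_comp hornerM horner_comp LE mulrC; congr (_ * _).
  by rewrite /L derivD derivC add0r derivZ derivX hornerZ -polyC1 hornerC mulr1.
Qed.

Variables (a b : R) (x : nat -> R) (N : nat).
Hypothesis hx : is_mesh a b N x.

Lemma mesh_mono i j : (i <= j)%N -> (j <= N)%N -> x i <= x j.
Proof.
have [_ _ xinc] := hx.
elim: j => [|j IH]; first by rewrite leqn0 => /eqP ->.
rewrite leq_eqVlt => /predU1P[->//|]; rewrite ltnS => ij jN.
by rewrite (le_trans (IH ij (ltnW jN)))// ltW// (xinc j.+1).
Qed.

Lemma mesh_sum (F : nat -> R) k : \sum_(1 <= i < k.+1) (F i - F i.-1) = F k - F 0%N.
Proof. by rewrite big_add1/= telescope_sumr. Qed.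

Lemma mesh_find t : a < t <= b -> exists2 k, (1 <= k <= N)%N & x k.-1 < t <= x k.
Proof.
have [x0 xN _] := hx; move=> /andP[at_ tb].
have : exists k, (k <= N)%N && (t <= x k) by exists N; rewrite leqnn xN.
move=> /ex_minnP[k /andP[kN tk] kmin]; case: k kN tk kmin => [|k] kN tk kmin.
  by move: at_; rewrite -x0 ltNge tk.
exists k.+1; rewrite ?kN//= tk andbT ltNge; apply/negP => tk'.
by have := kmin k; rewrite (ltnW kN) tk' ltnn => /(_ isT).
Qed.

Lemma pwE F t k : (1 <= k <= N)%N -> x k.-1 < t <= x k -> pw x N F t = F k t.
Proof.
move=> /andP[k1 kN] /andP[kt tk]; rewrite /pw (bigD1_seq k) ?iota_uniq ?mem_index_iota ?k1 ?ltnS//=.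
rewrite !indicE mem_set/= ?in_itv/= ?kt// memNset/=; last first.
  by rewrite in_itv/= andbT; apply/negP; rewrite -leNgt.
rewrite subr0 mulr1 big_seq_cond big1 ?addr0// => i.
rewrite mem_index_iota ltnS => /andP[/andP[i1 iN] ik].
have [ik'|ki|E] := ltngtP i k; last by rewrite E eqxx in ik.
  have xit : x i < t by rewrite (le_lt_trans _ kt)// mesh_mono// ?(leq_trans (leq_pred _))// -ltnS prednK.
  have xit' : x i.-1 < t by rewrite (le_lt_trans _ xit)// mesh_mono// leq_pred.
  by rewrite !indicE !mem_set/= ?in_itv/= ?xit ?xit'// subrr mulr0.
have txi : t <= x i.-1 by rewrite (le_trans tk)// mesh_mono// ?(leq_trans (leq_pred _))// -ltnS prednK.
have txi' : t <= x i by rewrite (le_trans txi)// mesh_mono// leq_pred.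
by rewrite !indicE !memNset/= ?in_itv/= ?andbT ?subrr ?mulr0//; apply/negP; rewrite -leNgt.
Qed.

Lemma pw_left F : pw x N F a = 0.
Proof.
have [x0 _ _] := hx; rewrite /pw big_nat big1// => i /andP[i1 iN].
have ge_a j : (j <= N)%N -> \1_(`]x j, +oo[%classic) a = 0 :> R.
  move=> jN; rewrite indicE memNset//= in_itv/= andbT; apply/negP.
  by rewrite -leNgt -x0 mesh_mono.
by rewrite !ge_a ?subrr ?mulr0// (leq_trans (leq_pred _)).
Qed.

Lemma bdm_pw_poly (q : nat -> {poly R}) : bdm (pw x N (fun i => horner (q i))).
Proof.
rewrite (_ : pw _ _ _ = fun t => \sum_(i <- index_iota 1 N.+1) ((horner (q i)) \_ `]x i.-1, x i]) t *
   (if (1 <= i <= N)%N then 1 else 0)).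
  apply: bdm_sum => i; apply: bdmM; last first.
    by case: ifP => _; exact: bdm_cst.
  have [M M0 qM] := poly_bound_itv (q i) (x i.-1) (x i).
  apply: (@bdm_patch _ _ _ M) => //.
    by apply: measurable_funTS; apply: continuous_measurable_fun; exact: continuous_horner.
  by move=> t /= ti; apply: qM; move: ti; rewrite !in_itv/= => /andP[/ltW -> ->].
apply/funext => t; rewrite /pw big_seq [RHS]big_seq; apply: eq_bigr => i.
rewrite mem_index_iota ltnS => iN; rewrite iN mulr1 patchE !indicE !mem_setE !in_itv/= !andbT.
have [_ _ /(_ i iN) xi] := hx.
case: (ltP (x i) t) => it; case: (ltP (x i.-1) t) => it' /=; rewrite ?subrr ?subr0 ?mulr1 ?mulr0//.
by have := lt_trans xi it; rewrite ltNge it'.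
Qed.

Lemma Rint_mesh_le (f : R -> R) (B : nat -> R) : mu.-integrable `[a, b] (EFin \o f) ->
  (forall k, (1 <= k <= N)%N -> forall t, x k.-1 < t < x k -> `|f t| <= B k) ->
  `|\int[mu]_(t in `[a, b]) f t| <= \sum_(1 <= k < N.+1) (x k - x k.-1) * B k.
Proof.
have [x0 xN xinc] := hx; move=> if_ fB.
suff H k : (k <= N)%N -> `|\int[mu]_(t in `[a, x k]) f t| <= \sum_(1 <= i < k.+1) (x i - x i.-1) * B i.
  by rewrite -{1}xN; exact: H.
have iS s t : a <= s -> t <= b -> mu.-integrable `[s, t] (EFin \o f).
  move=> as_ tb; apply: integrableS if_ => // u /=; rewrite !in_itv/= => /andP[su ut].
  by rewrite (le_trans as_)//= (le_trans ut).
have xb j : (j <= N)%N -> x j <= b by move=> jN; rewrite -xN mesh_mono.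
have ax j : (j <= N)%N -> a <= x j by move=> jN; rewrite -x0 mesh_mono.
elim: k => [|k IH] kN.
  by rewrite x0 set_itv1 Rintegral_set1 normr0 big_geq.
have xk : x k < x k.+1 by exact: (xinc k.+1).
rewrite big_nat_recr//= (@Rint_cat _ f a (x k)) ?ax ?(ltnW kN) ?(ltW xk)//; last exact: iS (xb _ kN).
rewrite (le_trans (ler_normD _ _))// lerD ?IH ?(ltnW kN)// mulrC.
apply: Rint_normM_le; [exact: ltW|exact: iS (ax _ (ltnW kN)) (xb _ kN)|].
exact: (fB k.+1).
Qed.

Lemma mesh_size_le i : (1 <= i <= N)%N -> x i - x i.-1 <= mesh_size N x.
Proof.
move=> iN; rewrite /mesh_size; apply: (@le_bigmax_seq _ _ _ _ _ i xpredT (fun i => x i - x i.-1)) => //.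
by rewrite mem_index_iota ltnS.
Qed.

End Auxiliary.

(** * Discrete stability *)

Section Stability.
Variable R : realType.
Local Notation mu := (@lebesgue_measure R).

Definition node (G : nat -> R) (c d : R) (j : nat) : R := (d + c + (d - c) * G j) / 2.

Lemma node_bounds r G c d j : gauss_nodes r G -> c < d -> (1 <= j <= r)%N ->
  c < node G c d j < d.
Proof.
move=> hG cd jr; have /andP[G1 G2] := gauss_nodes_bounds hG jr.
have dc : 0 < d - c by rewrite subr_gt0.
have := ltr_pM2l dc; move=> H; have := H (-1) (G j); have := H (G j) 1; rewrite G1 G2 => h1 h2.
have {h1} h1 : (d - c) * G j < (d - c) * 1 by rewrite h1.
have {h2} h2 : (d - c) * (-1) < (d - c) * G j by rewrite h2.
by rewrite /node; apply/andP; split; lra.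
Qed.

(** Affine images of the facts on [-1, 1], so that the same weights and constants serve every
    element of every mesh. The majorant of the sup norm in the second part is the quantity [S] of
    the stability estimate. *)
Lemma gauss_rule r G : gauss_nodes r G ->
  exists (A : nat -> R) (K Cg : R), [/\ 0 <= K, 0 < Cg, (forall j, (1 <= j <= r)%N -> 0 < A j) &
  forall c d (p : {poly R}), c < d -> (size p <= r.+1)%N ->
  let g := node G c d in
  [/\ \sum_(1 <= j < r.+1) A j * ((d - c) / 2) * p^`().[g j] = p.[d] - p.[c],
      (forall t, c <= t <= d -> `|p^`().[t]| <= K * \sum_(1 <= j < r.+1) `|p^`().[g j]|) &
      (d - c) * (K * \sum_(1 <= j < r.+1) `|p^`().[g j]|) ^+ 2 <=
        Cg * \sum_(1 <= j < r.+1) A j * ((d - c) / 2) * p^`().[g j] ^+ 2]].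
Proof.
move=> hG; have [A [A0 exact_]] := gauss_quadrature hG.
have [K K0 Kp] := gauss_nodes_norm hG.
pose T := \sum_(1 <= j < r.+1) (A j)^-1.
have T0 : 0 <= T.
  by rewrite /T big_seq sumr_ge0// => j; rewrite mem_index_iota ltnS => /A0 ?; rewrite invr_ge0 ltW.
(* [sqr_sum_le] gives K^2 T; the factor 2 compensates the half length (d - c)/2, and 1 is added for
   strict positivity. *)
exists A, K, (2 * K ^+ 2 * T + 1); split => //.
- exact: ltW.
- rewrite ltr_wpDl//; do ?[apply: mulr_ge0|apply: exprn_ge0] => //; exact: ltW.
move=> c d p cd sp g.
have dc : 0 < d - c by rewrite subr_gt0.
have [sL L1 LN1 dL] := gauss_itv_poly c d p.
set q := p \Po _ in sL L1 LN1 dL.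
have sq : (size q <= r.+1)%N by exact: leq_trans sL sp.
have sq' : (size q^`() <= r)%N.
  have [->|q0] := eqVneq q 0; first by rewrite deriv0 size_poly0.
  by rewrite -ltnS (leq_trans (lt_size_deriv q0)).
split.
- rewrite -L1 -LN1 -exact_//; apply: eq_bigr => j _.
  by rewrite dL [RHS]mulrA.
- move=> t /andP[ct td]; pose s := (2 * t - (d + c)) / (d - c).
  have s1 : -1 <= s <= 1 by rewrite /s ler_pdivlMr// ler_pdivrMr//; apply/andP; split; lra.
  have := Kp _ sq' s s1; rewrite dL.
  have -> : (d + c + (d - c) * s) / 2 = t by rewrite /s; field; rewrite gt_eqF.
  under eq_bigr do rewrite dL normrM; rewrite -mulr_sumr normrM mulrCA.
  by rewrite ler_pM2l// gtr0_norm ?divr_gt0.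
- have := @sqr_sum_le R _ (index_iota 1 r.+1) A (fun j => `|p^`().[g j]|).
  have A0' : {in index_iota 1 r.+1, forall j, 0 < A j}.
    by move=> j; rewrite mem_index_iota ltnS; exact: A0.
  move=> /(_ A0'); rewrite -/T => H.
  have -> : \sum_(1 <= j < r.+1) A j * ((d - c) / 2) * p^`().[g j] ^+ 2 =
      (\sum_(1 <= j < r.+1) A j * `|p^`().[g j]| ^+ 2) * ((d - c) / 2).
    by rewrite mulr_suml; apply: eq_bigr => j _; rewrite real_normK ?num_real// mulrAC.
  set Q := \sum_(1 <= j < r.+1) _ in H *; set Y := \sum_(1 <= j < r.+1) _ in H *.
  have Y0 : 0 <= Y.
    by rewrite /Y big_seq sumr_ge0// => j /A0' ?; rewrite mulr_ge0 ?sqr_ge0// ltW.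
  rewrite exprMn.
  have := ler_wpM2l (mulr_ge0 (ltW dc) (sqr_ge0 K)) H.
  have := mulr_ge0 Y0 (ltW dc).
  move: (Q ^+ 2) => Q2; lra.
Qed.

Variables (r : nat) (G : nat -> R) (a b : R) (alpha beta dbeta gamma : R -> R) (alpha0 kappa M : R).
Hypotheses (hr : (1 <= r)%N) (hG : gauss_nodes r G) (hab : a < b).
Hypotheses (hbeta : bdm beta) (hgamma : bdm gamma).
Hypotheses (betaM : forall t, `|beta t| <= M) (gammaM : forall t, `|gamma t| <= M).
Hypotheses (alphaM : forall t, t \in `[a, b] -> `|alpha t| <= M).
Hypotheses (alpha0_gt0 : 0 < alpha0) (halpha : forall t, t \in `[a, b] -> alpha0 <= alpha t).
Hypotheses (hbetaW : is_weak_derivative a b 1 beta dbeta) (hkappa : 0 <= kappa).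
Hypothesis hcoer : {ae mu, forall t, t \in `]a, b[ -> kappa <= gamma t - 2^-1 * dbeta t}.

Let L := b - a.
Let M0 : 0 <= M. Proof. exact: le_trans (normr_ge0 _) (betaM 0). Qed.

(** Quantified so that h0 and C are fixed before the mesh. [eta1] and [eta0] stand for u' - p' and u
    - p. With F = beta e' + gamma e and W the step function built from J, the identity says that the
    Gauss sum of alpha e'^2, plus the integral of F e, plus the integral of F (W - e), equals the
    consistency terms in [eta1] and [eta0]. *)
Lemma stability : exists h0 C : R, [/\ 0 < h0, 0 <= C &
  forall N (x : nat -> R) (e : nat -> {poly R}) (eta1 eta0 : R -> R) (H : nat -> R),
  is_mesh a b N x -> (1 <= N)%N -> mesh_size N x <= h0 ->
  (forall i, (1 <= i <= N)%N -> (size (e i) <= r.+1)%N) ->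
  (forall i, (1 <= i < N)%N -> (e i).[x i] = (e i.+1).[x i]) ->
  (e 1%N).[a] = 0 -> (e N).[b] = 0 -> bdm eta1 -> bdm eta0 ->
  (forall k, (1 <= k <= N)%N -> 0 <= H k) ->
  (forall k, (1 <= k <= N)%N -> forall t, x k.-1 < t < x k ->
     `|eta1 t| <= H k /\ `|eta0 t| <= L * H k) ->
  (forall J : nat -> nat -> R,
     \sum_(1 <= i < N.+1) \sum_(1 <= j < r.+1) J i j = 0 ->
     \sum_(1 <= i < N.+1) \sum_(1 <= j < r.+1) J i j *
       (alpha (node G (x i.-1) (x i) j) * (e i)^`().[node G (x i.-1) (x i) j] -
        \int[mu]_(t in `[a, node G (x i.-1) (x i) j])
          (beta t * pw x N (fun i => horner (e i)^`()) t + gamma t * pw x N (fun i => horner (e i)) t)) =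
     \sum_(1 <= i < N.+1) \sum_(1 <= j < r.+1) J i j *
       (alpha (node G (x i.-1) (x i) j) * eta1 (node G (x i.-1) (x i) j) -
        \int[mu]_(t in `[a, node G (x i.-1) (x i) j]) (beta t * eta1 t + gamma t * eta0 t))) ->
  exists S : nat -> R, [/\ (forall k, (1 <= k <= N)%N -> 0 <= S k),
     (forall k, (1 <= k <= N)%N -> forall t, x k.-1 <= t <= x k -> `|(e k)^`().[t]| <= S k) &
     \sum_(1 <= k < N.+1) (x k - x k.-1) * S k ^+ 2 <=
       C * \sum_(1 <= k < N.+1) (x k - x k.-1) * H k ^+ 2]].
Proof.
have [A [K [Cg [K0 Cg0 A0 rule]]]] := gauss_rule hG.
have L0 : 0 < L by rewrite subr_gt0.
(* [c1] collects what carries a factor h, [c2] the consistency terms. The threshold on h and the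
   parameter [delta] of Young's inequality are chosen so that each puts at most a quarter of the
   left-hand side on the right, which leaves half of it. *)
pose c1 := Cg * (2 * M * (1 + L)).
pose c2 := Cg * (M * (1 + (1 + L) * L) / 2).
have c10 : 0 <= c1.
  exact: (mulr_ge0 (ltW Cg0) (mulr_ge0 (mulr_ge0 (ler0n _ 2) M0) (addr_ge0 ler01 (ltW L0)))).
have c20 : 0 <= c2.
  exact: (mulr_ge0 (ltW Cg0) (divr_ge0 (mulr_ge0 M0 (addr_ge0 ler01
    (mulr_ge0 (addr_ge0 ler01 (ltW L0)) (ltW L0)))) (ler0n _ 2))).
pose delta := alpha0 / (4 * (c2 + 1)).
have delta0 : 0 < delta by rewrite divr_gt0// mulr_gt0// ltr_wpDl.
exists (alpha0 / (4 * (c1 + 1))), (2 * c2 / (delta * alpha0)); split.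
- by rewrite divr_gt0// mulr_gt0// ltr_wpDl.
- by apply: divr_ge0; apply: mulr_ge0 => //; exact: ltW.
move=> N x e eta1 eta0 H hx N1 hsmall se econt ea eb heta1 heta0 H0 etaH ident.
have [x0 xN xinc] := hx.
pose h k := x k - x k.-1.
have h0 k : (1 <= k <= N)%N -> 0 < h k by move=> kN; rewrite subr_gt0 xinc.
pose g i j := node G (x i.-1) (x i) j.
pose om i j := A j * (h i / 2).
pose J i j := om i j * (e i)^`().[g i j].
pose S k := K * \sum_(1 <= j < r.+1) `|(e k)^`().[g k j]|.
have S0 k : 0 <= S k by rewrite mulr_ge0// sumr_ge0.
have om0 i j : (1 <= i <= N)%N -> (1 <= j <= r)%N -> 0 <= om i j.
  by move=> iN jr; rewrite mulr_ge0 ?divr_ge0 ?ltW ?h0 ?A0.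
have rulee i : (1 <= i <= N)%N -> [/\ \sum_(1 <= j < r.+1) J i j = (e i).[x i] - (e i).[x i.-1],
      (forall t, x i.-1 <= t <= x i -> `|(e i)^`().[t]| <= S i) &
      h i * S i ^+ 2 <= Cg * \sum_(1 <= j < r.+1) om i j * (e i)^`().[g i j] ^+ 2].
  by move=> iN; apply: rule; [exact: xinc|exact: se].
have omsum i : (1 <= i <= N)%N -> \sum_(1 <= j < r.+1) om i j = h i.
  move=> iN; have [] := rule (x i.-1) (x i) 'X (xinc _ iN).
    by rewrite size_polyX.
  rewrite !hornerX => H1 _ _; rewrite /h -H1; apply: eq_bigr => j _.
  by rewrite derivX -polyC1 hornerC mulr1.
have gb i j : (1 <= i <= N)%N -> (1 <= j <= r)%N -> x i.-1 < g i j < x i.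
  by move=> iN jr; exact: (node_bounds hG (xinc _ iN) jr).
(* The values of e at the mesh points; at index 0 there is no element on the left, and e vanishes at
   a. *)
pose U i := if i is 0%N then 0 else (e i).[x i].
have Ue i : (1 <= i <= N)%N -> (e i).[x i.-1] = U i.-1.
  case: i => [|[|i]] // /andP[_ iN]; first by rewrite /= x0.
  by rewrite /= -econt.
have Jsum i : (1 <= i <= N)%N -> \sum_(1 <= j < r.+1) J i j = U i - U i.-1.
  move=> iN; have [-> _ _] := rulee i iN; rewrite Ue//.
  by case: i iN.
(* Since the quadrature is exact on e', each row of J sums to the increment of e over its element,
   and the increments telescope to e(b) - e(a) = 0. *)
have Jtot : \sum_(1 <= i < N.+1) \sum_(1 <= j < r.+1) J i j = 0.
  rewrite big_seq; under eq_bigr => i do (rewrite mem_index_iota ltnS => iN; rewrite Jsum//).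
  rewrite -big_seq mesh_sum subr0 /U; case: N N1 xN eb {ident etaH H0 econt se hsmall hx xinc h0 om0 rulee omsum gb Ue Jsum} => // n _ -> ->//.
pose E1 := pw x N (fun i => horner (e i)^`()); pose E0 := pw x N (fun i => horner (e i)).
have hE1 : bdm E1 by exact: (bdm_pw_poly hx (fun i => (e i)^`())).
have hE0 : bdm E0 by exact: (bdm_pw_poly hx e).
pose F t := beta t * E1 t + gamma t * E0 t.
have hF : bdm F by apply: bdmD; exact: bdmM.
have gab i j : (1 <= i <= N)%N -> (1 <= j <= r)%N -> a <= g i j <= b.
  move=> iN jr; have /andP[g1 g2] := gb i j iN jr; have /andP[i1 iN'] := iN.
  rewrite -x0 -xN; apply/andP; split.
    by rewrite (le_trans _ (ltW g1))// (mesh_mono hx)// (leq_trans (leq_pred _)).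
  by rewrite (le_trans (ltW g2))// (mesh_mono hx).
(* The integral up to c is the total minus the integral beyond c. The total disappears by [Jtot],
   and the remaining integrals combine into one against W. *)
have intF c : a <= c <= b -> \int[mu]_(t in `[a, c]) F t =
    \int[mu]_(t in `[a, b]) F t - \int[mu]_(t in `[a, b]) (F t * \1_(`]c, +oo[%classic) t).
  move=> /andP[ac cb]; rewrite (@Rint_cat _ F a c b ac cb); last exact: bdm_integrable_itv.
  rewrite (@Rint_support _ `[a, b]%classic `]c, b]%classic); last 2 first.
  - by move=> y /=; rewrite !in_itv/= => /andP[y1 y2]; rewrite y2 (le_trans ac)// ltW.
  - move=> y /=; rewrite !in_itv/= => /andP[y1 y2] yc; rewrite indicE memNset ?mulr0//=.
    by rewrite in_itv/= andbT => cy; apply: yc; rewrite cy.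
  rewrite -[X in _ + X - _](@Rintegral_itv_obnd_cbnd _ c); last first.
    apply: (@integrableS _ _ _ mu `[c, b]%classic) => //; last exact: bdm_integrable_itv.
    by apply: subset_itvr; rewrite bnd_simp.
  rewrite [X in _ - X](@eq_Rintegral _ _ _ mu _ F) ?addrK// => y.
  rewrite inE/= in_itv/= => /andP[cy _].
  by rewrite indicE mem_set ?mulr1//= in_itv/= andbT.
(* The part of the quadrature of e' that lies to the left of t: a step function agreeing with e at
   the mesh points. *)
pose W t := \sum_(1 <= i < N.+1) \sum_(1 <= j < r.+1) J i j * \1_(`]g i j, +oo[%classic) t.
have hW : bdm W.
  apply: bdm_sum => i; apply: bdm_sum => j; apply: bdmM; first exact: bdm_cst.
  exact: bdm_indic.
have sumF : \sum_(1 <= i < N.+1) \sum_(1 <= j < r.+1) J i j * \int[mu]_(t in `[a, g i j]) F t =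
    - \int[mu]_(t in `[a, b]) (F t * W t).
  have iFg i j : mu.-integrable `[a, b] (EFin \o (fun t => J i j * (F t * \1_(`]g i j, +oo[%classic) t))).
    by apply: bdm_integrable_itv; apply: bdmM; [exact: bdm_cst|apply: bdmM => //; exact: bdm_indic].
  have -> : \int[mu]_(t in `[a, b]) (F t * W t) = \sum_(1 <= i < N.+1) \sum_(1 <= j < r.+1)
      J i j * \int[mu]_(t in `[a, b]) (F t * \1_(`]g i j, +oo[%classic) t).
    transitivity (\int[mu]_(t in `[a, b]) \sum_(1 <= i < N.+1) \sum_(1 <= j < r.+1)
       J i j * (F t * \1_(`]g i j, +oo[%classic) t)).
      apply: eq_Rintegral => t _; rewrite /W mulr_sumr; apply: eq_bigr => i _.
      by rewrite mulr_sumr; apply: eq_bigr => j _; rewrite mulrCA.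
    rewrite (Rint_sum _ _ _).2//; last by move=> i; exact: (Rint_sum _ _ (iFg i)).1.
    apply: eq_bigr => i _; rewrite (Rint_sum _ _ (iFg i)).2//.
    apply: eq_bigr => j _; rewrite RintegralZl//.
    by apply: bdm_integrable_itv; apply: bdmM => //; exact: bdm_indic.
  transitivity (\sum_(1 <= i < N.+1) \sum_(1 <= j < r.+1) (J i j * \int[mu]_(t in `[a, b]) F t
      - J i j * \int[mu]_(t in `[a, b]) (F t * \1_(`]g i j, +oo[%classic) t))).
    apply: eq_big_nat => i iN; apply: eq_big_nat => j jr.
    by rewrite intF ?gab// mulrBr.
  rewrite (eq_bigr (fun i => (\sum_(1 <= j < r.+1) J i j) * \int[mu]_(t in `[a, b]) F t -
    \sum_(1 <= j < r.+1) J i j * \int[mu]_(t in `[a, b]) (F t * \1_(`]g i j, +oo[%classic) t))).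
    by rewrite sumrB -mulr_suml Jtot mul0r sub0r.
  by move=> i _; rewrite sumrB -mulr_suml.
have emvt k s t : (1 <= k <= N)%N -> x k.-1 <= s -> s <= t -> t <= x k ->
    `|(e k).[t] - (e k).[s]| <= S k * (t - s).
  move=> kN ks st tk; apply: (@MVT_norm_le _ (horner (e k)) (horner (e k)^`())) => //.
  - by move=> y _; exact: is_derive_poly.
  - by apply: continuous_subspaceT => y; exact: continuous_horner.
  - move=> y; rewrite in_itv/= => /andP[sy yt]; have [_ + _] := rulee k kN; apply.
    by rewrite (le_trans ks (ltW sy)) (le_trans (ltW yt) tk).
(* A bound for |e| on all of [a, b], obtained by adding the increments from e(a) = 0. *)
pose sigma := \sum_(1 <= i < N.+1) h i * S i.
have psum (f : nat -> R) k : (forall i, (1 <= i <= N)%N -> 0 <= f i) -> (k <= N)%N ->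
    \sum_(1 <= i < k.+1) f i <= \sum_(1 <= i < N.+1) f i.
  move=> f0 kN; rewrite [leRHS](@big_cat_nat _ _ _ k.+1)//= lerDl big_seq sumr_ge0// => i.
  rewrite mem_index_iota ltnS => /andP[ki iN]; apply: f0; rewrite iN andbT.
  exact: leq_ltn_trans ki.
have hS0 i : (1 <= i <= N)%N -> 0 <= h i * S i by move=> iN; rewrite mulr_ge0// ltW// h0.
have Ub k : (k <= N)%N -> `|U k| <= \sum_(1 <= i < k.+1) h i * S i.
  elim: k => [|k IH] kN; first by rewrite normr0 big_geq.
  have kN' : (1 <= k.+1 <= N)%N by [].
  rewrite big_nat_recr//= -(subrK (U k) (e k.+1).[x k.+1]) addrC (le_trans (ler_normD _ _))//.
  rewrite lerD ?IH ?(ltnW kN)// -(Ue k.+1 kN')/= mulrC.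
  by apply: emvt => //; exact/ltW/(xinc k.+1).
have eb_sigma k t : (1 <= k <= N)%N -> x k.-1 < t < x k -> `|(e k).[t]| <= sigma.
  case: k => // k kN /andP[kt tk].
  have kN' : (k <= N)%N by case/andP: kN => _ /ltnW.
  apply: (@le_trans _ _ (\sum_(1 <= i < k.+2) h i * S i)); last by apply: psum => //; case/andP: kN.
  rewrite big_nat_recr//= -(subrK (U k) (e k.+1).[t]) addrC (le_trans (ler_normD _ _))//.
  rewrite lerD ?Ub// -(Ue k.+1 kN)/= mulrC (le_trans (emvt k.+1 _ _ kN _ _ _))//; [exact: ltW..|].
  by rewrite ler_wpM2l// lerD2r ltW.
(* The previous rows of W add up to e at the left end of the element. The partial row of the current
   element and the increment of e inside it are each at most h S, the weights of a row summing to
   h. *)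
have WE k t : (1 <= k <= N)%N -> x k.-1 < t < x k -> `|W t - (e k).[t]| <= 2 * (h k * S k).
  case: k => // k kN /andP[kt tk]; have /andP[_ kN'] := kN.
  pose w i := \sum_(1 <= j < r.+1) J i j * \1_(`]g i j, +oo[%classic) t.
  have wlt i : (1 <= i <= k)%N -> w i = U i - U i.-1.
    move=> /andP[i1 ik]; have iN : (1 <= i <= N)%N by rewrite i1 (leq_trans ik)// ltnW.
    rewrite -Jsum//; apply: eq_big_nat => j jr; have /andP[_ gx] := gb i j iN jr.
    rewrite indicE mem_set ?mulr1//= in_itv/= andbT (lt_trans gx)// (le_lt_trans _ kt)//.
    by rewrite (mesh_mono hx)// ltnW.
  have wgt i : (k.+2 <= i <= N)%N -> w i = 0.
    move=> /andP[ki iN]; have i1 : (1 <= i <= N)%N by rewrite iN (leq_trans _ ki).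
    rewrite /w big_nat big1// => j jr; have /andP[gx _] := gb i j i1 jr.
    rewrite indicE memNset ?mulr0//= in_itv/= andbT; apply/negP; rewrite -leNgt ltW//.
    rewrite (lt_trans tk)// (le_lt_trans _ gx)// (mesh_mono hx)//; last exact: leq_trans (leq_pred _) iN.
    by case: i ki {iN i1 gx}.
  have Wt : W t = U k + w k.+1.
    have -> : W t = \sum_(1 <= i < N.+1) w i by [].
    rewrite (@big_cat_nat _ _ _ k.+1)//=; last by rewrite ltnS ltnW.
    have -> : \sum_(1 <= i < k.+1) w i = U k.
      transitivity (\sum_(1 <= i < k.+1) (U i - U i.-1)).
        by apply: eq_big_nat => i; exact: wlt.
      by rewrite mesh_sum subr0.
    rewrite (@big_ltn _ _ _ k.+1)//.
    rewrite [X in _ + (_ + X)]big_nat big1 ?addr0// => i /andP[ki iN]; apply: wgt.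
  have wk : `|w k.+1| <= h k.+1 * S k.+1.
    rewrite (le_trans (ler_norm_sum _ _ _))// -(omsum k.+1 kN) mulr_suml big_nat [leRHS]big_nat.
    apply: ler_sum => j jr; rewrite normrM /J normrM.
    have [_ + _] := rulee k.+1 kN; have /andP[g1 g2] := gb k.+1 j kN jr.
    move=> /(_ (g k.+1 j)); rewrite (ltW g1) (ltW g2) => /(_ isT) eS.
    rewrite -[leRHS]mulr1 ler_pM ?mulr_ge0//; last first.
      by rewrite indicE; case: (_ \in _); rewrite ?normr1 ?normr0.
    by rewrite ler_pM// ger0_norm// om0.
  have ek := emvt k.+1 _ _ kN (lexx _) (ltW kt) (ltW tk).
  have ek' : S k.+1 * (t - x k) <= S k.+1 * h k.+1 by rewrite ler_wpM2l// lerD2r ltW.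
  rewrite Wt; have -> : U k + w k.+1 - (e k.+1).[t] = w k.+1 - ((e k.+1).[t] - (e k.+1).[x k]).
    by rewrite (Ue k.+1 kN)/=; ring.
  rewrite (le_trans (ler_normB _ _))// mulr2n mulrDl mul1r lerD//.
  by rewrite (le_trans ek)// [leRHS]mulrC.
(* Twice this integrand is the one of [coercivity], because (e^2)' = 2 e e'. *)
have FE0 : 0 <= \int[mu]_(t in `[a, b]) (F t * E0 t).
  have := coercivity hbeta hgamma hbetaW hkappa hcoer hx N1 econt ea eb.
  rewrite (_ : Rintegral _ _ _ = 2 * \int[mu]_(t in `[a, b]) (F t * E0 t)).
    by rewrite pmulr_rge0.
  rewrite -RintegralZl//; last by apply: bdm_integrable_itv; exact: bdmM.
  apply: eq_Rintegral => t; rewrite inE/= in_itv/= => /andP[].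
  rewrite le_eqVlt => /predU1P[<- _|at_ tb].
    by rewrite /F /E1 /E0 !(pw_left hx); ring.
  have atb : a < t <= b by rewrite at_.
  have [k kN kt] := mesh_find hx atb.
  rewrite /F /E1 /E0 !(pwE hx _ kN kt) deriv_exp/= expr1 hornerMn hornerM horner_exp.
  by rewrite -mulr_natl; ring.
pose X := \sum_(1 <= k < N.+1) h k * S k ^+ 2.
pose Y := \sum_(1 <= k < N.+1) h k * H k ^+ 2.
pose rho := \sum_(1 <= k < N.+1) h k * H k.
pose Z := \sum_(1 <= k < N.+1) h k * (S k * H k).
pose D := delta * X + delta^-1 * Y.
have sum_nat_ge0 (f : nat -> R) : (forall i, (1 <= i <= N)%N -> 0 <= f i) ->
    0 <= \sum_(1 <= i < N.+1) f i.
  by move=> f0; rewrite big_seq sumr_ge0// => i; rewrite mem_index_iota ltnS; exact: f0.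
have sum_nat_le (f1 f2 : nat -> R) : (forall i, (1 <= i <= N)%N -> f1 i <= f2 i) ->
    \sum_(1 <= i < N.+1) f1 i <= \sum_(1 <= i < N.+1) f2 i.
  by move=> f12; rewrite big_seq [leRHS]big_seq ler_sum// => i; rewrite mem_index_iota ltnS; exact: f12.
have X0 : 0 <= X by apply: sum_nat_ge0 => i iN; rewrite mulr_ge0 ?sqr_ge0// ltW// h0.
have Y0 : 0 <= Y by apply: sum_nat_ge0 => i iN; rewrite mulr_ge0 ?sqr_ge0// ltW// h0.
have sigma0 : 0 <= sigma by exact: sum_nat_ge0.
have rho0 : 0 <= rho by apply: sum_nat_ge0 => i iN; rewrite mulr_ge0 ?H0// ltW// h0.
have hsum : \sum_(1 <= k < N.+1) h k = L by rewrite mesh_sum xN x0.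
(* Cauchy-Schwarz with the element lengths as weights, whose sum is L; it compares [sigma] and [rho]
   with [X] and [Y]. *)
have cs (f : nat -> R) : (\sum_(1 <= k < N.+1) h k * f k) ^+ 2 <=
    L * \sum_(1 <= k < N.+1) h k * f k ^+ 2.
  have h0' : {in index_iota 1 N.+1, forall k, 0 < (h k)^-1}.
    by move=> k; rewrite mem_index_iota ltnS => kN; rewrite invr_gt0 h0.
  have := sqr_sum_le (fun k => h k * f k) h0'.
  under [X in _ <= X * _ -> _]eq_bigr do rewrite invrK.
  rewrite hsum => /le_trans; apply; rewrite ler_wpM2l ?(ltW L0)//.
  apply: sum_nat_le => k kN.
  by rewrite le_eqVlt; apply/orP; left; apply/eqP; field; rewrite gt_eqF ?h0.
have sig2 : sigma ^+ 2 <= L * X by exact: cs.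
have rho2 : rho ^+ 2 <= L * Y by exact: cs.
(* Young's inequality with parameter [delta]. *)
have amgm (y z : R) : y * z <= (delta * y ^+ 2 + delta^-1 * z ^+ 2) / 2.
  rewrite ler_pdivlMr// -subr_ge0.
  have -> : delta * y ^+ 2 + delta^-1 * z ^+ 2 - y * z * 2 = delta * (y - z / delta) ^+ 2.
    by field; rewrite gt_eqF.
  by rewrite mulr_ge0 ?sqr_ge0// ltW.
have ZD : Z <= D / 2.
  rewrite /D /X /Y !mulr_sumr -big_split/= mulr_suml; apply: sum_nat_le => k kN.
  have -> : (delta * (h k * S k ^+ 2) + delta^-1 * (h k * H k ^+ 2)) / 2 =
    h k * ((delta * S k ^+ 2 + delta^-1 * H k ^+ 2) / 2) by ring.
  by rewrite ler_wpM2l ?amgm// ltW// h0.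
have srD : sigma * rho <= L * D / 2.
  apply: (le_trans (amgm _ _)); rewrite ler_pM2r// /D mulrDr lerD//.
    by rewrite [leRHS]mulrCA ler_pM2l.
  by rewrite [leRHS]mulrCA ler_pM2l ?invr_gt0.
have hmax k : (1 <= k <= N)%N -> h k <= alpha0 / (4 * (c1 + 1)).
  by move=> kN; rewrite (le_trans _ hsmall)//; exact: mesh_size_le.
set hh := alpha0 / (4 * (c1 + 1)) in hmax.
have Fbd k t : (1 <= k <= N)%N -> x k.-1 < t < x k -> `|F t| <= M * (S k + sigma).
  move=> kN kt; have /andP[kt1 kt2] := kt.
  have kt' : x k.-1 < t <= x k by rewrite kt1 ltW.
  rewrite /F /E1 /E0 !(pwE hx _ kN kt') mulrDr (le_trans (ler_normD _ _))// lerD// normrM ler_pM//.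
    by have [_ + _] := rulee k kN; apply; rewrite (ltW kt1) (ltW kt2).
  exact: eb_sigma kN kt.
(* The smallness of the mesh enters here, through the additional factor [h k] of [WE]. *)
have FWE : `|\int[mu]_(t in `[a, b]) (F t * (W t - E0 t))| <= 2 * M * hh * (X + sigma ^+ 2).
  apply: (@le_trans _ _ (\sum_(1 <= k < N.+1) h k * (M * (S k + sigma) * (2 * (h k * S k))))).
    apply: (Rint_mesh_le hx); first by apply: bdm_integrable_itv; apply: bdmM => //; exact: bdmB.
    move=> k kN t kt; have /andP[kt1 kt2] := kt.
    have kt' : x k.-1 < t <= x k by rewrite kt1 ltW.
    rewrite normrM ler_pM//; first exact: Fbd.
    by rewrite /E0 (pwE hx _ kN kt'); exact: WE.
  apply: (@le_trans _ _ (\sum_(1 <= k < N.+1) 2 * M * hh * (h k * S k ^+ 2 + sigma * (h k * S k)))).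
    apply: sum_nat_le => k kN.
    have -> : h k * (M * (S k + sigma) * (2 * (h k * S k))) =
      2 * M * h k * (h k * S k ^+ 2 + sigma * (h k * S k)) by ring.
    rewrite ler_wpM2r//; last by rewrite ler_wpM2l ?hmax// mulr_ge0.
    by rewrite addr_ge0// mulr_ge0 ?hS0 ?sqr_ge0// ltW// h0.
  by rewrite -mulr_sumr big_split/= -mulr_sumr -/X -/sigma -expr2.
pose fe t := beta t * eta1 t + gamma t * eta0 t.
have hfe : bdm fe by apply: bdmD; exact: bdmM.
have feint c : a <= c <= b -> `|\int[mu]_(t in `[a, c]) fe t| <= M * (1 + L) * rho.
  move=> /andP[ac cb].
  have hn := bdm_norm hfe.
  rewrite (le_trans (le_normr_Rintegral _ _))//; first exact: bdm_integrable_itv.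
  apply: (@le_trans _ _ (\int[mu]_(t in `[a, b]) `|fe t|)).
    rewrite (@Rint_cat _ (fun t => `|fe t|) a c b ac cb); last exact: bdm_integrable_itv.
    by rewrite lerDl Rintegral_ge0.
  rewrite (le_trans (ler_norm _))// /rho mulr_sumr.
  rewrite (eq_bigr (fun k => h k * (M * (1 + L) * H k))); last by move=> k _; ring.
  apply: (Rint_mesh_le hx); first exact: bdm_integrable_itv.
  move=> k kN t kt; have [e1 e0] := etaH k kN t kt.
  rewrite normr_id (le_trans (ler_normD _ _))// !normrM.
  have -> : M * (1 + L) * H k = M * H k + M * (L * H k) by ring.
  by rewrite lerD// ler_pM.
have JS i j : (1 <= i <= N)%N -> (1 <= j <= r)%N -> `|J i j| <= om i j * S i.
  move=> iN jr; rewrite /J normrM (ger0_norm (om0 i j iN jr)) ler_wpM2l ?om0//.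
  have /andP[g1 g2] := gb i j iN jr; have [_ + _] := rulee i iN; apply.
  by rewrite (ltW g1) (ltW g2).
have sumJ_le (q : nat -> nat -> R) (B : nat -> R) :
    (forall i j, (1 <= i <= N)%N -> (1 <= j <= r)%N -> `|q i j| <= B i) ->
    `|\sum_(1 <= i < N.+1) \sum_(1 <= j < r.+1) J i j * q i j| <= \sum_(1 <= i < N.+1) h i * (S i * B i).
  move=> qB; rewrite (le_trans (ler_norm_sum _ _ _))//; apply: sum_nat_le => i iN.
  rewrite (le_trans (ler_norm_sum _ _ _))// -(omsum i iN) mulr_suml big_nat [leRHS]big_nat.
  apply: ler_sum => j jr; rewrite normrM mulrA ler_pM//; first exact: JS.
  exact: qB.
have R1 : `|\sum_(1 <= i < N.+1) \sum_(1 <= j < r.+1) J i j * (alpha (g i j) * eta1 (g i j))| <= M * Z.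
  rewrite /Z mulr_sumr [leRHS](eq_bigr (fun k => h k * (S k * (M * H k)))); last by move=> k _; ring.
  apply: sumJ_le => i j iN jr; rewrite normrM ler_pM//.
    by apply: alphaM; rewrite in_itv/= gab.
  by have [] := etaH i iN _ (gb i j iN jr).
have R2 : `|\sum_(1 <= i < N.+1) \sum_(1 <= j < r.+1) J i j * \int[mu]_(t in `[a, g i j]) fe t| <=
    M * (1 + L) * (sigma * rho).
  have -> : M * (1 + L) * (sigma * rho) = \sum_(1 <= k < N.+1) h k * (S k * (M * (1 + L) * rho)).
    by rewrite /sigma mulrCA mulr_suml; apply: eq_bigr => k _; ring.
  by apply: sumJ_le => i j iN jr; apply: feint; exact: gab.
(* As the weights are positive, alpha may be replaced by alpha0 node by node; the last part of
   [gauss_rule] then compares the weighted squares with h S^2. *)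
have P1 : alpha0 * X <= Cg * \sum_(1 <= i < N.+1) \sum_(1 <= j < r.+1) J i j * (alpha (g i j) * (e i)^`().[g i j]).
  rewrite /X !mulr_sumr; apply: sum_nat_le => i iN.
  have [_ _ hS] := rulee i iN.
  rewrite (le_trans (ler_wpM2l (ltW alpha0_gt0) hS))// mulrCA ler_pM2l// mulr_sumr.
  rewrite big_nat [leRHS]big_nat; apply: ler_sum => j jr.
  have -> : J i j * (alpha (g i j) * (e i)^`().[g i j]) =
    alpha (g i j) * (om i j * (e i)^`().[g i j] ^+ 2) by rewrite /J; ring.
  apply: ler_wpM2r; first by apply: mulr_ge0; [exact: om0|exact: sqr_ge0].
  by apply: halpha; rewrite in_itv/= gab.
exists S; split => //.
  by move=> k kN; have [] := rulee k kN.
have := ident J Jtot.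
have split2 (p q : nat -> nat -> R) :
   \sum_(1 <= i < N.+1) \sum_(1 <= j < r.+1) J i j * (p i j - q i j) =
   \sum_(1 <= i < N.+1) \sum_(1 <= j < r.+1) J i j * p i j -
   \sum_(1 <= i < N.+1) \sum_(1 <= j < r.+1) J i j * q i j.
  rewrite -sumrB; apply: eq_bigr => i _; rewrite -sumrB; apply: eq_bigr => j _.
  exact: mulrBr.
rewrite !split2 sumF opprK => main.
have FW : \int[mu]_(t in `[a, b]) (F t * W t) = \int[mu]_(t in `[a, b]) (F t * E0 t) +
    \int[mu]_(t in `[a, b]) (F t * (W t - E0 t)).
  rewrite -RintegralD//; first by apply: eq_Rintegral => t _; ring.
    by apply: bdm_integrable_itv; exact: bdmM.
  by apply: bdm_integrable_itv; apply: bdmM => //; exact: bdmB.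
rewrite FW in main.
move: P1 R1 R2 FWE main FE0.
set p1 := \sum_(1 <= i < N.+1) _; set p2 := \sum_(1 <= i < N.+1) _.
set p3 := \sum_(1 <= i < N.+1) _; set p4 := Rintegral _ _ _; set p5 := Rintegral _ _ _.
move=> P1 R1 R2 FWE main FE0.
have {}R1 : p2 <= M * Z by exact: le_trans (ler_norm _) R1.
have {}R2 : - p3 <= M * (1 + L) * (sigma * rho).
  by rewrite (le_trans (ler_norm _))// normrN.
have {}FWE : - p4 <= 2 * M * hh * (X + sigma ^+ 2).
  by rewrite (le_trans (ler_norm _))// normrN.
(* The integral of F e is on the side where its sign is favourable, and drops out. *)
have B1 : p1 <= 2 * M * hh * (X + sigma ^+ 2) + M * Z + M * (1 + L) * (sigma * rho).
  by lra.
have hh0 : 0 <= hh by rewrite /hh divr_ge0 ?(ltW alpha0_gt0)// mulr_ge0// addr_ge0.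
have B2 : 2 * M * hh * (X + sigma ^+ 2) <= 2 * M * hh * ((1 + L) * X).
  apply: ler_wpM2l; first by apply: mulr_ge0 => //; exact: mulr_ge0.
  by rewrite mulrDl mul1r lerD2l.
have B3 : M * Z <= M * (D / 2) by rewrite ler_wpM2l.
have B4 : M * (1 + L) * (sigma * rho) <= M * (1 + L) * (L * D / 2).
  by rewrite ler_wpM2l// mulr_ge0// addr_ge0// ltW.
have B5 : alpha0 * X <= c1 * hh * X + c2 * D.
  apply: (le_trans P1); apply: (@le_trans _ _ (Cg * (2 * M * hh * ((1 + L) * X) + M * (D / 2) + M * (1 + L) * (L * D / 2)))).
    rewrite ler_pM2l//; apply: (le_trans B1); by rewrite !lerD.
  by rewrite le_eqVlt; apply/orP; left; apply/eqP; rewrite /c1 /c2; field.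
have B6 : c1 * hh <= alpha0 / 4.
  rewrite /hh mulrA ler_pdivrMr ?mulr_gt0 ?ltr_wpDl//.
  have -> : alpha0 / 4 * (4 * (c1 + 1)) = c1 * alpha0 + alpha0 by field.
  by rewrite lerDl ltW.
have B7 : c2 * delta <= alpha0 / 4.
  rewrite /delta mulrA ler_pdivrMr ?mulr_gt0 ?ltr_wpDl//.
  have -> : alpha0 / 4 * (4 * (c2 + 1)) = c2 * alpha0 + alpha0 by field.
  by rewrite lerDl ltW.
have B8 : alpha0 / 2 * X <= c2 / delta * Y.
  have := ler_wpM2r X0 B6; have := ler_wpM2r X0 B7.
  move: B5; rewrite /D mulrDr mulrA [X in _ + (_ + X)]mulrA.
  move: (c2 * delta^-1 * Y) (c2 * delta * X) (c1 * hh * X) => u1 u2 u3.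
  have -> : alpha0 / 2 * X = alpha0 * X - 2 * (alpha0 / 4 * X) by field.
  by move: (alpha0 * X) (alpha0 / 4 * X) => u4 u5; lra.
have -> : 2 * c2 / (delta * alpha0) * Y = (alpha0 / 2)^-1 * (c2 / delta * Y).
  by field; rewrite !gt_eqF.
by rewrite ler_pdivlMl// divr_gt0.
Qed.

End Stability.

(** * The scheme *)

Section Scheme.
Variable R : realType.
Local Notation mu := (@lebesgue_measure R).

(** * Summation by parts between coefficients and jumps *)

Section Abel.
Variables (N r : nat) (x G : nat -> R) (J : nat -> nat -> R).
Hypotheses (hr : (1 <= r)%N) (N1 : (1 <= N)%N).
Hypothesis Jtot : \sum_(1 <= i < N.+1) \sum_(1 <= j < r.+1) J i j = 0.

(** Partial sums of J in the lexicographic order of (i, j). The zero sum of J makes the coefficient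
    at (N, r) vanish, as the convention on jumps demands. *)
Definition coef_of_jump i j : R :=
  \sum_(1 <= i' < i) \sum_(1 <= j' < r.+1) J i' j' + \sum_(1 <= j' < j.+1) J i j'.

Let w := coef_of_jump.

Lemma coef_of_jump0 i : w i 0%N = \sum_(1 <= i' < i) \sum_(1 <= j' < r.+1) J i' j'.
Proof. by rewrite /w /coef_of_jump [X in _ + X]big_geq// addr0. Qed.

Lemma coef_of_jump_row i : (1 <= i)%N -> w i r = w i.+1 0%N.
Proof. by move=> i1; rewrite coef_of_jump0 big_nat_recr. Qed.

Lemma coef_of_jump_end : w N r = 0.
Proof. by rewrite coef_of_jump_row// coef_of_jump0. Qed.

Lemma coef_ext_of_jump i j : (1 <= i <= N)%N -> (j <= r)%N -> coef_ext N r w i j = w i j.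
Proof.
move=> /andP[i1 iN] jr; rewrite /coef_ext; case: eqP => [->|j0].
  case: eqP => [->|/eqP i1']; first by rewrite coef_of_jump0 big_geq.
  case: i i1 iN i1' => [|[|i]]// _ _ _; exact: coef_of_jump_row.
by case: ifP => // /andP[/eqP -> /eqP ->]; rewrite coef_of_jump_end.
Qed.

Lemma jump_of_jump i j : (1 <= i <= N)%N -> (1 <= j <= r)%N -> jump N r w i j = J i j.
Proof.
case: j => // j iN /andP[_ jr]; rewrite /jump !coef_ext_of_jump//=; last exact: ltnW.
rewrite /w /coef_of_jump [X in _ + X - _]big_nat_recr//=.
by move: (\sum_(1 <= i' < i) _) (\sum_(1 <= j' < j.+1) _) => s1 s2; ring.
Qed.

(** With [Psi] a primitive, this converts integrals over dual cells into integrals from a to the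
    Gauss points. The end terms vanish as the extended coefficients are 0 before the first and after
    the last Gauss point. *)
Lemma abel_dual (Psi : R -> R) : let g := gauss_pt x r G in
  \sum_(1 <= i < N.+1) \sum_(1 <= j < (ndof N r i).+1)
     w i j * (Psi (g i j.+1) - Psi (g i j)) =
  - \sum_(1 <= i < N.+1) \sum_(1 <= j < r.+1) J i j * Psi (g i j).
Proof.
move=> g; apply/eqP; rewrite -addr_eq0 -big_split/=.
pose T i := w i.+1 0%N * Psi (g i.+1 1%N).
rewrite (eq_big_nat _ _ (F2 := fun i => T i - T i.-1)).
  rewrite mesh_sum /T -coef_of_jump_row// coef_of_jump_end mul0r.
  by rewrite coef_of_jump0 big_geq// mul0r subrr.
move=> i iN; have iN' : (1 <= i <= N)%N by [].
(* In the last element [ndof] stops at r - 1; the term j = r may be added because its coefficient is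
   0. *)
have -> : \sum_(1 <= j < (ndof N r i).+1) w i j * (Psi (g i j.+1) - Psi (g i j)) =
    \sum_(1 <= j < r.+1) w i j * (Psi (g i j.+1) - Psi (g i j)).
  rewrite /ndof; case: eqP => [->|//]; rewrite prednK// [RHS]big_nat_recr//=.
  by rewrite coef_of_jump_end mul0r addr0.
rewrite -big_split/=; pose f j := w i j * Psi (g i j.+1).
rewrite (eq_big_nat _ _ (F2 := fun j => f j - f j.-1)).
  rewrite mesh_sum /f /T coef_of_jump_row//; last by case/andP: iN'.
  have -> : g i r.+1 = g i.+1 1%N.
    by rewrite /g /gauss_pt eqxx eqSS ltn_eqF.
  by case: i {f} iN iN' => // i _ _.
move=> j; case: j => // j /andP[_ jr]; rewrite /f/= -jump_of_jump// /jump.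
rewrite !coef_ext_of_jump//=; last exact: ltnW.
by ring.
Qed.

End Abel.

Lemma gauss_pt_node (x G : nat -> R) r i j : (1 <= j <= r)%N -> gauss_pt x r G i j = node G (x i.-1) (x i) j.
Proof. by move=> /andP[_ jr]; rewrite /gauss_pt ltn_eqF. Qed.

(** Tested with [coef_of_jump], the scheme says that the flux balance of uP, taken from a to the
    Gauss points, is orthogonal to all families of zero sum. In this form it can be compared with
    the exact solution, whose flux balance is constant. *)
Lemma fv_weak r G a b alpha beta gamma f N x uP : (1 <= r)%N -> gauss_nodes r G ->
  is_mesh a b N x -> (1 <= N)%N ->
  fv_solution a b alpha beta gamma f N x r G uP ->
  mu.-integrable `[a, b] (EFin \o f) ->
  mu.-integrable `[a, b] (EFin \o (fun t => beta t * derive1 uP t + gamma t * uP t)) ->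
  forall J : nat -> nat -> R,
  \sum_(1 <= i < N.+1) \sum_(1 <= j < r.+1) J i j = 0 ->
  \sum_(1 <= i < N.+1) \sum_(1 <= j < r.+1) J i j *
    (alpha (node G (x i.-1) (x i) j) * derive1 uP (node G (x i.-1) (x i) j)
     - \int[mu]_(t in `[a, node G (x i.-1) (x i) j]) (beta t * derive1 uP t + gamma t * uP t)) =
  - \sum_(1 <= i < N.+1) \sum_(1 <= j < r.+1) J i j *
     \int[mu]_(t in `[a, node G (x i.-1) (x i) j]) f t.
Proof.
move=> hr hG hx N1 [_ sol] if_ iF J Jtot; have [x0 xN xinc] := hx.
pose w := coef_of_jump r J; pose g := gauss_pt x r G.
have gE i j : (1 <= j <= r)%N -> g i j = node G (x i.-1) (x i) j by exact: gauss_pt_node.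
have gb i j : (1 <= i <= N)%N -> (1 <= j <= r)%N -> x i.-1 < g i j < x i.
  by move=> iN jr; rewrite gE//; exact: (node_bounds hG (xinc _ iN) jr).
(* The cell j = r straddles a mesh point: it reaches from the last node of an element to the first
   node of the next, and exists only for i < N. *)
have gcell i j : (1 <= i <= N)%N -> (1 <= j <= ndof N r i)%N ->
    [/\ a <= g i j, g i j <= g i j.+1 & g i j.+1 <= b].
  move=> iN /andP[j1 jn]; have /andP[i1 iN'] := iN.
  have jr : (1 <= j <= r)%N by rewrite j1 (leq_trans jn)// /ndof; case: eqP => _ //; exact: leq_pred.
  have /andP[g1 g2] := gb i j iN jr.
  have ag : a <= g i j.
    by rewrite -x0 (le_trans _ (ltW g1))// (mesh_mono hx)// (leq_trans (leq_pred _)).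
  case: (eqVneq j r) => [E|jr'].
    have iltN : (i < N)%N.
      rewrite ltn_neqAle iN' andbT; apply: contraPneq jn => ->; rewrite E /ndof eqxx.
      by apply/negP; rewrite -ltnNge prednK.
    have Eg : g i j.+1 = g i.+1 1%N by rewrite /g /gauss_pt E eqxx eqSS ltn_eqF.
    have /andP[g3 g4] := gb i.+1 1%N iltN hr.
    split => //; rewrite Eg; first exact: le_trans (ltW g2) (ltW g3).
    by rewrite (le_trans (ltW g4))// -xN (mesh_mono hx).
  have jr2 : (1 <= j.+1 <= r)%N by rewrite /= ltn_neqAle jr'; case/andP: jr.
  have /andP[g3 g4] := gb i j.+1 iN jr2.
  split => //; last by rewrite (le_trans (ltW g4))// -xN (mesh_mono hx).
  rewrite !gE// /node ler_pM2r ?invr_gt0// lerD2l ler_pM2l ?subr_gt0 ?xinc//.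
  by apply/ltW/(gauss_nodes_lt hG) => //; case/andP: jr2.
have icell F i j : mu.-integrable `[a, b] (EFin \o F) -> (1 <= i <= N)%N -> (1 <= j <= ndof N r i)%N ->
    \int[mu]_(t in `[g i j, g i j.+1]) F t =
    \int[mu]_(t in `[a, g i j.+1]) F t - \int[mu]_(t in `[a, g i j]) F t.
  move=> iF' iN jn; have [ag gg gb'] := gcell i j iN jn.
  rewrite [X in _ = X - _](Rint_cat ag gg); first by rewrite [RHS]addrAC subrr add0r.
  by apply: integrableS iF' => //; apply: subset_itvl; rewrite bnd_simp.
have dual F : mu.-integrable `[a, b] (EFin \o F) ->
    \sum_(1 <= i < N.+1) \sum_(1 <= j < (ndof N r i).+1) w i j * \int[mu]_(t in `[g i j, g i j.+1]) F t =
    - \sum_(1 <= i < N.+1) \sum_(1 <= j < r.+1) J i j * \int[mu]_(t in `[a, g i j]) F t.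
  move=> iF'; have := @abel_dual N r x G J hr N1 Jtot (fun t => \int[mu]_(s in `[a, t]) F s).
  move=> /= <-; apply: eq_big_nat => i iN; apply: eq_big_nat => j jn.
  by rewrite icell.
have := sol w; rewrite /fv_form (dual _ iF).
have -> : \int[mu]_(t in `[a, b]) (f t * test_fun N x r G w t) =
    \sum_(1 <= i < N.+1) \sum_(1 <= j < (ndof N r i).+1) w i j * \int[mu]_(t in `[g i j, g i j.+1]) f t.
  have iJ i j : mu.-integrable `[a, b] (EFin \o (fun t => w i j * (\1_(`[g i j, g i j.+1]%classic) t * f t))).
    apply: bdm_integrableM => //; first exact: bdm_cst.
    by apply: bdm_integrableM => //; exact: bdm_indic.
  transitivity (\int[mu]_(t in `[a, b]) \sum_(1 <= i < N.+1) \sum_(1 <= j < (ndof N r i).+1)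
      w i j * (\1_(`[g i j, g i j.+1]%classic) t * f t)).
    apply: eq_Rintegral => t _; rewrite /test_fun mulr_sumr; apply: eq_bigr => i _.
    by rewrite mulr_sumr; apply: eq_bigr => j _; rewrite -/g; ring.
  rewrite (Rint_sum _ _ _).2//; last by move=> i; exact: (Rint_sum _ _ (iJ i)).1.
  apply: eq_big_nat => i iN; rewrite (Rint_sum _ _ (iJ i)).2//; apply: eq_big_nat => j jn.
  rewrite RintegralZl//; last by apply: bdm_integrableM => //; exact: bdm_indic.
  have [ag gg gb'] := gcell i j iN jn; congr (_ * _).
  rewrite (@Rint_support _ `[a, b]%classic `[g i j, g i j.+1]%classic).
  - by apply: eq_Rintegral => t tg; rewrite indicE tg mul1r.
  - by move=> t /=; rewrite !in_itv/= => /andP[t1 t2]; rewrite (le_trans ag t1) (le_trans t2 gb').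
  - by move=> t _ tg; rewrite indicE memNset// mul0r.
rewrite (dual _ if_) => H.
have E (F : R -> R) : \sum_(1 <= i < N.+1) \sum_(1 <= j < r.+1) J i j * F (node G (x i.-1) (x i) j) =
   \sum_(1 <= i < N.+1) \sum_(1 <= j < r.+1) J i j * F (g i j).
  by apply: eq_big_nat => i iN; apply: eq_big_nat => j jr; rewrite gE.
rewrite (E (fun c => alpha c * derive1 uP c - \int[mu]_(t in `[a, c]) (beta t * derive1 uP t + gamma t * uP t))).
rewrite (E (fun c => \int[mu]_(t in `[a, c]) f t)) -H -sumrB.
apply: eq_big_nat => i iN; rewrite -sumrB; apply: eq_big_nat => j jr.
by rewrite jump_of_jump// mulrBr.
Qed.

End Scheme.

(** * Continuity of the flux and bounded representatives of the coefficients *)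

Section ExactSolution.
Variable R : realType.
Local Notation mu := (@lebesgue_measure R).

(** Absolute continuity with a single interval is uniform continuity on [c, d]. *)
Lemma absolutely_continuous_within (c d : R) v : c < d -> absolutely_continuous c d v ->
  {within `[c, d], continuous v}.
Proof.
move=> cd ac.
have uc (e : R) : 0 < e -> exists2 delta : R, 0 < delta & forall s t, s \in `[c, d] -> t \in `[c, d] ->
    `|s - t| < delta -> `|v s - v t| < e.
  move=> e0; have [delta d0 H] := ac e e0; exists delta => // s t.
  wlog st : s t / s <= t.
    move=> W; have [st|/ltW ts] := leP s t; first exact: W.
    by move=> sc tc; rewrite distrC => st; rewrite distrC; exact: W.
  rewrite !in_itv/= => /andP[cs sd] /andP[ct td]; rewrite distrC ger0_norm ?subr_ge0// => std.
  have := H 1%N (fun=> s) (fun=> t); rewrite !big_ord1 distrC; apply => //.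
  move=> i j; rewrite /= => i1 j1 _.
  by move: i1 j1; rewrite /mkset !ltnS !leqn0 => /eqP -> /eqP ->.
have nearv z : z \in `[c, d] -> forall e, 0 < e ->
    \forall y \near z, y \in `[c, d] -> `|v z - v y| < e.
  move=> zcd e e0; have [delta d0 H] := uc e e0; apply/nbhs_ballP.
  by exists delta => //= y zy ycd; exact: H.
apply/(continuous_within_itvP _ cd); split.
- move=> z zcd; apply/cvgrPdist_lt => e e0; near=> y.
  have ycd : y \in `[c, d].
    by apply: subset_itv_oo_cc; near: y; exact: near_in_itvoo.
  move: ycd; near: y; apply: nearv => //; exact: subset_itv_oo_cc.
- apply/cvgrPdist_lt => e e0; near=> y.
  have ycd : y \in `[c, d].
    by rewrite in_itv/=; apply/andP; split; near: y; [exact: nbhs_right_ge|exact: nbhs_right_le].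
  move: ycd; near: y; rewrite near_withinE; have ccd : c \in `[c, d] by rewrite in_itv/= lexx ltW.
  by apply: filterS (nearv c ccd e e0) => y H _; exact: H.
- apply/cvgrPdist_lt => e e0; near=> y.
  have ycd : y \in `[c, d].
    by rewrite in_itv/=; apply/andP; split; near: y; [exact: nbhs_left_ge|exact: nbhs_left_le].
  move: ycd; near: y; rewrite near_withinE; have dcd : d \in `[c, d] by rewrite in_itv/= lexx andbT ltW.
  by apply: filterS (nearv d dcd e e0) => y H _; exact: H.
Unshelve. all: by end_near. Qed.

(** The function is set to 0 where its modulus exceeds a number M that bounds it almost
    everywhere. *)
Lemma in_Linfty_truncate D (F : R -> R) : measurable D -> in_Lp +oo%E D F ->
  exists F' : R -> R, bdm F' /\ {ae mu, forall t, D t -> F t = F' t}.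
Proof.
move=> mD [mF]; rewrite /Lnorm_on unlock /=.
have -> : (0%R < mu [set: R])%E.
  apply: (@lt_le_trans _ _ (mu `]0%R, 1%R[)); first by rewrite lebesgue_measure_itv/= lte_fin ltr01 sube0.
  by apply: le_measure; rewrite ?inE//; exact: measurable_itv.
set s := ess_sup_inf.ess_sup _ _ => soo.
have [M HM] : exists M : R, {ae mu, forall t, (`|(F \_ D) t|%:E <= M%:E)%E}.
  have := soo; rewrite /s ess_sup_inf.ess_supEae => /ereal_inf_lt[y ay yoo].
  case: y ay yoo => [M ay _||ay _] //.
    by exists M; exact: ay.
  exists 0; apply: (@filterS _ _ (ae_filter_ringOfSetsType mu) _ _ _ ay) => t.
  by rewrite leeNy_eq.
pose K := D `&` [set t | `|F t| <= M].
have mK : measurable K.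
  have -> : K = D `&` (fun t => `|F t|) @^-1` `]-oo, M].
    by apply/seteqP; split => t [Dt Ft]; split => //; move: Ft; rewrite /= in_itv.
  by apply: (measurableT_comp (@normr_measurable R setT) mF) => //; exact: measurable_itv.
exists (F \_ K); split.
  apply: (@bdm_patch _ _ _ M) => //.
    by apply: measurable_funS mF => // t [].
  by move=> t [].
apply: (@filterS _ _ (ae_filter_ringOfSetsType mu) _ _ _ HM) => t + Dt.
rewrite lee_fin !patchE mem_set// => FM; rewrite mem_set//.
Qed.

End ExactSolution.

(** * Regularity *)

Section Regularity.
Variable R : realType.
Local Notation mu := (@lebesgue_measure R).

Lemma derivable_shift_near (Phi v : R -> R) (k t l : R) : derivable Phi t 1 ->
  Phi^`()%classic t = l -> (\forall y \near t, k + Phi y = v y) -> is_derive t (1 : R) v l.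
Proof.
move=> dPhi Phil nearv; apply: (near_eq_is_derive nearv).
have dP : is_derive t (1 : R) Phi l by apply: DeriveDef => //; rewrite -derive1E.
have := is_deriveD (is_derive_cst k t (1 : R)) dP; rewrite add0r; exact.
Qed.

(** The fundamental theorem of calculus at a Lebesgue point of g, with a base point s to the left of
    t. *)
Lemma primitive_is_derive (c d : R) (v g : R -> R) (t : R) :
  (forall s e, c < s -> s < e -> e < d -> v e - v s = \int[mu]_(y in `[s, e]) g y) ->
  locally_integrable `]c, d[ g -> t \in `]c, d[ -> lebesgue_pt g t ->
  is_derive t (1 : R) v (g t).
Proof.
move=> vg lg; rewrite in_itv/= => /andP[ct td] gt.
have [s cs st] : exists2 s, c < s & s < t by exists ((c + t) / 2); lra.
have [e te ed] : exists2 e, t < e & e < d by exists ((t + d) / 2); lra.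
have ig : mu.-integrable `[s, e] (EFin \o g) by exact: (locally_integrable_itv lg).
have st' : (BLeft s < BRight t)%E by rewrite lte_fin.
have [dF FE] := @FTC1_lebesgue_pt R g (BLeft s) t e te ig st' gt.
have nearE : \forall y \near t, v s + (\int[mu]_(z in `[s, y]) g z)%R = v y.
  near=> y.
  have sy : s < y by near: y; exact: lt_nbhsr.
  have ye : y < e by near: y; exact: lt_nbhsl.
  by rewrite -(vg s y cs sy (lt_trans ye ed)) addrC subrK.
exact: derivable_shift_near dF FE nearE.
Unshelve. all: by end_near. Qed.

Lemma within_in_continuous (c d : R) (v : R -> R) : c < d -> {within `[c, d], continuous v} ->
  {in `]c, d[, continuous v}.
Proof. by move=> cd /(continuous_within_itvP _ cd)[]. Qed.

(** All points are Lebesgue points of a continuous function, so the increment formula has no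
    exceptional set. *)
Lemma weak_derivative_increment c d (v g : R -> R) s e : {in `]c, d[, continuous v} ->
  is_weak_derivative c d 1 v g -> c < s -> s < e -> e < d ->
  v e - v s = \int[mu]_(y in `[s, e]) g y.
Proof.
move=> cv wd cs se ed; have [[mv _ _] _ _] := wd.
by apply: (is_weak_derivative_lebesgue_pt wd) => //; apply: (in_continuous_lebesgue_pt mv cv);
   rewrite in_itv/=; apply/andP; split => //; [exact: lt_trans ed|exact: lt_trans se].
Qed.

(** In the increment formula g may be replaced by the continuous w, for which every point is a
    Lebesgue point; v is then differentiable in the classical sense. *)
Lemma weak_derivative_is_derive c d (v g w : R -> R) : {in `]c, d[, continuous v} ->
  is_weak_derivative c d 1 v g -> {in `]c, d[, continuous w} -> measurable_fun `]c, d[ w ->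
  {ae mu, forall t, t \in `]c, d[ -> g t = w t} ->
  {in `]c, d[, forall t, is_derive t (1 : R) v (w t)}.
Proof.
move=> cv wd cw mw gw t tcd.
have [lv [mg og fg] _] := wd.
have gwS (s e : R) : c < s -> e < d -> {ae mu, forall y, y \in `[s, e] -> g y = w y}.
  move=> cs ed; apply: (@filterS _ _ (ae_filter_ringOfSetsType mu) _ _ _ gw) => y gy.
  rewrite in_itv/= => /andP[sy ye]; apply: gy.
  by rewrite in_itv/= (lt_le_trans cs sy) (le_lt_trans ye ed).
have sub (s e : R) : c < s -> e < d -> `[s, e]%classic `<=` `]c, d[%classic.
  move=> cs ed y /=; rewrite !in_itv/= => /andP[sy ye].
  by rewrite (lt_le_trans cs sy) (le_lt_trans ye ed).
apply: (@primitive_is_derive c d) => //.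
- move=> s e cs se ed; rewrite (weak_derivative_increment cv wd)//.
  apply: Rint_ae => //; [by apply: measurable_funS mg => //; exact: sub|by apply: measurable_funS mw => //; exact: sub|].
  by apply: gwS.
- split => // K Kcd cK; apply: le_lt_trans (fg K Kcd cK).
  rewrite le_eqVlt; apply/orP; left; apply/eqP; have mK : measurable K by exact: compact_measurable.
  apply: (@ae_eq_integral _ _ _ mu K) => //.
  - by apply/measurable_EFinP; apply: measurableT_comp => //; exact: measurable_funS mw.
  - by apply/measurable_EFinP; apply: measurableT_comp => //; exact: measurable_funS mg.
  - by apply: (@filterS _ _ (ae_filter_ringOfSetsType mu) _ _ _ gw) => y gy Ky; rewrite gy//; exact: Kcd.
- exact: (in_continuous_lebesgue_pt mw).
Qed.

Lemma weak_derivative_ae c d (v g w : R -> R) : is_weak_derivative c d 1 v g ->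
  {ae mu, forall t, t \in `]c, d[ -> v t = w t} -> locally_integrable `]c, d[ w ->
  is_weak_derivative c d 1 w g.
Proof.
move=> [lv lg H] vw lw; split => // phi tphi; rewrite -(H _ tphi).
have [phi' _ _] := tphi.
have mphi : measurable_fun `]c, d[ (derive1n 1 phi).
  apply: measurable_funS (continuous_measurable_fun _) => // t.
  by apply: differentiable_continuous; apply/derivable1_diffP; exact: (phi' 1%N).
apply: Rint_ae => //.
- by apply: measurable_funM => //; case: lw.
- by apply: measurable_funM => //; case: lv.
- by apply: (@filterS _ _ (ae_filter_ringOfSetsType mu) _ _ _ vw) => t + tcd => ->.
Qed.

Lemma bdm_locally_integrable c d (w : R -> R) : bdm w -> locally_integrable `]c, d[ w.
Proof.
move=> bw; split; [by apply: measurable_funTS; case: bw|exact: interval_open|move=> K _ cK].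
have : mu.-integrable K (EFin \o w).
  by apply: bdm_integrable => //; [exact: compact_measurable|exact: compact_finite_measure].
by move=> /integrableP[].
Qed.

Lemma Lnorm_on_sqr (A : set R) v : measurable A ->
  (Lnorm_on 2%:E A v ^+ 2 = \int[mu]_(t in A) (v t ^+ 2)%:E)%E.
Proof.
move=> mA; have E : (Lnorm_on 2%:E A v ^+ 2 = Lnorm_on 2%:E A v `^ 2)%E.
  have : (0 <= Lnorm_on 2%:E A v)%E by exact: Lnorm_ge0.
  case: (Lnorm_on _ _ _) => [y y0||//]; last by rewrite poweRyr ?pnatr_eq0.
  by rewrite poweR_EFin powR_mulrn// EFin_expe.
rewrite {}E /Lnorm_on poweR_Lnorm ?pnatr_eq0//.
rewrite [RHS]integral_mkcond; apply: eq_integral => t _.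
rewrite /= !patchE; case: ifP => _; rewrite ?normr0 ?powR0//.
by rewrite powR_mulrn// real_normK// num_real.
Qed.

Lemma sqr_integrable (c d : R) (v : R -> R) : measurable_fun `]c, d[ v ->
  (Lnorm_on 2%:E `]c, d[ v < +oo)%E ->
  mu.-integrable `]c, d[ (EFin \o (fun t => v t ^+ 2)) /\ mu.-integrable `]c, d[ (EFin \o v).
Proof.
move=> mv voo; have mv2 : measurable_fun `]c, d[ (fun t => v t ^+ 2).
  by apply: measurable_funX.
have i2 : mu.-integrable `]c, d[ (EFin \o (fun t => v t ^+ 2)).
  apply/integrableP; split; first exact/measurable_EFinP.
  under eq_integral do rewrite /= ger0_norm ?sqr_ge0//.
  by rewrite -Lnorm_on_sqr// lte_mul_pinfty// ?Lnorm_ge0// ge0_fin_numE ?Lnorm_ge0.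
split => //.
have i1 : mu.-integrable `]c, d[ (EFin \o (fun t => 1 + v t ^+ 2)).
  have := integrableD _ (bdm_integrable _ _ (bdm_cst 1)) i2.
  by apply => //; rewrite lebesgue_measure_itv/=; case: ifP => _; rewrite ?ltry// -EFinB ltry.
apply: le_integrable i1 => //; first exact/measurable_EFinP.
move=> t _ /=; rewrite lee_fin [X in _ <= X]ger0_norm ?addr_ge0 ?sqr_ge0//.
have : 0 <= (`|v t| - 2^-1) ^+ 2 by exact: sqr_ge0.
rewrite -[v t ^+ 2]real_normK ?num_real//; lra.
Qed.

(* The integral of [(|v| - m)^2] is nonnegative, with [m] the mean of [|v|]. *)
Lemma cauchy_schwarz_itv (c d : R) (v : R -> R) : c < d -> measurable_fun `]c, d[ v ->
  (Lnorm_on 2%:E `]c, d[ v < +oo)%E ->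
  (\int[mu]_(t in `]c, d[) `|v t|) ^+ 2 <= (d - c) * \int[mu]_(t in `]c, d[) v t ^+ 2.
Proof.
move=> cd mv voo; have [i2 i1] := sqr_integrable mv voo.
have i1' : mu.-integrable `]c, d[ (EFin \o (fun t => `|v t|)).
  exact: integrable_norm i1.
set K := Rintegral _ _ _; pose m := K / (d - c).
have dc0 : 0 < d - c by rewrite subr_gt0.
have icst (k : R) : mu.-integrable `]c, d[ (EFin \o (fun=> k)).
  apply: bdm_integrable (bdm_cst k) => //.
  by rewrite lebesgue_measure_itv/=; case: ifP => _; rewrite ?ltry// -EFinB ltry.
have i1m : mu.-integrable `]c, d[ (EFin \o (fun t => 2 * m * `|v t|)).
  exact: (integrableZl _ (2 * m) i1').
have : 0 <= \int[mu]_(t in `]c, d[) (`|v t| - m) ^+ 2.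
  by apply: Rintegral_ge0 => t _; exact: sqr_ge0.
have -> : \int[mu]_(t in `]c, d[) (`|v t| - m) ^+ 2 =
    \int[mu]_(t in `]c, d[) (v t ^+ 2 - 2 * m * `|v t| + m ^+ 2).
  apply: eq_Rintegral => t _; rewrite -[v t ^+ 2]real_normK ?num_real//; ring.
rewrite RintegralD//; last exact: (integrableB _ i2 i1m).
rewrite RintegralB// RintegralZl// Rintegral_cst// -/K.
rewrite /= lebesgue_measure_itv/= lte_fin cd -EFinB/= /m => H.
rewrite -ler_pdivrMl// -subr_ge0; apply: le_trans H _.
by rewrite le_eqVlt; apply/orP; left; apply/eqP; field; rewrite gt_eqF.
Qed.

End Regularity.

(** * Interpolation of a Sobolev function on one element *)

Section Element.
Variable R : realType.
Local Notation mu := (@lebesgue_measure R).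

Lemma sobolev_weak_derivative c d m j (u : R -> R) : sobolev c d m u -> (j <= m)%N ->
  is_weak_derivative c d j u (weak_derivative c d j u).
Proof. by move=> su jm; have [g wg _] := su j jm; exact: (xgetPex _ (ex_intro _ g wg)). Qed.

(** The weak derivatives of orders 1 to r have continuous representatives [F j], which are classical
    derivatives of one another and feed [element_approx]. The oscillation of [F r] is at most the L1
    norm of the next derivative, which Cauchy-Schwarz compares with its L2 norm at the cost of the
    length of the element. *)
Lemma sobolev_element_approx (r : nat) (c d : R) (u du : R -> R) : (1 <= r)%N -> c < d ->
  {within `[c, d], continuous u} ->
  {in `]c, d[, forall t, is_derive t (1 : R) u (du t)} ->
  sobolev c d r.+1 u ->
  (Lnorm_on 2%:E `]c, d[ (weak_derivative c d r.+1 u) < +oo)%E ->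
  exists p : {poly R}, exists K : R,
    [/\ (size p <= r.+1)%N, p.[c] = u c, p.[d] = u d &
     [/\ 0 <= K,
         K ^+ 2 <= (d - c) * \int[mu]_(t in `]c, d[) weak_derivative c d r.+1 u t ^+ 2 &
         {in `]c, d[, forall t, `|du t - p^`().[t]| <= 2 * K * (d - c) ^+ r.-1}]].
Proof.
move=> r1 cd cu du_u su Doo; set D := weak_derivative c d r.+1 u.
have wD : is_weak_derivative c d r.+1 u D by exact: sobolev_weak_derivative su _.
have [g Hg] : exists g : nat -> R -> R, forall j, (j <= r)%N ->
    is_weak_derivative c d j u (g j) /\ in_Lp 2%:E `]c, d[ (g j).
  have /choice[g Hg] : forall j, exists g : R -> R, (j <= r)%N ->
      is_weak_derivative c d j u g /\ in_Lp 2%:E `]c, d[ g.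
    move=> j; have [jr|rj] := leqP j r; last by exists u.
    by have [g wg Lg] := su j (leqW jr); exists g.
  by exists g.
(* At order r + 1 the representative must be [D] itself, since the seminorm is defined through that
   choice. *)
pose f j : R -> R := if (j <= r)%N then g j else D.
have wf j : (j <= r.+1)%N -> is_weak_derivative c d j u (f j).
  by rewrite leq_eqVlt /f => /predU1P[->|jr]; [rewrite ltnn|rewrite -ltnS jr; exact: (Hg j jr).1].
have mf j : (j <= r.+1)%N -> measurable_fun `]c, d[ (f j).
  by move=> /wf[_ [mg _ _]].
have iff j : (j <= r.+1)%N -> mu.-integrable `]c, d[ (EFin \o f j).
  move=> jr; apply: (sqr_integrable (mf j jr) _).2.
  move: jr; rewrite leq_eqVlt /f => /predU1P[->|jr]; first by rewrite ltnn.
  by rewrite -ltnS jr; exact: (Hg j jr).2.2.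
have wfS j : (j <= r)%N -> is_weak_derivative c d 1 (f j) (f j.+1).
  by move=> jr; exact: is_weak_derivativeS (wf j (leqW jr)) (wf j.+1 jr).
have /choice[k Hk] : forall j, exists k : R, (j <= r)%N -> forall t, t \in `]c, d[ ->
    lebesgue_pt (f j) t -> f j t = k + \int[mu]_(x in `[c, t]) f j.+1 x.
  move=> j; have [jr|rj] := leqP j r; last by exists 0.
  by have [k Hk] := weak_derivative_primitive cd (wfS j jr) (iff j.+1 jr); exists k.
(* The continuous representative of [f j]. *)
pose F j (t : R) : R := k j + \int[mu]_(x in `[c, t]) f j.+1 x.
have icc j : (j <= r.+1)%N -> mu.-integrable `[c, d] (EFin \o f j).
  by move=> /iff /integrable_oo_cc.
have fF j : (j <= r)%N -> {ae mu, forall t, t \in `]c, d[ -> f j t = F j t}.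
  move=> jr; have [lfj _ _] := wfS j jr; have H := ae_lebesgue_pt lfj.
  by apply: (@filterS _ _ (ae_filter_ringOfSetsType mu) _ _ _ H) => t + tcd => /(_ tcd) /(Hk j jr t tcd).
have cF j : (j <= r)%N -> {within `[c, d], continuous (F j)}.
  move=> jr; have := parameterized_integral_continuous (ltW cd) (icc j.+1 jr).
  by move=> H x; exact: (cvgD (cvg_cst _) (H x)).
have cFin j : (j <= r)%N -> {in `]c, d[, continuous (F j)}.
  by move=> jr; exact: within_in_continuous cd (cF j jr).
have mF j : (j <= r)%N -> measurable_fun `]c, d[ (F j).
  move=> jr; apply: (@measurable_funS _ _ _ _ `[c, d]%classic) => //.
    exact: subset_itv_oo_cc.
  by apply: subspace_continuous_measurable_fun => //; exact: cF.
have incF j s e : (j <= r)%N -> c < s -> s < e -> e < d ->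
    F j e - F j s = \int[mu]_(y in `[s, e]) f j.+1 y.
  move=> jr cs se ed; rewrite /F (@Rint_cat _ _ c s e) ?(ltW cs) ?(ltW se)//; first by ring.
  by apply: integrableS (icc j.+1 jr) => //; apply: subset_itvl; rewrite bnd_simp ltW.
have wF j : (1 <= j < r)%N -> is_weak_derivative c d 1 (F j) (f j.+1).
  move=> /andP[_ jr]; apply: weak_derivative_ae (wfS j (ltnW jr)) (fF j (ltnW jr)) _.
  split; [exact: mF (ltnW jr)|exact: interval_open|move=> K Kcd cK].
  have iK : mu.-integrable K (EFin \o F j).
    have icF : mu.-integrable `[c, d] (EFin \o F j).
      by apply: continuous_compact_integrable; [exact: segment_compact|exact: cF (ltnW jr)].
    apply: integrableS icF => //; first exact: compact_measurable.
    by apply: subset_trans Kcd _; exact: subset_itv_oo_cc.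
  by have /integrableP[_ +] := iK.
have dF j : (1 <= j < r)%N -> {in `]c, d[, forall t, is_derive t (1 : R) (F j) (F j.+1 t)}.
  move=> /andP[j1 jr]; apply: (weak_derivative_is_derive _ (wF j _) _ _ (fF j.+1 jr)).
  - exact: cFin (ltnW jr).
  - by rewrite j1.
  - exact: cFin jr.
  - exact: mF jr.
have du1 : {in `]c, d[, forall t, is_derive t (1 : R) u (F 1%N t)}.
  apply: (weak_derivative_is_derive _ (wf 1%N _) _ _ (fF 1%N r1)) => //.
  - exact: within_in_continuous cd cu.
  - exact: cFin r1.
  - exact: mF r1.
pose K := \int[mu]_(t in `]c, d[) `|D t|.
have fD : f r.+1 = D by rewrite /f ltnn.
have iD : mu.-integrable `]c, d[ (EFin \o D) by rewrite -fD; exact: iff.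
have iDn : mu.-integrable `]c, d[ (EFin \o (fun t => `|D t|)) by exact: integrable_norm iD.
have K0 : 0 <= K by apply: Rintegral_ge0.
have FK : {in `]c, d[ &, forall s t, `|F r t - F r s| <= K}.
  have W s t : c < s -> s <= t -> t < d -> `|F r t - F r s| <= K.
    move=> cs st td; move: st; rewrite le_eqVlt => /predU1P[->|st].
      by rewrite subrr normr0.
    have sub : `[s, t]%classic `<=` `]c, d[%classic.
      by move=> y /=; rewrite !in_itv/= => /andP[sy yt]; rewrite (lt_le_trans cs sy) (le_lt_trans yt td).
    rewrite incF// fD; apply: (@le_trans _ _ (\int[mu]_(y in `[s, t]) `|D y|)).
      by apply: le_normr_Rintegral => //; exact: integrableS iD.
    have iDs : mu.-integrable `[s, t] (EFin \o (fun y => `|D y|)) by apply: integrableS iDn.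
    rewrite /K /Rintegral; apply: fine_le; [exact: integrable_fin_num iDs|exact: integrable_fin_num iDn|].
    by apply: ge0_subset_integral => //; exact: measurable_int iDn.
  move=> s t; rewrite !in_itv/= => /andP[cs sd] /andP[ct td].
  have [st|/ltW ts] := leP s t; first exact: W.
  by rewrite distrC; exact: W.
have [p [sp pc pd Hp]] := element_approx cd r1 cu du1 dF FK.
exists p, K; split => //; split => //.
- by apply: cauchy_schwarz_itv => //; rewrite -fD; exact: mf.
- move=> t tcd; have -> : du t = F 1%N t; last exact: Hp.
  have [_ <-] := du_u t tcd; have [_ <-] := du1 t tcd; by [].
Qed.

End Element.

(** * The exact solution *)

Section ExactSolution.
Variable R : realType.
Local Notation mu := (@lebesgue_measure R).

Lemma within_continuous_bounded (c d : R) (v : R -> R) : c <= d ->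
  {within `[c, d], continuous v} -> exists M, forall t, t \in `[c, d] -> `|v t| <= M.
Proof.
move=> cd cv; have [p _ Hp] := EVT_max cd cv; have [q _ Hq] := EVT_min cd cv.
exists (Num.max `|v p| `|v q|) => t tcd; rewrite le_max !ler_norml.
have := Hp t tcd; have := Hq t tcd; have := ler_norm (v p); have := ler_norm (- v q).
rewrite normrN => H1 H2 H3 H4; have [v0|v0] := leP 0 (v t); apply/orP; [left|right]; apply/andP; split; lra.
Qed.

Lemma within_continuous_bdm (c d : R) (v : R -> R) : c <= d ->
  {within `[c, d], continuous v} -> bdm (v \_ `[c, d]).
Proof.
move=> cd cv; have [M HM] := within_continuous_bounded cd cv.
apply: (@bdm_patch _ _ _ M) => //; first exact: subspace_continuous_measurable_fun.
Qed.

Lemma within_continuous_div (c d : R) (v w : R -> R) : c < d ->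
  {within `[c, d], continuous v} -> {within `[c, d], continuous w} ->
  (forall t, t \in `[c, d] -> w t != 0) -> {within `[c, d], continuous (fun t => v t / w t)}.
Proof.
move=> cd /(continuous_within_itvP _ cd)[v1 v2 v3] /(continuous_within_itvP _ cd)[w1 w2 w3] w0.
apply/(continuous_within_itvP _ cd); split.
- move=> t tcd; apply: cvgM; [exact: v1|apply: cvgV; [|exact: w1]].
  by apply: w0; exact: subset_itv_oo_cc.
- by apply: cvgM => //; apply: cvgV => //; apply: w0; rewrite in_itv/= lexx ltW.
- by apply: cvgM => //; apply: cvgV => //; apply: w0; rewrite in_itv/= lexx ltW.
Qed.

(** The continuous q divided by alpha represents u', so u is differentiable in ]a, b[ with bounded
    derivative. The equation gives the weak derivative of q, and integrating it leaves a flux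
    balance that is constant on ]a, b[. *)
Lemma exact_solution (a b : R) (alpha beta gamma beta' gamma' f u : R -> R) (alpha0 : R) :
  a < b -> {within `[a, b], continuous alpha} -> 0 < alpha0 ->
  (forall t, t \in `[a, b] -> alpha0 <= alpha t) ->
  bdm beta' -> bdm gamma' ->
  {ae mu, forall t, `[a, b]%classic t -> beta t = beta' t} ->
  {ae mu, forall t, `[a, b]%classic t -> gamma t = gamma' t} ->
  mu.-integrable `[a, b] (EFin \o f) -> sobolev10 a b u ->
  solves_ode a b alpha beta gamma f u ->
  exists du : R -> R, [/\ bdm du,
    {in `]a, b[, forall t, is_derive t (1 : R) u (du t)} &
    exists k, {in `]a, b[, forall t, alpha t * du t
      - \int[mu]_(y in `[a, t]) (beta' y * du y + gamma' y * (u \_ `[a, b]) y)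
      + \int[mu]_(y in `[a, t]) f y = k}].
Proof.
move=> ab ca a0 ha bb bg bE gE if_ [su cu ua ub] [q [dq [acq qE wq dqE]]].
have cq := absolutely_continuous_within ab acq.
have alpha_neq0 t : t \in `[a, b] -> alpha t != 0.
  by move=> tab; rewrite gt_eqF// (lt_le_trans a0 (ha _ tab)).
have sub : `]a, b[ `<=` `[a, b] by exact: subset_itv_oo_cc.
(* Cut off outside [a, b] to be bounded and measurable on the whole line. *)
pose du := (fun t => q t / alpha t) \_ `[a, b].
have cqa := within_continuous_div ab cq ca alpha_neq0.
have bdu : bdm du := within_continuous_bdm (ltW ab) cqa.
have duE t : t \in `[a, b] -> du t = q t / alpha t by move=> tab; rewrite /du patchE mem_set.
have cdu : {in `]a, b[, continuous du}.
  move=> t tab; have /(_ t tab) cqat := within_in_continuous ab cqa.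
  have nearE : \forall y \near t, q y / alpha y = du y.
    by near=> y; rewrite duE//; apply: sub; near: y; exact: near_in_itvoo.
  rewrite /continuous_at duE; last exact: sub.
  by apply: cvg_trans cqat; apply: near_eq_cvg.
have mdu : measurable_fun `]a, b[ du by apply: measurable_funTS; case: bdu.
have wu := sobolev_weak_derivative su (leqnn 1).
exists du; split => //.
  apply: (weak_derivative_is_derive (within_in_continuous ab cu) wu cdu mdu).
  apply: (@filterS _ _ (ae_filter_ringOfSetsType mu) _ _ _ qE) => t + tab => /(_ tab) qt.
  rewrite duE; last exact: sub.
  by rewrite -qt mulrAC divff ?mul1r// alpha_neq0//; exact: sub.
pose F := fun y => beta' y * du y + gamma' y * (u \_ `[a, b]) y.
have bF : bdm F.
  by apply: bdmD; apply: bdmM => //; exact: within_continuous_bdm (ltW ab) cu.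
have dqF : {ae mu, forall t, t \in `]a, b[ -> dq t = F t - f t}.
  pose aeI := @filterI _ _ (ae_filter_ringOfSetsType mu).
  have := aeI _ _ (aeI _ _ bE gE) (aeI _ _ qE dqE).
  apply: (@filterS _ _ (ae_filter_ringOfSetsType mu)) => t [[bt gt] [qt dqt]] tab.
  have tab' : `[a, b]%classic t by exact: sub.
  rewrite -(dqt tab) /F -bt// -gt// patchE mem_set// duE// -(qt tab).
  rewrite (mulrC (alpha t)) mulfK ?alpha_neq0//; ring.
have iS (g : R -> R) s e : a <= s -> e <= b -> mu.-integrable `[a, b] (EFin \o g) -> mu.-integrable `[s, e] (EFin \o g).
  move=> as_ eb ig; apply: integrableS ig => // y /=; rewrite !in_itv/= => /andP[sy ye].
  by rewrite (le_trans as_ sy) (le_trans ye eb).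
have iF : mu.-integrable `[a, b] (EFin \o F) by exact: bdm_integrable_itv.
pose Q t := q t - \int[mu]_(y in `[a, t]) F y + \int[mu]_(y in `[a, t]) f y.
have QE s e : a < s -> s < e -> e < b -> Q e = Q s.
  move=> as_ se eb; have [lq [mdq _ _] _] := wq.
  have := weak_derivative_increment (within_in_continuous ab cq) wq as_ se eb.
  have -> : \int[mu]_(y in `[s, e]) dq y = \int[mu]_(y in `[s, e]) (F y - f y).
    have ssub : `[s, e]%classic `<=` `]a, b[%classic.
      by move=> y /=; rewrite !in_itv/= => /andP[sy ye]; rewrite (lt_le_trans as_ sy) (le_lt_trans ye eb).
    apply: Rint_ae => //.
    - by apply: measurable_funS mdq.
    - apply: measurable_funB; first by apply: measurable_funTS; case: bF.
      by apply/measurable_EFinP; exact: measurable_int (iS _ _ _ (ltW as_) (ltW eb) if_).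
    - apply: (@filterS _ _ (ae_filter_ringOfSetsType mu) _ _ _ dqF) => y + yse; apply; exact: ssub.
  rewrite RintegralB//; [|exact: iS (ltW as_) (ltW eb) iF|exact: iS (ltW as_) (ltW eb) if_].
  rewrite /Q (@Rint_cat _ F a s e) ?(ltW as_) ?(ltW se)//; last exact: iS (lexx a) (ltW eb) iF.
  rewrite (@Rint_cat _ f a s e) ?(ltW as_) ?(ltW se)//; last exact: iS (lexx a) (ltW eb) if_.
  lra.
exists (Q ((a + b) / 2)) => t tab.
have -> : alpha t * du t = q t by rewrite duE ?sub// mulrC divfK ?alpha_neq0// sub.
rewrite -/(Q t); move: tab; rewrite in_itv/= => /andP[at_ tb].
have [tm|mt|->//] := ltgtP t ((a + b) / 2).
- by apply/esym/QE => //; lra.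
- by apply: QE => //; lra.
Unshelve. all: by end_near. Qed.

Lemma Lnorm_on_le (a b : R) (v w : R -> R) : a < b -> measurable_fun `]a, b[ v -> bdm w ->
  {ae mu, forall t, t \in `]a, b[ -> `|v t| <= `|w t|} ->
  (Lnorm_on 2%:E `]a, b[ v ^+ 2 <= (\int[mu]_(t in `[a, b]) w t ^+ 2)%:E)%E.
Proof.
move=> ab mv bw vw; rewrite Lnorm_on_sqr//.
have bw2 : bdm (fun t => w t ^+ 2) by exact: bdmM.
have iw : mu.-integrable `]a, b[ (EFin \o (fun t => w t ^+ 2)).
  by apply: integrableS (bdm_integrable_itv a b bw2) => //; exact: subset_itv_oo_cc.
rewrite -(Rint_oo iw) /Rintegral fineK; last exact: integrable_fin_num iw.
apply: ae_ge0_le_integral => //.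
- by move=> t _; rewrite lee_fin sqr_ge0.
- by apply/measurable_EFinP; exact: measurable_funX.
- by move=> t _; rewrite lee_fin sqr_ge0.
- by apply/measurable_EFinP; apply: measurable_funTS; case: bw2.
apply: (@filterS _ _ (ae_filter_ringOfSetsType mu) _ _ _ vw) => t + tab => /(_ tab).
by rewrite lee_fin -[v t ^+ 2]real_normK ?num_real// -[w t ^+ 2]real_normK ?num_real// => H; rewrite lerXn2r// ?nnegrE.
Qed.

End ExactSolution.

(** * The energy norm *)

Section Energy.
Variable R : realType.
Local Notation mu := (@lebesgue_measure R).

(** Serves for [derive1 uP], whose values at the mesh points carry no information. *)
Lemma measurable_fun_off_finite (D K : set R) (f g : R -> R) : measurable D -> finite_set K ->
  measurable_fun D g -> (forall t, D t -> ~ K t -> f t = g t) -> measurable_fun D f.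
Proof.
move=> mD fK mg fg _ Y mY.
have mfin (A : set R) : A `<=` K -> measurable A.
  move=> AK; apply: countable_measurable; last by apply: finite_set_countable; exact: sub_finite_set fK.
  by move=> t; exact: measurable_set1.
have -> : D `&` f @^-1` Y = ((D `&` g @^-1` Y) `\` K) `|` (D `&` f @^-1` Y `&` K).
  apply/seteqP; split => t.
    move=> [Dt Yt]; have [Kt|Kt] := pselect (K t); first by right.
    by left; split => //; split => //; rewrite /preimage/= -fg.
  by move=> [[[Dt Yt] Kt]|[]//]; split => //; rewrite /preimage/= fg.
apply: measurableU; last by apply: mfin; exact: subIsetr.
by apply: measurableD; [exact: mg|exact: mfin].
Qed.

Variables (a b : R) (N : nat) (x : nat -> R).
Hypotheses (hab : a < b) (hx : is_mesh a b N x) (N1 : (1 <= N)%N).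

Lemma mesh_itv_sub k : (1 <= k <= N)%N -> a <= x k.-1 /\ x k <= b.
Proof.
move=> /andP[k1 kN]; have [<- <- _] := hx; split; apply: (mesh_mono hx) => //.
exact: leq_trans (leq_pred k) kN.
Qed.

Lemma trial_space_derive (v : R -> R) (P : nat -> {poly R}) k : (1 <= k <= N)%N ->
  {in `[x k.-1, x k], forall t, v t = (P k).[t]} ->
  {in `]x k.-1, x k[, forall t, is_derive t (1 : R) v (P k)^`().[t]}.
Proof.
move=> kN vP t tk; apply: near_eq_is_derive (is_derive_poly (P k) t).
near=> y; rewrite vP//; apply: subset_itv_oo_cc; near: y; exact: near_in_itvoo.
Unshelve. all: by end_near. Qed.

Lemma ae_off_mesh : {ae mu, forall t, ~ (x @` `I_N.+1) t}.
Proof.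
have fK : finite_set (x @` `I_N.+1) by apply: finite_image; exact: finite_II.
have cK := finite_set_countable fK.
exists (x @` `I_N.+1); split.
- by apply: countable_measurable cK => t; exact: measurable_set1.
- exact: countable_lebesgue_measure0.
- by move=> t /= /contrapT.
Qed.

Lemma mesh_find_open t : t \in `]a, b[ -> ~ (x @` `I_N.+1) t ->
  exists2 k, (1 <= k <= N)%N & x k.-1 < t < x k.
Proof.
rewrite in_itv/= => /andP[at_ tb] tx.
have [|k kN /andP[kt tk]] := mesh_find hx (t := t); first by rewrite at_ ltW.
exists k => //; rewrite kt lt_neqAle tk andbT; apply/eqP => E; apply: tx.
by exists k => //=; rewrite ltnS; case/andP: kN.
Qed.

(** As E vanishes at a, |E| is at most the sum of the h_k T_k, whose square is at most (b - a) Q by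
    Cauchy-Schwarz. Integrating over ]a, b[ gives the term (b - a)^2, and the derivative contributes
    the 1. *)
Lemma mesh_energy_bound (E dE : R -> R) (T : nat -> R) :
  {within `[a, b], continuous E} -> E a = 0 ->
  (forall k, (1 <= k <= N)%N -> 0 <= T k) ->
  (forall k, (1 <= k <= N)%N -> {in `]x k.-1, x k[, forall t, is_derive t (1 : R) E (dE t)}) ->
  (forall k, (1 <= k <= N)%N -> {in `]x k.-1, x k[, forall t, `|dE t| <= T k}) ->
  (H1norm a b E <= (Num.sqrt (((b - a) ^+ 2 + 1) *
     \sum_(1 <= k < N.+1) (x k - x k.-1) * T k ^+ 2))%:E)%E.
Proof.
move=> cE Ea T0 dEE dET; have [x0 xN xinc] := hx.
set Q := \sum_(1 <= k < N.+1) _.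
have h0 k : (1 <= k <= N)%N -> 0 < x k - x k.-1 by move=> kN; rewrite subr_gt0 xinc.
have lip k s t : (1 <= k <= N)%N -> x k.-1 <= s -> s <= t -> t <= x k ->
    `|E t - E s| <= T k * (t - s).
  move=> kN ks st tk; have [ak kb] := mesh_itv_sub kN.
  have sub y : y \in `]s, t[ -> y \in `]x k.-1, x k[.
    by rewrite !in_itv/= => /andP[sy yt]; rewrite (le_lt_trans ks sy) (lt_le_trans yt tk).
  apply: (@MVT_norm_le _ E dE) => //.
  - by move=> y /sub; exact: dEE.
  - apply: continuous_subspaceW cE => y /=; rewrite !in_itv/= => /andP[sy yt].
    by rewrite (le_trans ak (le_trans ks sy)) (le_trans yt (le_trans tk kb)).
  - by move=> y /sub; exact: dET.
pose B k : R := \sum_(1 <= i < k.+1) (x i - x i.-1) * T i.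
have BS k : (k < N)%N -> B k.+1 = B k + (x k.+1 - x k) * T k.+1 by move=> _; rewrite /B big_nat_recr.
have Badd k j : (k + j <= N)%N -> B k <= B (k + j)%N.
  elim: j => [|j IH]; first by rewrite addn0.
  rewrite addnS => kj; have kj' : (1 <= (k + j).+1 <= N)%N by [].
  by rewrite BS// (le_trans (IH (ltnW kj)))// lerDl mulr_ge0 ?T0// ltW ?(h0 _ kj').
have Bmono k : (k <= N)%N -> B k <= B N.
  by move=> kN; have := Badd k (N - k)%N; rewrite subnKC//; apply.
have EB k : (k <= N)%N -> `|E (x k)| <= B k.
  elim: k => [_|k IH kN]; first by rewrite x0 Ea normr0 /B big_geq.
  have kN' : (1 <= k.+1 <= N)%N by [].
  rewrite BS// -[E _](subrK (E (x k))) addrC (le_trans (ler_normD _ _))// lerD ?IH ?(ltnW kN)//.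
  by rewrite mulrC; apply: (lip k.+1); rewrite //= ltW// (xinc _ kN').
have BN0 : 0 <= B N by apply: le_trans (EB N (leqnn N)).
have Ebound t : t \in `]a, b[ -> `|E t| <= B N.
  rewrite in_itv/= => /andP[at_ tb].
  have [|k kN /andP[kt tk]] := mesh_find hx (t := t); first by rewrite at_ ltW.
  apply: le_trans (Bmono k _); last by case/andP: kN.
  case: k kN kt tk => // k kN kt tk; rewrite BS; last by case/andP: kN.
  rewrite -[E t](subrK (E (x k))) addrC (le_trans (ler_normD _ _))// lerD//.
    by apply: EB; case/andP: kN => _ /ltnW.
  apply: (le_trans (lip k.+1 _ _ kN (lexx _) (ltW kt) tk)).
  by rewrite mulrC ler_wpM2r ?T0// lerD2r.
have BQ : B N ^+ 2 <= (b - a) * Q.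
  have := @sqr_sum_le R _ (index_iota 1 N.+1) (fun k => (x k - x k.-1)^-1) (fun k => (x k - x k.-1) * T k).
  have -> : \sum_(k <- index_iota 1 N.+1) (x k - x k.-1)^-1^-1 = b - a.
    by under eq_bigr do rewrite invrK; rewrite mesh_sum x0 xN.
  have -> : \sum_(k <- index_iota 1 N.+1) (x k - x k.-1)^-1 * ((x k - x k.-1) * T k) ^+ 2 = Q.
    apply: eq_big_nat => k kN; have := h0 k kN; move: (x k - x k.-1) => h hp.
    by field; rewrite gt_eqF.
  by apply => k; rewrite mem_index_iota => kN; rewrite invr_gt0 h0.
have mE : measurable_fun `]a, b[ E.
  apply: (@measurable_funS _ _ _ _ `[a, b]%classic) => //; first exact: subset_itv_oo_cc.
  exact: subspace_continuous_measurable_fun.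
have A0 : (Lnorm_on 2%:E `]a, b[ E ^+ 2 <= ((b - a) ^+ 2 * Q)%:E)%E.
  apply: (le_trans (Lnorm_on_le hab mE (bdm_cst (B N)) _)).
    by apply: aeW => t tab; rewrite (ger0_norm BN0) Ebound.
  rewrite lee_fin Rintegral_cst//= lebesgue_measure_itv/= lte_fin hab -EFinB/=.
  by rewrite mulrC expr2 -mulrA ler_wpM2l// subr_ge0 ltW.
(* A piecewise constant majorant of |E'|, written with constant polynomials so that [bdm_pw_poly]
   applies. *)
pose w := pw x N (fun k => horner (T k)%:P).
have bw : bdm w by exact: (bdm_pw_poly hx).
have wE k t : (1 <= k <= N)%N -> x k.-1 < t <= x k -> w t = T k.
  by move=> kN tk; rewrite /w (pwE hx _ kN tk) hornerC.
have w0 t : t \in `]a, b[ -> 0 <= w t.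
  rewrite in_itv/= => /andP[at_ tb].
  have [|k kN tk] := mesh_find hx (t := t); first by rewrite at_ ltW.
  by rewrite (wE k)// T0.
set g := weak_derivative a b 1 E.
have [mg gw] : measurable_fun `]a, b[ g /\ {ae mu, forall t, t \in `]a, b[ -> `|g t| <= `|w t|}.
  (* Without a weak derivative, g is the default function 0 and the bound is trivial. Otherwise, at
     every Lebesgue point of g off the mesh, g is the classical derivative of E. *)
  have [ex|nex] := pselect (exists g0, is_weak_derivative a b 1 E g0); last first.
    have -> : g = fun=> 0.
      by apply: xgetPN => g0 wg0; apply: nex; exists g0.
    by split; [exact: measurable_cst|apply: aeW => t _; rewrite normr0].
  have wg : is_weak_derivative a b 1 E g := xgetPex _ ex.
  have [_ lg _] := wg; split; first by case: lg.
  pose aeI := @filterI _ _ (ae_filter_ringOfSetsType mu).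
  apply: (@filterS _ _ (ae_filter_ringOfSetsType mu) _ _ _ (aeI _ _ ae_off_mesh (ae_lebesgue_pt lg))).
  move=> t [tx lt_] tab; have [k kN ktk] := mesh_find_open tab tx.
  have incr := weak_derivative_increment (within_in_continuous hab cE) wg.
  have [_ gE] := primitive_is_derive incr lg tab (lt_ tab).
  have tk : t \in `]x k.-1, x k[ by rewrite in_itv.
  have [_ dEt] := dEE k kN t tk.
  rewrite (ger0_norm (w0 t tab)) (wE k)//; last by case/andP: ktk => -> /ltW.
  by rewrite -gE dEt; exact: dET tk.
have A1 : (Lnorm_on 2%:E `]a, b[ g ^+ 2 <= Q%:E)%E.
  apply: (le_trans (Lnorm_on_le hab mg bw gw)); rewrite lee_fin.
  apply: (le_trans (ler_norm _)); apply: (Rint_mesh_le hx (B := fun k => T k ^+ 2)).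
    by apply: bdm_integrable_itv; exact: bdmM.
  move=> k kN t /andP[kt tk]; have tk' : x k.-1 < t <= x k by rewrite kt ltW.
  by rewrite (wE k t kN tk') ger0_norm ?sqr_ge0.
have Q0 : 0 <= Q.
  rewrite /Q big_nat_cond sumr_ge0// => k /andP[kN _].
  by rewrite mulr_ge0 ?sqr_ge0// ltW ?h0.
rewrite /H1norm -powR12_sqrt; last by rewrite mulr_ge0// addr_ge0// sqr_ge0.
rewrite -poweR_EFin; apply: gt0_ler_poweR; first by rewrite invr_ge0.
- by rewrite in_itv/= leey andbT adde_ge0// sqre_ge0.
- by rewrite in_itv/= leey andbT lee_fin mulr_ge0// addr_ge0// sqr_ge0.
- have -> : ((((b - a) ^+ 2 + 1) * Q)%:E = ((b - a) ^+ 2 * Q)%:E + Q%:E)%E.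
    by rewrite -EFinD mulrDl mul1r.
  exact: leeD.
Qed.

End Energy.

(** * The error estimate *)

Section Assembly.
Variable R : realType.
Local Notation mu := (@lebesgue_measure R).

Lemma trial_space_poly (a b : R) N x r v : trial_space a b N x r v ->
  exists P : nat -> {poly R}, forall i, (1 <= i <= N)%N ->
    (size (P i) <= r.+1)%N /\ {in `[x i.-1, x i], forall t, v t = (P i).[t]}.
Proof.
move=> [_ H _ _].
have /choice[P HP] : forall i, exists p : {poly R}, (1 <= i <= N)%N ->
    (size p <= r.+1)%N /\ {in `[x i.-1, x i], forall t, v t = p.[t]}.
  move=> i; have [iN|iN] := boolP (1 <= i <= N)%N; last by exists 0.
  by have [p sp vp] := H i iN; exists p.
by exists P.
Qed.

Lemma pwB (x : nat -> R) N (F G : nat -> R -> R) t :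
  pw x N (fun i t => F i t - G i t) t = pw x N F t - pw x N G t.
Proof. by rewrite /pw -sumrB; apply: eq_bigr => i _; rewrite mulrBl. Qed.

(* The flux balance of the exact solution is the constant [k], which [J] with
   zero sum does not see. *)
Lemma error_weak_identity (r N : nat) (x G : nat -> R) (a b : R) (alpha beta gamma f : R -> R)
  (k : R) (du u' : R -> R) (P p : nat -> {poly R}) : gauss_nodes r G -> is_mesh a b N x ->
  bdm beta -> bdm gamma -> bdm du -> bdm u' ->
  (forall t, t \in `]a, b[ -> alpha t * du t
      - \int[mu]_(y in `[a, t]) (beta y * du y + gamma y * u' y) + \int[mu]_(y in `[a, t]) f y = k) ->
  (forall J : nat -> nat -> R, \sum_(1 <= i < N.+1) \sum_(1 <= j < r.+1) J i j = 0 ->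
    \sum_(1 <= i < N.+1) \sum_(1 <= j < r.+1) J i j *
      (alpha (node G (x i.-1) (x i) j) * (P i)^`().[node G (x i.-1) (x i) j]
       - \int[mu]_(t in `[a, node G (x i.-1) (x i) j])
           (beta t * pw x N (fun i => horner (P i)^`()) t + gamma t * pw x N (fun i => horner (P i)) t)) =
    - \sum_(1 <= i < N.+1) \sum_(1 <= j < r.+1) J i j *
       \int[mu]_(t in `[a, node G (x i.-1) (x i) j]) f t) ->
  forall J : nat -> nat -> R, \sum_(1 <= i < N.+1) \sum_(1 <= j < r.+1) J i j = 0 ->
  let e i := P i - p i in
  let eta1 t := du t - pw x N (fun i => horner (p i)^`()) t in
  let eta0 t := u' t - pw x N (fun i => horner (p i)) t in
  \sum_(1 <= i < N.+1) \sum_(1 <= j < r.+1) J i j *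
       (alpha (node G (x i.-1) (x i) j) * (e i)^`().[node G (x i.-1) (x i) j] -
        \int[mu]_(t in `[a, node G (x i.-1) (x i) j])
          (beta t * pw x N (fun i => horner (e i)^`()) t + gamma t * pw x N (fun i => horner (e i)) t)) =
  \sum_(1 <= i < N.+1) \sum_(1 <= j < r.+1) J i j *
       (alpha (node G (x i.-1) (x i) j) * eta1 (node G (x i.-1) (x i) j) -
        \int[mu]_(t in `[a, node G (x i.-1) (x i) j]) (beta t * eta1 t + gamma t * eta0 t)).
Proof.
move=> hG hx bb bg bdu bu exact_ discr J Jtot e eta1 eta0.
pose g i j := node G (x i.-1) (x i) j.
pose pP' := pw x N (fun i => horner (P i)^`()); pose pP := pw x N (fun i => horner (P i)).
pose pe' := pw x N (fun i => horner (e i)^`()); pose pe := pw x N (fun i => horner (e i)).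
have bP' : bdm pP' by exact: (bdm_pw_poly hx).
have bP : bdm pP by exact: (bdm_pw_poly hx).
have be' : bdm pe' by exact: (bdm_pw_poly hx).
have be : bdm pe by exact: (bdm_pw_poly hx).
have beta1 : bdm eta1 by apply: bdmB => //; exact: (bdm_pw_poly hx).
have beta0 : bdm eta0 by apply: bdmB => //; exact: (bdm_pw_poly hx).
have pe'E t : pe' t = pP' t - pw x N (fun i => horner (p i)^`()) t.
  rewrite -pwB; rewrite /pe' /pw; apply: eq_bigr => i _.
  by rewrite /e derivB hornerD hornerN.
have peE t : pe t = pP t - pw x N (fun i => horner (p i)) t.
  by rewrite -pwB; rewrite /pe /pw; apply: eq_bigr => i _; rewrite /e hornerD hornerN.
have bF v0 v1 : bdm v0 -> bdm v1 -> bdm (fun t => beta t * v1 t + gamma t * v0 t).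
  by move=> b0 b1; apply: bdmD; apply: bdmM.
pose I v1 v0 t : R := \int[mu]_(y in `[a, t]) (beta y * v1 y + gamma y * v0 y).
have Isplit t : I pe' pe t + I du u' t = I eta1 eta0 t + I pP' pP t.
  rewrite /I -!RintegralD//; try by apply: bdm_integrable_itv; exact: bF.
  by apply: eq_Rintegral => y _; rewrite pe'E peE /eta1 /eta0; ring.
have := discr J Jtot; set s1 := \sum_(1 <= i < N.+1) _; set s2 := \sum_(1 <= i < N.+1) _ => s12.
apply/eqP; rewrite -subr_eq0 -sumrB.
have -> : \sum_(1 <= i < N.+1) (\sum_(1 <= j < r.+1) J i j * (alpha (g i j) * (e i)^`().[g i j] - I pe' pe (g i j))
    - \sum_(1 <= j < r.+1) J i j * (alpha (g i j) * eta1 (g i j) - I eta1 eta0 (g i j)))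
  = s1 + s2 - k * \sum_(1 <= i < N.+1) \sum_(1 <= j < r.+1) J i j.
  rewrite /s1 /s2 mulr_sumr -big_split -sumrB; apply: eq_big_nat => i iN.
  rewrite mulr_sumr -big_split -!sumrB; apply: eq_big_nat => j jr.
  have iN' : (1 <= i <= N)%N by [].
  have /andP[g1 g2] : x i.-1 < g i j < x i.
    by have [_ _ xinc] := hx; exact: (node_bounds hG (xinc _ iN') jr).
  have gab : g i j \in `]a, b[.
    have [ai ib] := mesh_itv_sub hx iN'.
    by rewrite in_itv/= (le_lt_trans ai g1) (lt_le_trans g2 ib).
  have -> : eta1 (g i j) = du (g i j) - (p i)^`().[g i j].
    by rewrite /eta1 (pwE hx _ iN')// g1 ltW.
  rewrite /e derivB hornerD hornerN -/(g i j) -/(I pP' pP (g i j)) -(exact_ _ gab) -/(I du u' _).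
  have := Isplit (g i j); move: (I pe' pe _) (I du u' _) (I eta1 eta0 _) (I pP' pP _) => i1 i2 i3 i4 H.
  have -> : i1 = i3 + i4 - i2 by rewrite -H addrK.
  by rewrite /=; ring.
by rewrite s12 Jtot mulr0 subr0 addNr.
Qed.

End Assembly.

Theorem corollary3p4 (R : realType) (r : nat) (hr : (1 <= r)%N)
  (G : nat -> R) (hG : gauss_nodes r G)
  (a b : R) (hab : a < b)
  (alpha beta dbeta gamma : R -> R) (alpha0 kappa : R)
  (halphaL : in_Lp +oo%E `[a, b] alpha)
  (hbetaL : in_Lp +oo%E `[a, b] beta)
  (hgammaL : in_Lp +oo%E `[a, b] gamma)
  (halphaC : {within `[a, b], continuous alpha})
  (hbetaW : is_weak_derivative a b 1 beta dbeta)
  (halpha0 : 0 < alpha0)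
  (halpha : forall t, t \in `[a, b] -> alpha0 <= alpha t)
  (hkappa : 0 < kappa)
  (hcoer : {ae (@lebesgue_measure R), forall t, t \in `]a, b[ ->
              kappa <= gamma t - 2^-1 * dbeta t}) :
  exists h0 C : R, 0 < h0 /\
    forall (f u : R -> R) (N : nat) (x : nat -> R) (uP : R -> R),
      (@lebesgue_measure R).-integrable `[a, b] (EFin \o f) ->
      is_mesh a b N x ->
      mesh_size N x <= h0 ->
      sobolev10 a b u ->
      broken_sobolev a b N x r.+1 u ->
      solves_ode a b alpha beta gamma f u ->
      fv_solution a b alpha beta gamma f N x r G uP ->
      (H1norm a b (u \- uP)%R
         <= (C * mesh_size N x ^+ r)%:E * broken_seminorm N x r.+1 u)%E.
Proof.
have mab : measurable `[a, b]%classic by [].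
have sub : `]a, b[ `<=` `[a, b] by exact: subset_itv_oo_cc.
have [beta' [bb bE]] := in_Linfty_truncate mab hbetaL.
have [gamma' [bg gE]] := in_Linfty_truncate mab hgammaL.
have [M1 beta_M] : exists M1, forall t, `|beta' t| <= M1 by case: bb => _ [M1 H]; exists M1.
have [M2 gamma_M] : exists M2, forall t, `|gamma' t| <= M2 by case: bg => _ [M2 H]; exists M2.
have [M3 alpha_M] := within_continuous_bounded (ltW hab) halphaC.
have M10 : 0 <= M1 by exact: le_trans (normr_ge0 _) (beta_M 0).
have M20 : 0 <= M2 by exact: le_trans (normr_ge0 _) (gamma_M 0).
have M30 : 0 <= M3.
  by apply: le_trans (normr_ge0 _) (alpha_M a _); rewrite in_itv/= lexx ltW.
pose M := M1 + M2 + M3.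
have betaM t : `|beta' t| <= M by rewrite (le_trans (beta_M t))// /M; lra.
have gammaM t : `|gamma' t| <= M by rewrite (le_trans (gamma_M t))// /M; lra.
have alphaM t : t \in `[a, b] -> `|alpha t| <= M.
  by move=> tab; rewrite (le_trans (alpha_M t tab))// /M; lra.
have wbeta : is_weak_derivative a b 1 beta' dbeta.
  apply: weak_derivative_ae hbetaW _ (bdm_locally_integrable a b bb).
  apply: (@filterS _ _ (ae_filter_ringOfSetsType _) _ _ _ bE) => t + tab; apply; exact: sub.
have coer : {ae (@lebesgue_measure R), forall t, t \in `]a, b[ -> kappa <= gamma' t - 2^-1 * dbeta t}.
  pose aeI := @filterI _ _ (ae_filter_ringOfSetsType (@lebesgue_measure R)).
  apply: (@filterS _ _ (ae_filter_ringOfSetsType _) _ _ _ (aeI _ _ gE hcoer)) => t [gt ct] tab.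
  by rewrite -gt; [exact: ct|exact: sub].
have [h0 [C0 [h00 C00 stab]]] := stability hr hG hab bb bg betaM gammaM alphaM halpha0 halpha
  wbeta (ltW hkappa) coer.
(* The first factor comes from [mesh_energy_bound]. For the second, (S + H)^2 is at most 2 S^2 + 2
   H^2, stability bounds the S part by C0 times the H part, and the H part is at most 4 h^(2 r)
   |u|^2: in all 8 C0 + 8. *)
pose Csq := ((b - a) ^+ 2 + 1) * (8 * (C0 + 1)).
have Csq0 : 0 < Csq by rewrite mulr_gt0 ?mulr_gt0 ?ltr_wpDl ?sqr_ge0.
exists h0, (Num.sqrt Csq); split => // f u N x uP if_ hx hh0 hu hbu hode hfv.
have [x0 xN xinc] := hx.
have N1 : (1 <= N)%N by case: N xN {hx hh0 hbu hfv xinc} => // xN; move: hab; rewrite -x0 -xN ltxx.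
have [su cu ua ub] := hu.
have [du [bdu du_u [k exk]]] := exact_solution hab halphaC halpha0 halpha bb bg bE gE if_ hu hode.
pose u' := u \_ `[a, b].
have bu : bdm u' := within_continuous_bdm (ltW hab) cu.
have [trial _] := hfv; have [cuP _ uPa uPb] := trial.
have [P HP] := trial_space_poly trial.
set h := mesh_size N x in hh0 *.
have hk k' : (1 <= k' <= N)%N -> 0 < x k' - x k'.-1 <= h.
  by move=> kN; rewrite subr_gt0 xinc//= mesh_size_le.
have hpos : 0 < h by have /andP[h1 h2] := hk 1%N N1; exact: lt_le_trans h1 h2.
have isub i : (1 <= i <= N)%N -> forall t, t \in `[x i.-1, x i] -> t \in `[a, b].
  move=> iN t; have [ai ib] := mesh_itv_sub hx iN.
  by rewrite !in_itv/= => /andP[t1 t2]; rewrite (le_trans ai t1) (le_trans t2 ib).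
have isubo i : (1 <= i <= N)%N -> forall t, t \in `]x i.-1, x i[ -> t \in `]a, b[.
  move=> iN t; have [ai ib] := mesh_itv_sub hx iN.
  by rewrite !in_itv/= => /andP[t1 t2]; rewrite (le_lt_trans ai t1) (lt_le_trans t2 ib).
pose Lk k' := Lnorm_on 2%:E `]x k'.-1, x k'[ (weak_derivative (x k'.-1) (x k') r.+1 u).
have Lk0 k' : (0 <= Lk k' ^+ 2)%E by exact: sqre_ge0.
rewrite /broken_seminorm -/Lk.
(* If the seminorm is infinite, so is the right-hand side, its constant being positive. Otherwise
   each local norm is finite and real arithmetic suffices. *)
have [sumoo|] := eqVneq (\sum_(1 <= i < N.+1) Lk i ^+ 2)%E +oo%E.
  rewrite sumoo poweRyr ?invr_eq0 ?pnatr_eq0// gt0_muley ?leey// lte_fin.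
  by rewrite mulr_gt0 ?sqrtr_gt0// exprn_gt0.
move=> sumoo.
have Lkoo k' : (1 <= k' <= N)%N -> (Lk k' < +oo)%E.
  move=> kN; rewrite ltey; apply: contra sumoo => /eqP Loo.
  have L2 : (Lk k' ^+ 2 = +oo)%E by rewrite Loo.
  rewrite (bigD1_seq k') ?mem_index_iota ?iota_uniq// L2.
  by rewrite -leye_eq; apply: leeDl; apply: sume_ge0 => i _; exact: Lk0.
pose d k' : R := \int[@lebesgue_measure R]_(t in `]x k'.-1, x k'[) weak_derivative (x k'.-1) (x k') r.+1 u t ^+ 2.
have d0 k' : 0 <= d k' by apply: Rintegral_ge0 => t _; exact: sqr_ge0.
have [_ sob] := hbu.
have LkE k' : (1 <= k' <= N)%N -> (Lk k' ^+ 2 = (d k')%:E)%E.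
  move=> kN; have [_ [mD _ _] _] := sobolev_weak_derivative (sob k' kN) (leqnn _).
  have [iD2 _] := sqr_integrable mD (Lkoo k' kN).
  by rewrite /Lk Lnorm_on_sqr// /d /Rintegral fineK//; exact: integrable_fin_num iD2.
have -> : (\sum_(1 <= i < N.+1) Lk i ^+ 2)%E = (\sum_(1 <= i < N.+1) d i)%:E.
  by rewrite -sumEFin; apply: eq_big_nat => i iN; rewrite LkE.
have /choice[pK HpK] : forall i, exists pK : {poly R} * R, (1 <= i <= N)%N ->
    [/\ (size pK.1 <= r.+1)%N, pK.1.[x i.-1] = u (x i.-1), pK.1.[x i] = u (x i) &
     [/\ 0 <= pK.2, pK.2 ^+ 2 <= (x i - x i.-1) * d i &
      {in `]x i.-1, x i[, forall t, `|du t - pK.1^`().[t]| <= 2 * pK.2 * (x i - x i.-1) ^+ r.-1}]].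
  move=> i; have [iN|iN] := boolP (1 <= i <= N)%N; last by exists (0, 0).
  have [p [K H]] := sobolev_element_approx hr (xinc i iN)
    (continuous_subspaceW (isub i iN) cu) (fun t ti => du_u t (isubo i iN t ti)) (sob i iN) (Lkoo i iN).
  by exists (p, K).
pose p i := (pK i).1; pose H i := 2 * (pK i).2 * (x i - x i.-1) ^+ r.-1.
have H0 i : (1 <= i <= N)%N -> 0 <= H i.
  move=> iN; have [_ _ _ [K0 _ _]] := HpK i iN; have /andP[hi _] := hk i iN.
  by rewrite /H !mulr_ge0// exprn_ge0// ltW.
have dpH i : (1 <= i <= N)%N -> {in `]x i.-1, x i[, forall t, `|du t - (p i)^`().[t]| <= H i}.
  by move=> iN; have [_ _ _ [_ _ HH]] := HpK i iN.
pose e i := P i - p i.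
pose eta1 t := du t - pw x N (fun i => horner (p i)^`()) t.
pose eta0 t := u' t - pw x N (fun i => horner (p i)) t.
have node_in i : (i <= N)%N -> x i \in `[a, b].
  by move=> iN; rewrite in_itv/= -x0 -xN !(mesh_mono hx).
have uPx i : (1 <= i <= N)%N -> (P i).[x i] = uP (x i) /\ (P i).[x i.-1] = uP (x i.-1).
  move=> iN; have [_ HPi] := HP i iN.
  by split; rewrite -HPi// in_itv/= lexx ltW ?xinc.
have eta1_le i t : (1 <= i <= N)%N -> x i.-1 < t < x i -> `|eta1 t| <= H i.
  move=> iN /andP[t1 t2]; rewrite /eta1 (pwE hx _ iN); last by rewrite t1 ltW.
  by apply: dpH => //; rewrite in_itv/= t1.
(* u - p vanishes at the left end of the element, so the bound on its derivative is multiplied by a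
   length at most b - a. *)
have eta0_le i t : (1 <= i <= N)%N -> x i.-1 < t < x i -> `|eta0 t| <= (b - a) * H i.
  move=> iN /andP[t1 t2]; rewrite /eta0 (pwE hx _ iN); last by rewrite t1 ltW.
  have tab : t \in `[a, b] by apply: (isub i iN); rewrite in_itv/= !ltW.
  rewrite /u' patchE mem_set//.
  have [_ pl _ _] := HpK i iN.
  have := @MVT_norm_le R (fun t => u t - (p i).[t]) (fun t => du t - (p i)^`().[t]) (x i.-1) t (H i).
  rewrite /= pl subrr subr0 => mvt.
  apply: (le_trans (mvt _ _ (ltW t1) _)).
  - move=> y; rewrite in_itv/= => /andP[y1 y2].
    have yo : y \in `]x i.-1, x i[ by rewrite in_itv/= y1 (lt_trans y2 t2).
    have dy := du_u y (isubo i iN y yo).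
    exact: (is_deriveB dy (is_derive_poly (p i) y)).
  - have ci : {within `[x i.-1, t], continuous u}.
      apply: continuous_subspaceW cu => y; rewrite /= in_itv/= => /andP[y1 y2].
      by apply: (isub i iN); rewrite in_itv/= y1 (le_trans y2 (ltW t2)).
    have cp : {within `[x i.-1, t], continuous (horner (p i))}.
      by apply: continuous_subspaceT => y; exact: continuous_horner.
    by move=> y; exact: (cvgB (ci y) (cp y)).
  - by move=> y; rewrite in_itv/= => /andP[y1 y2]; apply: dpH => //; rewrite in_itv/= y1 (lt_trans y2 t2).
  rewrite mulrC ler_wpM2r ?H0//.
  by have [ai ib] := mesh_itv_sub hx iN; exact: lerB (le_trans (ltW t2) ib) ai.
have beta1 : bdm eta1 by apply: bdmB => //; exact: (bdm_pw_poly hx).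
have beta0 : bdm eta0 by apply: bdmB => //; exact: (bdm_pw_poly hx).
pose pP' := pw x N (fun i => horner (P i)^`()); pose pP := pw x N (fun i => horner (P i)).
have bP' : bdm pP' by exact: (bdm_pw_poly hx).
have bP : bdm pP by exact: (bdm_pw_poly hx).
(* [pw] covers half-open elements and is 0 at a, which agrees with the boundary value of uP. *)
have uPE t : t \in `[a, b] -> uP t = pP t.
  rewrite in_itv/= => /andP[]; rewrite le_eqVlt => /predU1P[<- _|at_ tb].
    by rewrite /pP (pw_left hx).
  have [|i iN ti] := mesh_find hx (t := t); first by rewrite at_.
  rewrite /pP (pwE hx _ iN ti); have [_ HPi] := HP i iN; apply: HPi.
  by case/andP: ti => t1 t2; rewrite in_itv/= t2 ltW.
have duPi i t : (1 <= i <= N)%N -> t \in `]x i.-1, x i[ -> derive1 uP t = (P i)^`().[t].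
  move=> iN ti; have [_ HPi] := HP i iN.
  by have [_ <-] := trial_space_derive iN HPi ti; rewrite derive1E.
have duPE t : t \in `]a, b[ -> ~ (x @` `I_N.+1) t -> derive1 uP t = pP' t.
  move=> tab tx; have [i iN ti] := mesh_find_open hx tab tx.
  rewrite (duPi i)//.
  by rewrite /pP' (pwE hx _ iN)//; case/andP: ti => -> /ltW.
have mends t : t \in `[a, b] -> ~ (x @` `I_N.+1) t -> t \in `]a, b[.
  rewrite !in_itv/= => /andP[ta tb] tx; rewrite !lt_neqAle ta tb !andbT; apply/andP; split.
    by apply/eqP => E; apply: tx; exists 0%N => //; rewrite x0.
  by apply/eqP => E; apply: tx; exists N => //; rewrite ?xN /=.
(* Under the integrals of the scheme, the coefficients and [derive1 uP] are exchanged for bounded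
   representatives, with equality outside the mesh points and two null sets. *)
have aeF : {ae (@lebesgue_measure R), forall t, `[a, b]%classic t ->
    beta t * derive1 uP t + gamma t * uP t = beta' t * pP' t + gamma' t * pP t}.
  pose aeI := @filterI _ _ (ae_filter_ringOfSetsType (@lebesgue_measure R)).
  apply: (@filterS _ _ (ae_filter_ringOfSetsType _) _ _ _ (aeI _ _ (ae_off_mesh N x) (aeI _ _ bE gE))).
  move=> t [tx [bt gt]] tab; rewrite bt// gt// uPE//; have tab' := mends t tab tx.
  by rewrite duPE.
have mduP : measurable_fun `[a, b] (derive1 uP).
  apply: (@measurable_fun_off_finite _ _ (x @` `I_N.+1) _ pP') => //.
  - by apply: finite_image; exact: finite_II.
  - by apply: measurable_funTS; case: bP'.
  - by move=> t tab tx; apply: duPE => //; exact: mends.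
have mFP : measurable_fun `[a, b] (fun t => beta t * derive1 uP t + gamma t * uP t).
  apply: measurable_funD; apply: measurable_funM => //; [by case: hbetaL|by case: hgammaL|].
  exact: subspace_continuous_measurable_fun.
have bFP : bdm (fun t => beta' t * pP' t + gamma' t * pP t) by apply: bdmD; apply: bdmM.
have mFP' : measurable_fun `[a, b] (fun t => beta' t * pP' t + gamma' t * pP t).
  by apply: measurable_funTS; case: bFP.
have iFP : (@lebesgue_measure R).-integrable `[a, b] (EFin \o (fun t => beta t * derive1 uP t + gamma t * uP t)).
  have /integrableP[_ iFPoo] := bdm_integrable_itv a b bFP.
  apply/integrableP; split; first exact/measurable_EFinP.
  apply: le_lt_trans iFPoo; rewrite le_eqVlt; apply/orP; left; apply/eqP.
  apply: (@ae_eq_integral _ _ _ (@lebesgue_measure R) `[a, b]%classic) => //.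
  - by apply: measurableT_comp => //; exact/measurable_EFinP.
  - by apply: measurableT_comp => //; exact/measurable_EFinP.
  - by apply: (@filterS _ _ (ae_filter_ringOfSetsType _) _ _ _ aeF) => t + tab => /= ->.
have weak := fv_weak hr hG hx N1 hfv if_ iFP.
have discr (J : nat -> nat -> R) : \sum_(1 <= i < N.+1) \sum_(1 <= j < r.+1) J i j = 0 ->
    \sum_(1 <= i < N.+1) \sum_(1 <= j < r.+1) J i j *
      (alpha (node G (x i.-1) (x i) j) * (P i)^`().[node G (x i.-1) (x i) j]
       - \int[@lebesgue_measure R]_(t in `[a, node G (x i.-1) (x i) j])
           (beta' t * pP' t + gamma' t * pP t)) =
    - \sum_(1 <= i < N.+1) \sum_(1 <= j < r.+1) J i j *
       \int[@lebesgue_measure R]_(t in `[a, node G (x i.-1) (x i) j]) f t.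
  move=> Jtot; rewrite -weak//; apply: eq_big_nat => i iN; apply: eq_big_nat => j jr.
  have iN' : (1 <= i <= N)%N by [].
  have gi := node_bounds hG (xinc i iN') jr.
  have gio : node G (x i.-1) (x i) j \in `]x i.-1, x i[ by rewrite in_itv.
  have gab := isubo i iN' _ gio.
  have gsub : `[a, node G (x i.-1) (x i) j]%classic `<=` `[a, b]%classic.
    by apply: subset_itvl; rewrite bnd_simp; move: gab; rewrite in_itv/= => /andP[_ /ltW].
  rewrite (duPi i)//; congr (_ * (_ - _)); apply: Rint_ae => //.
  - exact: measurable_funS mFP'.
  - exact: measurable_funS mFP.
  - apply: (@filterS _ _ (ae_filter_ringOfSetsType _) _ _ _ aeF) => t + ta.
    by move=> ->//; exact: gsub.
have ident := error_weak_identity p hG hx bb bg bdu bu exk discr.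
have size_e i : (1 <= i <= N)%N -> (size (e i) <= r.+1)%N.
  move=> iN; have [sP _] := HP i iN; have [sp _ _ _] := HpK i iN.
  by rewrite (leq_trans (size_polyD _ _))// geq_max size_polyN sP.
have eR i : (1 <= i <= N)%N -> (e i).[x i] = uP (x i) - u (x i).
  by move=> iN; have [_ _ pr _] := HpK i iN; rewrite /e hornerD hornerN (uPx i iN).1 /p pr.
have eL i : (1 <= i <= N)%N -> (e i).[x i.-1] = uP (x i.-1) - u (x i.-1).
  by move=> iN; have [_ pl _ _] := HpK i iN; rewrite /e hornerD hornerN (uPx i iN).2 /p pl.
have cont_e i : (1 <= i < N)%N -> (e i).[x i] = (e i.+1).[x i].
  move=> /andP[i1 iN]; have iN1 : (1 <= i <= N)%N by rewrite i1 ltnW.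
  have iN2 : (1 <= i.+1 <= N)%N by [].
  by have := eL i.+1 iN2; rewrite succnK => ->; exact: eR.
have e_a : (e 1%N).[a] = 0 by have := eL 1%N N1; rewrite /= x0 uPa ua subrr.
have e_b : (e N).[b] = 0 by have := eR N; rewrite N1 leqnn xN uPb ub subrr; exact.
have [S [S0 eS SH]] := stab N x e eta1 eta0 H hx N1 hh0 size_e cont_e e_a e_b beta1 beta0 H0
  (fun k' kN t tk => conj (eta1_le k' t kN tk) (eta0_le k' t kN tk)) ident.
have T0 i : (1 <= i <= N)%N -> 0 <= S i + H i by move=> iN; rewrite addr_ge0 ?S0 ?H0.
have pP'E i t : (1 <= i <= N)%N -> t \in `]x i.-1, x i[ -> pP' t = (P i)^`().[t].
  by rewrite in_itv/= => iN /andP[t1 t2]; rewrite /pP' (pwE hx _ iN)// t1 ltW.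
have cE : {within `[a, b], continuous (u \- uP)%R} by move=> y; exact: (cvgB (cu y) (cuP y)).
have Ea : (u \- uP)%R a = 0 by rewrite /= ua uPa subrr.
have dE i : (1 <= i <= N)%N -> {in `]x i.-1, x i[, forall t, is_derive t (1 : R) (u \- uP)%R (du t - pP' t)}.
  move=> iN t ti; have [_ HPi] := HP i iN; rewrite (pP'E i)//.
  exact: (is_deriveB (du_u t (isubo i iN t ti)) (trial_space_derive iN HPi ti)).
have dET i : (1 <= i <= N)%N -> {in `]x i.-1, x i[, forall t, `|du t - pP' t| <= S i + H i}.
  move=> iN t ti; rewrite (pP'E i)//; have := dpH i iN t ti.
  have := eS i iN t; rewrite /e derivB hornerD hornerN.
  have -> : x i.-1 <= t <= x i by move: ti; rewrite in_itv/= => /andP[/ltW -> /ltW].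
  move=> /(_ isT) H1 H2.
  have -> : du t - (P i)^`().[t] = (du t - (p i)^`().[t]) - ((P i)^`().[t] - (p i)^`().[t]) by ring.
  by rewrite (le_trans (ler_normB _ _))// addrC lerD.
apply: (le_trans (mesh_energy_bound hab hx cE Ea T0 dE dET)).
set Dsum := \sum_(1 <= i < N.+1) d i; have D0 : 0 <= Dsum by apply: sumr_ge0.
have hr0 : 0 <= h ^+ r by rewrite exprn_ge0// ltW.
rewrite poweR_EFin powR12_sqrt// -EFinM lee_fin.
have -> : Num.sqrt Csq * h ^+ r * Num.sqrt Dsum = Num.sqrt (Csq * (h ^+ r) ^+ 2 * Dsum).
  rewrite [RHS]sqrtrM; last exact: mulr_ge0 (ltW Csq0) (sqr_ge0 _).
  by rewrite [X in _ = X * _]sqrtrM ?(ltW Csq0)// sqrtr_sqr ger0_norm.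
apply: ler_wsqrtr; have -> : Csq * (h ^+ r) ^+ 2 * Dsum =
    ((b - a) ^+ 2 + 1) * (8 * ((C0 + 1) * ((h ^+ r) ^+ 2 * Dsum))) by rewrite /Csq !mulrA.
apply: ler_wpM2l; first by rewrite addr_ge0// sqr_ge0.
(* On each element h H^2 = 4 h^(2 r - 1) K^2, and the bound of K^2 by h times the integral of the
   squared derivative supplies the missing power of h. *)
have HD : \sum_(1 <= i < N.+1) (x i - x i.-1) * H i ^+ 2 <= 4 * ((h ^+ r) ^+ 2 * Dsum).
  rewrite !mulr_sumr; apply: ler_sum_nat => i iN; have iN' : (1 <= i <= N)%N by [].
  have [_ _ _ [K0 KD _]] := HpK i iN'; have /andP[hi0 hih] := hk i iN'.
  apply: (@le_trans _ _ (4 * (((x i - x i.-1) ^+ r) ^+ 2 * d i))).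
    have hrE (y : R) : y ^+ r = y * y ^+ r.-1 by rewrite -exprS prednK.
    rewrite /H hrE; move: KD hi0.
    move: (pK i).2 (x i - x i.-1) (d i) => K hi di KD hi0.
    have -> : hi * (2 * K * hi ^+ r.-1) ^+ 2 = 4 * (hi * (hi ^+ r.-1) ^+ 2) * K ^+ 2 by ring.
    have -> : 4 * ((hi * hi ^+ r.-1) ^+ 2 * di) = 4 * (hi * (hi ^+ r.-1) ^+ 2) * (hi * di) by ring.
    by apply: ler_wpM2l => //; exact: mulr_ge0 (ler0n _ 4) (mulr_ge0 (ltW hi0) (sqr_ge0 _)).
  rewrite ler_wpM2l// ler_wpM2r// lerXn2r// ?nnegrE ?exprn_ge0// ?(ltW hi0)//.
  by rewrite lerXn2r// ?nnegrE ltW.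
have ST : \sum_(1 <= i < N.+1) (x i - x i.-1) * (S i + H i) ^+ 2 <=
    2 * \sum_(1 <= i < N.+1) (x i - x i.-1) * S i ^+ 2 + 2 * \sum_(1 <= i < N.+1) (x i - x i.-1) * H i ^+ 2.
  rewrite !mulr_sumr -big_split; apply: ler_sum_nat => i iN; have /andP[hi0 _] := hk i iN.
  have := mulr_ge0 (ltW hi0) (sqr_ge0 (S i - H i)).
  rewrite /=; move: (x i - x i.-1) (S i) (H i) => hi s1 s2 H1; lra.
apply: (le_trans ST); move: SH HD; set X := \sum_(1 <= i < N.+1) _ * S _ ^+ 2.
set Y := \sum_(1 <= i < N.+1) _ * H _ ^+ 2; set Z := _ * Dsum => SH HD.
have Y4 : C0 * Y <= C0 * (4 * Z) by exact: ler_wpM2l.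
have -> : 8 * ((C0 + 1) * Z) = 2 * (C0 * (4 * Z)) + 2 * (4 * Z) by ring.
by rewrite lerD// ler_wpM2l// (le_trans SH).
Qed.
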